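(* Let $r\ge 1$ and $n\ge 1$ be integers, let $A=\mathbb{C}[x,y]/(xy)$ be the coordinate ring of $M=\{(x,y)\in\mathbb{C}^2 : xy=0\}$, and let $W_M(\{0\}_{n\omega_1})$ be the local Weyl module over $\mathfrak{sl}_{r+1}\otimes A$ at the double point $0=(0,0)$ with weight $n\omega_1$. Then there is an isomorphism of $\mathfrak{sl}_{r+1}$-modules $$W_M(\{0\}_{n\omega_1})\;\simeq\;V_{r+1}^{\otimes n}\;\oplus\;(n-1)\left(V_{r+1}^{\otimes (n-2)}\otimes\wedge^2 V_{r+1}\right),$$ where $(n-1)N$ denotes the direct sum of $n-1$ copies of $N$ (the second summand is zero if $n=1$).
   Context: $V_{r+1}=\mathbb{C}^{r+1}$ is the vector representation of $\mathfrak{sl}_{r+1}$ and $\omega_1$ is its highest weight. Let $\mathfrak{sl}_{r+1}=\mathfrak{n}_+\oplus\mathfrak{h}\oplus\mathfrak{n}_-$ be the triangular decomposition. The Lie algebra $\mathfrak{sl}_{r+1}\otimes A$ has bracket $[a\otimes P,b\otimes Q]=[a,b]\otimes PQ$, and $\mathfrak{sl}_{r+1}$ is identified with $\mathfrak{sl}_{r+1}\otimes 1$. For a dominant integrable weight $\lambda\in\mathfrak{h}^*$, the local Weyl module $W_M(\{0\}_\lambda)$ is the maximal (i.e. universal: every other such module is a quotient of it, with cyclic vector mapping to cyclic vector) $(\mathfrak{sl}_{r+1}\otimes A)$-module that is integrable as an $\mathfrak{sl}_{r+1}$-module and is generated by a cyclic vector $v_0$ satisfying $$(\mathfrak{n}_+\otimes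 P)v_0=0,\qquad (h\otimes P)v_0=\lambda(h)P(0)v_0\qquad\text{for all }P\in A,\ h\in\mathfrak{h}.$$ *)

(* Defs.v *)
From HB Require Import structures.
From mathcomp Require Import all_boot all_order all_algebra.
From mathcomp Require Import boolp reals.
From mathcomp Require Import complex mpoly.
From mathcomp Require Import ring.

Set Implicit Arguments.
Unset Strict Implicit.
Unset Printing Implicit Defensive.

Import Order.TTheory GRing.Theory Num.Theory.

Local Open Scope ring_scope.

HB.mixin Record Lmodule_isLie (K : comNzRingType) L of GRing.Lmodule K L := {
  lie : L -> L -> L;
  lie_linearl : forall z c x y, lie (c *: x + y) z = c *: lie x z + lie y z;
  lie_linearr : forall x c y z, lie x (c *: y + z) = c *: lie x y + lie x z;
  liexx : forall x, lie x x = 0;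
  lie_jacobi : forall x y z,
    lie x (lie y z) + lie y (lie z x) + lie z (lie x y) = 0
}.

#[short(type="lieAlgType")]
HB.structure Definition LieAlgebra (K : comNzRingType) :=
  {L of GRing.Lmodule K L & Lmodule_isLie K L}.

Record lieMod (K : comNzRingType) (L : lieAlgType K) := LieMod {
  carrier :> lmodType K;
  act : L -> carrier -> carrier;
  act_linearl : forall v c x y, act (c *: x + y) v = c *: act x v + act y v;
  act_linearr : forall x c u v, act x (c *: u + v) = c *: act x u + act x v;
  act_lie : forall x y v, act (lie x y) v = act x (act y v) - act y (act x v)
}.

HB.instance Definition _ (K : comNzRingType) (L : lieAlgType K) (M : lieMod L)
    (x : L) :=
  GRing.isLinear.Build K M M *:%R (@act K L M x) (@act_linearr K L M x).

Section LieModules.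
Variables (K : comNzRingType) (L : lieAlgType K).

Definition lie_equivariant (M N : lieMod L) (f : M -> N) : Prop :=
  forall x v, f (act x v) = act x (f v).

Definition lie_isomorphic (M N : lieMod L) : Prop :=
  exists f : {linear M -> N}, bijective f /\ lie_equivariant f.

Definition cyclic_vector (M : lieMod L) (v0 : M) : Prop :=
  forall S : M -> Prop,
    (forall c u v, S u -> S v -> S (c *: u + v)) ->
    (forall x v, S v -> S (act x v)) ->
    S v0 -> forall v, S v.

Definition triv_act (x : L) (c : K^o) : K^o := 0.
Fact triv_act_linearl v c x y :
  triv_act (c *: x + y) v = c *: triv_act x v + triv_act y v.
Proof. by rewrite /triv_act scaler0 addr0. Qed.
Fact triv_act_linearr x c u v :
  triv_act x (c *: u + v) = c *: triv_act x u + triv_act x v.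
Proof. by rewrite /triv_act scaler0 addr0. Qed.
Fact triv_act_lie x y v :
  triv_act (lie x y) v = triv_act x (triv_act y v) - triv_act y (triv_act x v).
Proof. by rewrite /triv_act subr0. Qed.
Definition triv_mod : lieMod L :=
  LieMod triv_act_linearl triv_act_linearr triv_act_lie.

Section DirectSum.
Variables M N : lieMod L.
Definition dsum_act (x : L) (u : M * N) : M * N := (act x u.1, act x u.2).
Fact dsum_act_linearl v c x y :
  dsum_act (c *: x + y) v = c *: dsum_act x v + dsum_act y v.
Proof. by rewrite /dsum_act !act_linearl. Qed.
Fact dsum_act_linearr x c u v :
  dsum_act x (c *: u + v) = c *: dsum_act x u + dsum_act x v.
Proof. by rewrite /dsum_act /= !act_linearr. Qed.
Fact dsum_act_lie x y v :
  dsum_act (lie x y) v = dsum_act x (dsum_act y v) - dsum_act y (dsum_act x v).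
Proof. by rewrite /dsum_act /= !act_lie. Qed.
Definition dsum : lieMod L :=
  LieMod dsum_act_linearl dsum_act_linearr dsum_act_lie.
End DirectSum.

Section Copies.
Variables (k : nat) (M : lieMod L).
Definition copies_act (x : L) (f : {ffun 'I_k -> M}) : {ffun 'I_k -> M} :=
  [ffun i => act x (f i)].
Fact copies_act_linearl f c x y :
  copies_act (c *: x + y) f = c *: copies_act x f + copies_act y f.
Proof. by apply/ffunP=> i; rewrite !ffunE act_linearl. Qed.
Fact copies_act_linearr x c f h :
  copies_act x (c *: f + h) = c *: copies_act x f + copies_act x h.
Proof. by apply/ffunP=> i; rewrite !ffunE act_linearr. Qed.
Fact copies_act_lie x y f :
  copies_act (lie x y) f
    = copies_act x (copies_act y f) - copies_act y (copies_act x f).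
Proof. by apply/ffunP=> i; rewrite !ffunE act_lie. Qed.
Definition copies : lieMod L :=
  LieMod copies_act_linearl copies_act_linearr copies_act_lie.
End Copies.

Section Restrict.
Variables (L' : lieAlgType K) (phi : {linear L' -> L}).
Hypothesis phi_lie : {morph phi : x y / lie x y}.
Variable M : lieMod L.
Definition restrict_act (x : L') (v : M) : M := act (phi x) v.
Fact restrict_act_linearl v c x y :
  restrict_act (c *: x + y) v = c *: restrict_act x v + restrict_act y v.
Proof. by rewrite /restrict_act linearP act_linearl. Qed.
Fact restrict_act_linearr x c u v :
  restrict_act x (c *: u + v) = c *: restrict_act x u + restrict_act x v.
Proof. exact: act_linearr. Qed.
Fact restrict_act_lie x y v :
  restrict_act (lie x y) v
    = restrict_act x (restrict_act y v) - restrict_act y (restrict_act x v).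
Proof. by rewrite /restrict_act phi_lie act_lie. Qed.
Definition restrict : lieMod L' :=
  LieMod restrict_act_linearl restrict_act_linearr restrict_act_lie.
End Restrict.

End LieModules.

Section SL.
Variables (B : comNzRingType) (m : nat).

Definition traceless : {pred 'M[B]_m} := [pred X | \tr X == 0].

Fact traceless_submod : submod_closed traceless.
Proof.
split=> [|c X Y]; rewrite !inE ?mxtrace0 // => /eqP X0 /eqP Y0.
by rewrite mxtraceD mxtraceZ X0 Y0 mulr0 addr0.
Qed.

HB.instance Definition _ :=
  GRing.isSubmodClosed.Build B 'M[B]_m traceless traceless_submod.

Record sl := Sl { slval :> 'M[B]_m; slvalP : slval \in traceless }.

HB.instance Definition _ := [isSub for slval].
HB.instance Definition _ := [Choice of sl by <:].
HB.instance Definition _ := [SubChoice_isSubLmodule of sl by <:].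

Lemma slval_sum (I : Type) (s : seq I) (P : pred I) (F : I -> sl) :
  slval (\sum_(i <- s | P i) F i) = \sum_(i <- s | P i) slval (F i).
Proof. exact: (big_morph slval (fun _ _ => erefl) erefl). Qed.

Fact sl_lie_subproof (X Y : sl) : X *m Y - Y *m X \in traceless.
Proof. by rewrite inE mxtraceD raddfN /= mxtrace_mulC subrr. Qed.

Definition sl_lie (X Y : sl) : sl := Sl (sl_lie_subproof X Y).

Fact sl_lie_linearl z c x y :
  sl_lie (c *: x + y) z = c *: sl_lie x z + sl_lie y z.
Proof.
apply/val_inj; rewrite /= mulmxDl mulmxDr -!scalemxAl -!scalemxAr scalerBr.
by rewrite opprD addrACA.
Qed.

Fact sl_liexx x : sl_lie x x = 0.
Proof. by apply/val_inj; rewrite /= subrr. Qed.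

Fact sl_lieC x y : sl_lie x y = - sl_lie y x.
Proof. by apply/val_inj; rewrite /= opprB. Qed.

Fact sl_lie_linearr x c y z :
  sl_lie x (c *: y + z) = c *: sl_lie x y + sl_lie x z.
Proof.
by rewrite sl_lieC sl_lie_linearl (sl_lieC x y) (sl_lieC x z) opprD scalerN.
Qed.

Fact sl_lie_jacobi x y z :
  sl_lie x (sl_lie y z) + sl_lie y (sl_lie z x) + sl_lie z (sl_lie x y) = 0.
Proof.
apply/val_inj; rewrite /= !(mulmxBl, mulmxBr) !mulmxA.
have addE (X Y : 'M[B]_m) i j : (X + Y) i j = X i j + Y i j by rewrite mxE.
have oppE (X : 'M[B]_m) i j : (- X) i j = - X i j by rewrite mxE.
by apply/matrixP=> i j; rewrite !(addE, oppE) [RHS]mxE; ring.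
Qed.

HB.instance Definition _ := Lmodule_isLie.Build B sl
  sl_lie_linearl sl_lie_linearr sl_liexx sl_lie_jacobi.

End SL.

(* A copy of [sl A m], regarded as a Lie algebra over the base ring [K] of the
   algebra [A] instead of over [A].  It is the model of sl_m(K) (x) A, with
   [ptens a P] standing for a (x) P; see [ptens_lie] and [ptens_universal]. *)
Definition current (K : comNzRingType) (A : comAlgType K) (m : nat) := sl A m.

Section Current.
Variables (K : comNzRingType) (A : comAlgType K) (m : nat).
Local Notation g := (sl K m).
Local Notation gA := (current A m).

HB.instance Definition _ := GRing.Zmodule.on gA.

Definition current_scale (c : K) (X : gA) : gA := c%:A *: (X : sl A m).

Fact current_scaleA a b v :
  current_scale a (current_scale b v) = current_scale (a * b) v.
Proof. by rewrite /current_scale scalerA -scalerAl mul1r scalerA. Qed.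
Fact current_scale1 : left_id 1 current_scale.
Proof. by move=> v; rewrite /current_scale !scale1r. Qed.
Fact current_scaleDr : right_distributive current_scale +%R.
Proof. by move=> c u v; rewrite /current_scale scalerDr. Qed.
Fact current_scaleDl v : {morph current_scale^~ v : a b / a + b}.
Proof. by move=> a b; rewrite /current_scale !scalerDl. Qed.

HB.instance Definition _ := GRing.Zmodule_isLmodule.Build K gA
  current_scaleA current_scale1 current_scaleDr current_scaleDl.

Definition current_lie (X Y : gA) : gA := lie (X : sl A m) (Y : sl A m).

Fact current_lie_linearl z c x y :
  current_lie (c *: x + y) z = c *: current_lie x z + current_lie y z.
Proof. exact: (lie_linearl (z : sl A m) c%:A x y). Qed.
Fact current_lie_linearr x c y z :
  current_lie x (c *: y + z) = c *: current_lie x y + current_lie x z.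
Proof. exact: (lie_linearr (x : sl A m) c%:A y z). Qed.
Fact current_liexx x : current_lie x x = 0.
Proof. exact: (liexx (x : sl A m)). Qed.
Fact current_lie_jacobi x y z :
  current_lie x (current_lie y z) + current_lie y (current_lie z x)
    + current_lie z (current_lie x y) = 0.
Proof. exact: (lie_jacobi (x : sl A m)). Qed.

HB.instance Definition _ := Lmodule_isLie.Build K gA
  current_lie_linearl current_lie_linearr current_liexx current_lie_jacobi.

Fact ptens_subproof (a : g) (P : A) :
  P *: map_mx (in_alg A) (slval a) \in @traceless A m.
Proof. by rewrite inE mxtraceZ trace_map_mx (eqP (slvalP a)) rmorph0 mulr0. Qed.

Definition ptens (a : g) (P : A) : gA := Sl (ptens_subproof a P).

Lemma ptens_lie a b P Q :
  lie (ptens a P) (ptens b Q) = ptens (lie a b) (P * Q).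
Proof.
apply/val_inj; rewrite /= map_mxB !map_mxM -!scalemxAl -!scalemxAr !scalerA.
by rewrite (mulrC Q) scalerBr.
Qed.

Lemma ptens_linearl P c a b : ptens (c *: a + b) P = c *: ptens a P + ptens b P.
Proof.
apply/val_inj; rewrite /= map_mxD map_mxZ scalerDr !scalerA.
by rewrite mulrC.
Qed.

Lemma ptens_linearr a c P Q : ptens a (c *: P + Q) = c *: ptens a P + ptens a Q.
Proof.
by apply/val_inj; rewrite /= scalerDl scalerA -scalerAl mul1r.
Qed.

End Current.

Section CurrentUniversal.
Variables (K : comNzRingType) (A : comAlgType K) (m : nat).
Local Notation g := (sl K m.+1).
Local Notation gA := (current A m.+1).

Fact sl_gen_subproof (i j : 'I_m.+1) :
  delta_mx i j - (i == j)%:R *: delta_mx ord0 ord0 \in @traceless K m.+1.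
Proof.
have trd k l : \tr (delta_mx k l : 'M[K]_m.+1) = (k == l)%:R.
  rewrite /mxtrace (bigD1 k) //= mxE eqxx big1 ?addr0 // => h /negPf hk.
  by rewrite mxE hk.
by rewrite inE mxtraceD raddfN /= mxtraceZ !trd eqxx mulr1 subrr.
Qed.

Definition sl_gen i j : g := Sl (sl_gen_subproof i j).

Lemma current_decomp (X : gA) :
  X = \sum_i \sum_j ptens (sl_gen i j) (slval X i j).
Proof.
apply/val_inj; rewrite /= [LHS](matrix_sum_delta (slval X)).
rewrite slval_sum; under [RHS]eq_bigr => i _ do rewrite slval_sum.
apply/eqP; rewrite -subr_eq0 -sumrB; apply/eqP.
under eq_bigr => i _.
  rewrite -sumrB; under eq_bigr => j _.
    rewrite /= map_mxD map_mxN map_mxZ !map_delta_mx scalerBr opprB addrC subrK.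
    rewrite /= -mulr_natl mulr1.
    over.
  over.
have /eqP trX := slvalP X.
under eq_bigr => i _.
  rewrite (bigD1 i) //= eqxx big1 ?addr0; last first.
    by move=> j /negPf; rewrite eq_sym => ->; rewrite !scale0r scaler0.
  rewrite !scale1r.
  over.
by rewrite -scaler_suml -/(\tr (slval X)) trX scale0r.
Qed.

Lemma sl_decomp (a : g) : a = \sum_i \sum_j slval a i j *: sl_gen i j.
Proof.
apply/val_inj; rewrite /= [LHS](matrix_sum_delta (slval a)).
rewrite slval_sum; under [RHS]eq_bigr => i _ do rewrite slval_sum.
apply/eqP; rewrite -subr_eq0 -sumrB; apply/eqP.
under eq_bigr => i _.
  rewrite -sumrB; under eq_bigr => j _.
    rewrite /= scalerBr opprB addrC subrK scalerA.
    over.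
  over.
have /eqP tra := slvalP a.
under eq_bigr => i _.
  rewrite (bigD1 i) //= eqxx mulr1 big1 ?addr0; last first.
    by move=> j /negPf; rewrite eq_sym => ->; rewrite mulr0 scale0r.
  over.
by rewrite -scaler_suml -/(\tr (slval a)) tra scale0r.
Qed.

Lemma ptens_universal (U : lmodType K) (f : g -> A -> U) :
  (forall P, linear (f^~ P)) -> (forall a, linear (f a)) ->
  exists2 phi : {linear gA -> U}, (forall a P, phi (ptens a P) = f a P) &
    forall psi : {linear gA -> U}, (forall a P, psi (ptens a P) = f a P) ->
      psi =1 phi.
Proof.
move=> fl fr.
pose fL P : {linear g -> U} :=
  HB.pack (f^~ P) (GRing.isLinear.Build _ _ _ _ (f^~ P) (fl P)).
pose fR a : {linear A -> U} :=
  HB.pack (f a) (GRing.isLinear.Build _ _ _ _ (f a) (fr a)).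
pose h (X : gA) : U := \sum_i \sum_j f (sl_gen i j) (slval X i j).
have hlin : linear h.
  move=> c X Y; rewrite /h scaler_sumr -big_split /=; apply: eq_bigr => i _.
  rewrite scaler_sumr -big_split /=; apply: eq_bigr => j _.
  by rewrite !mxE -scalerAl mul1r fr.
pose phi : {linear gA -> U} := HB.pack h (GRing.isLinear.Build _ _ _ _ h hlin).
exists phi => [a P | psi psiE X].
  rewrite [in RHS](sl_decomp a) -[RHS]/(fL P _) linear_sum /=.
  apply: eq_bigr => i _; rewrite -[RHS]/(fL P _) linear_sum /=.
  apply: eq_bigr => j _; rewrite -[RHS]/(fL P _) linearZ /=.
  rewrite !mxE -scalerAr mulr1.
  exact: (linearZ_LR (fR _)).
rewrite [in LHS](current_decomp X) linear_sum; apply: eq_bigr => i _.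
by rewrite linear_sum; apply: eq_bigr => j _; rewrite psiE.
Qed.

End CurrentUniversal.

Section RestrictCurrent.
Variables (K : comNzRingType) (A : comAlgType K) (m : nat).

Definition sl_to_current (a : sl K m) : current A m := ptens a 1.

Fact sl_to_current_linear : linear sl_to_current.
Proof. by move=> c a b; apply: ptens_linearl. Qed.
HB.instance Definition _ := GRing.isLinear.Build K (sl K m) (current A m) *:%R
  sl_to_current sl_to_current_linear.

Fact sl_to_current_lie : {morph sl_to_current : a b / lie a b}.
Proof. by move=> a b; rewrite /sl_to_current ptens_lie mulr1. Qed.

Definition res_sl (M : lieMod (current A m)) : lieMod (sl K m) :=
  restrict sl_to_current_lie M.

End RestrictCurrent.

Section VectorModules.
Variables (K : comNzRingType) (m : nat).
Local Notation g := (sl K m).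

Definition vec_act (a : g) (v : 'cV[K]_m) : 'cV[K]_m := slval a *m v.
Fact vec_act_linearl v c a b : vec_act (c *: a + b) v = c *: vec_act a v + vec_act b v.
Proof. by rewrite /vec_act mulmxDl scalemxAl. Qed.
Fact vec_act_linearr a c u v : vec_act a (c *: u + v) = c *: vec_act a u + vec_act a v.
Proof. by rewrite /vec_act mulmxDr scalemxAr. Qed.
Fact vec_act_lie a b v :
  vec_act (lie a b) v = vec_act a (vec_act b v) - vec_act b (vec_act a v).
Proof. by rewrite /vec_act mulmxBl !mulmxA. Qed.
Definition vec_mod : lieMod g := LieMod vec_act_linearl vec_act_linearr vec_act_lie.

Section VecTens.
Variable M : lieMod g.

Definition vec_tens_act (a : g) (f : {ffun 'I_m -> M}) : {ffun 'I_m -> M} :=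
  [ffun i => act a (f i) + \sum_j slval a i j *: f j].

Fact vec_tens_act_linearl f c a b :
  vec_tens_act (c *: a + b) f = c *: vec_tens_act a f + vec_tens_act b f.
Proof.
apply/ffunP=> i; rewrite !ffunE act_linearl scalerDr addrACA.
congr (_ + _); rewrite scaler_sumr -big_split /=; apply: eq_bigr => j _.
by rewrite !mxE scalerDl scalerA.
Qed.

Fact vec_tens_act_linearr a c f h :
  vec_tens_act a (c *: f + h) = c *: vec_tens_act a f + vec_tens_act a h.
Proof.
apply/ffunP=> i; rewrite !ffunE act_linearr scalerDr addrACA.
congr (_ + _); rewrite scaler_sumr -big_split /=; apply: eq_bigr => j _.
by rewrite !ffunE scalerDr !scalerA mulrC.
Qed.

Fact vec_tens_act_lie a b f :
  vec_tens_act (lie a b) f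
    = vec_tens_act a (vec_tens_act b f) - vec_tens_act b (vec_tens_act a f).
Proof.
apply/ffunP=> i; rewrite !ffunE act_lie.
have sumE (x y : g) : \sum_j slval x i j *: vec_tens_act y f j
    = \sum_j slval x i j *: act y (f j) + \sum_l (slval x *m slval y) i l *: f l.
  under eq_bigr => j _ do rewrite ffunE scalerDr scaler_sumr.
  rewrite big_split /= exchange_big /=; congr (_ + _); apply: eq_bigr => l _.
  by rewrite mxE scaler_suml; apply: eq_bigr => j _; rewrite scalerA.
have actE (x y : g) : act x (\sum_j slval y i j *: f j)
    = \sum_j slval y i j *: act x (f j).
  by rewrite linear_sum; apply: eq_bigr => j _; rewrite linearZ.
have -> : \sum_j slval (lie a b) i j *: f j =
    \sum_l (slval a *m slval b) i l *: f l
    - \sum_l (slval b *m slval a) i l *: f l.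
  by rewrite -sumrB; apply: eq_bigr => l _; rewrite -scalerBl !mxE.
rewrite !sumE (raddfD (act a)) (raddfD (act b)) /= !actE.
rewrite [X in _ = X - _](AC (2*2) ((1*4)*(2*3))).
rewrite [X in _ = _ - X](AC (2*2) ((1*4)*(3*2))).
by rewrite opprD [RHS]addrACA subrr addr0 opprD addrACA.
Qed.

(* The tensor product K^m (x) M: an element f stands for the sum over i of
   e_i (x) f i, with (e_i) the standard basis of K^m. *)
Definition vec_tens : lieMod g :=
  LieMod vec_tens_act_linearl vec_tens_act_linearr vec_tens_act_lie.

Definition tens (v : vec_mod) (w : M) : vec_tens :=
  [ffun i => (v : 'cV[K]_m) i ord0 *: w].

Lemma tens_act a v w : act a (tens v w) = tens (act a v) w + tens v (act a w).
Proof.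
apply/ffunP=> i; rewrite !ffunE linearZ addrC; congr (_ + _).
by rewrite mxE scaler_suml; apply: eq_bigr => j _; rewrite ffunE scalerA.
Qed.

Lemma tens_linearl w : linear (tens^~ w).
Proof.
by move=> c u v; apply/ffunP=> i; rewrite !ffunE !mxE scalerDl scalerA.
Qed.

Lemma tens_linearr v : linear (tens v).
Proof.
by move=> c u w; apply/ffunP=> i; rewrite !ffunE scalerDr !scalerA mulrC.
Qed.

Lemma tens_universal (U : lmodType K) (f : vec_mod -> M -> U) :
  (forall w, linear (f^~ w)) -> (forall v, linear (f v)) ->
  exists2 phi : {linear vec_tens -> U}, (forall v w, phi (tens v w) = f v w) &
    forall psi : {linear vec_tens -> U}, (forall v w, psi (tens v w) = f v w) ->
      psi =1 phi.
Proof.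
move=> fl fr.
pose fL w : {linear vec_mod -> U} :=
  HB.pack (f^~ w) (GRing.isLinear.Build _ _ _ _ (f^~ w) (fl w)).
pose fR v : {linear M -> U} :=
  HB.pack (f v) (GRing.isLinear.Build _ _ _ _ (f v) (fr v)).
pose e i : vec_mod := delta_mx i ord0 : 'cV[K]_m.
pose h (t : vec_tens) : U := \sum_i f (e i) ((t : {ffun 'I_m -> M}) i).
have hlin : linear h.
  move=> c t s; rewrite /h scaler_sumr -big_split /=; apply: eq_bigr => i _.
  by rewrite !ffunE fr.
pose phi : {linear vec_tens -> U} := HB.pack h (GRing.isLinear.Build _ _ _ _ h hlin).
have vE (v : vec_mod) : v = \sum_i (v : 'cV[K]_m) i ord0 *: e i.
  apply/colP=> i; rewrite summxE (bigD1 i) //= !mxE !eqxx mulr1.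
  by rewrite big1 ?addr0 // => j /negPf ji; rewrite !mxE eq_sym ji mulr0.
have tE (t : vec_tens) : t = \sum_i tens (e i) ((t : {ffun 'I_m -> M}) i).
  apply/ffunP=> i; rewrite sum_ffunE (bigD1 i) //= ffunE mxE !eqxx scale1r.
  rewrite big1 ?addr0 // => j /negPf ji.
  by rewrite ffunE mxE eq_sym ji scale0r.
exists phi => [v w | psi psiE t].
  rewrite [in RHS](vE v) -[RHS]/(fL w _) linear_sum; apply: eq_bigr => i _.
  rewrite ffunE linearZ; exact: (linearZ_LR (fR _)).
by rewrite [in LHS](tE t) linear_sum; apply: eq_bigr => i _; rewrite psiE.
Qed.

End VecTens.

End VectorModules.

Section Wedge.
Variables (K : numFieldType) (m : nat).
Local Notation g := (sl K m).

Definition antisymmetric_mx : {pred 'M[K]_m} := [pred X | X^T == - X].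

Fact antisymmetric_mx_submod : submod_closed antisymmetric_mx.
Proof.
split=> [|c X Y]; rewrite !inE; first by rewrite trmx0 oppr0.
move=> /eqP XN /eqP YN.
by rewrite linearP /= XN YN scalerN opprD.
Qed.

HB.instance Definition _ :=
  GRing.isSubmodClosed.Build K 'M[K]_m antisymmetric_mx antisymmetric_mx_submod.

(* Exterior square of K^m, with [wedge v w] standing for v /\ w: the matrix X
   is the tensor of coordinates X i j. *)
Record wedge2 := Wedge2 { w2val :> 'M[K]_m; _ : w2val \in antisymmetric_mx }.

HB.instance Definition _ := [isSub for w2val].
HB.instance Definition _ := [Choice of wedge2 by <:].
HB.instance Definition _ := [SubChoice_isSubLmodule of wedge2 by <:].

Lemma w2valP (X : wedge2) : (w2val X)^T = - w2val X.
Proof. by case: X => X XN; apply/eqP. Qed.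

Fact wedge2_act_subproof (a : g) (X : wedge2) :
  slval a *m X + X *m (slval a)^T \in antisymmetric_mx.
Proof.
rewrite inE linearD /= !trmx_mul trmxK w2valP mulNmx mulmxN addrC.
by rewrite opprD.
Qed.

Definition wedge2_act (a : g) (X : wedge2) : wedge2 :=
  Wedge2 (wedge2_act_subproof a X).

Fact wedge2_act_linearl X c a b :
  wedge2_act (c *: a + b) X = c *: wedge2_act a X + wedge2_act b X.
Proof.
apply/val_inj; rewrite /= linearP /= mulmxDl mulmxDr -scalemxAl -scalemxAr.
by rewrite scalerDr addrACA.
Qed.

Fact wedge2_act_linearr a c X Y :
  wedge2_act a (c *: X + Y) = c *: wedge2_act a X + wedge2_act a Y.
Proof.
apply/val_inj; rewrite /= mulmxDl mulmxDr -scalemxAl -scalemxAr.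
by rewrite scalerDr addrACA.
Qed.

Fact wedge2_act_lie a b X :
  wedge2_act (lie a b) X
    = wedge2_act a (wedge2_act b X) - wedge2_act b (wedge2_act a X).
Proof.
apply/val_inj; rewrite /= linearB /= !trmx_mul.
rewrite !(mulmxBl, mulmxBr, mulmxDl, mulmxDr, mulNmx, mulmxN) !mulmxA.
have addE (Y Z : 'M[K]_m) i j : (Y + Z) i j = Y i j + Z i j by rewrite mxE.
have oppE (Y : 'M[K]_m) i j : (- Y) i j = - Y i j by rewrite mxE.
by apply/matrixP=> i j; rewrite !(addE, oppE); ring.
Qed.

Definition wedge2_mod : lieMod g :=
  LieMod wedge2_act_linearl wedge2_act_linearr wedge2_act_lie.

Fact wedge_subproof (v w : 'cV[K]_m) : v *m w^T - w *m v^T \in antisymmetric_mx.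
Proof. by rewrite inE linearB /= !trmx_mul !trmxK opprB. Qed.

Definition wedge (v w : vec_mod K m) : wedge2_mod := Wedge2 (wedge_subproof v w).

Lemma wedge_act a v w : act a (wedge v w) = wedge (act a v) w + wedge v (act a w).
Proof.
apply/val_inj; rewrite /= /vec_act !trmx_mul mulmxBl mulmxBr !mulmxA.
have addE (Y Z : 'M[K]_m) i j : (Y + Z) i j = Y i j + Z i j by rewrite mxE.
have oppE (Y : 'M[K]_m) i j : (- Y) i j = - Y i j by rewrite mxE.
by apply/matrixP=> i j; rewrite !(addE, oppE); ring.
Qed.

Lemma wedge_linearl w : linear (wedge^~ w).
Proof.
move=> c u v; apply/val_inj; rewrite /= linearP /= mulmxDl mulmxDr.
by rewrite -scalemxAl -scalemxAr scalerBr opprD addrACA.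
Qed.

Lemma wedgevv v : wedge v v = 0.
Proof. by apply/val_inj; rewrite /= subrr. Qed.

Lemma wedge_universal (U : lmodType K) (f : vec_mod K m -> vec_mod K m -> U) :
  (forall w, linear (f^~ w)) -> (forall v, linear (f v)) ->
  (forall v, f v v = 0) ->
  exists2 phi : {linear wedge2_mod -> U}, (forall v w, phi (wedge v w) = f v w) &
    forall psi : {linear wedge2_mod -> U}, (forall v w, psi (wedge v w) = f v w) ->
      psi =1 phi.
Proof.
move=> fl fr fvv.
pose fL w : {linear vec_mod K m -> U} :=
  HB.pack (f^~ w) (GRing.isLinear.Build _ _ _ _ (f^~ w) (fl w)).
pose fR v : {linear vec_mod K m -> U} :=
  HB.pack (f v) (GRing.isLinear.Build _ _ _ _ (f v) (fr v)).
have fC v w : f w v = - f v w.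
  apply/eqP; rewrite -addr_eq0; apply/eqP.
  have := fvv (v + w); rewrite -[f _ _]/(fL _ _) raddfD /=.
  rewrite -[f v _]/(fR _ _) -[f w _]/(fR _ _) !raddfD /= !fvv.
  by rewrite add0r addr0 addrC.
pose e i : vec_mod K m := delta_mx i ord0 : 'cV[K]_m.
pose h (X : wedge2_mod) : U :=
  2^-1 *: \sum_i \sum_j (w2val X) i j *: f (e i) (e j).
have hlin : linear h.
  move=> c X Y; rewrite /h scalerA mulrC -scalerA -scalerDr; congr (_ *: _).
  rewrite scaler_sumr -big_split /=; apply: eq_bigr => i _.
  rewrite scaler_sumr -big_split /=; apply: eq_bigr => j _.
  by rewrite !mxE scalerDl scalerA.
pose phi : {linear wedge2_mod -> U} :=
  HB.pack h (GRing.isLinear.Build _ _ _ _ h hlin).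
have two (V : lmodType K) (u : V) : 2^-1 *: (u + u) = u.
  by rewrite -mulr2n -scaler_nat scalerA mulVf ?scale1r // pnatr_eq0.
have vE (v : vec_mod K m) : v = \sum_i (v : 'cV[K]_m) i ord0 *: e i.
  apply/colP=> i; rewrite summxE (bigD1 i) //= !mxE !eqxx mulr1.
  by rewrite big1 ?addr0 // => j /negPf ji; rewrite !mxE eq_sym ji mulr0.
have fE v w : f v w = \sum_i \sum_j
    ((v : 'cV[K]_m) i ord0 * (w : 'cV[K]_m) j ord0) *: f (e i) (e j).
  rewrite [in LHS](vE v) -[LHS]/(fL w _) linear_sum; apply: eq_bigr => i _.
  rewrite linearZ /= [in LHS](vE w) -[f (e i) _]/(fR _ _) linear_sum scaler_sumr.
  by apply: eq_bigr => j _; rewrite linearZ /= scalerA.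
have valS (I : finType) (F : I -> wedge2_mod) :
    w2val (\sum_i F i) = \sum_i w2val (F i).
  exact: (big_morph w2val (fun _ _ => erefl) erefl).
have XE (X : wedge2_mod) : X =
    2^-1 *: \sum_i \sum_j (w2val X) i j *: wedge (e i) (e j).
  apply/val_inj; rewrite /= valS; under eq_bigr => i _ do rewrite valS.
  rewrite -[LHS]two; congr (_ *: _).
  have dE i j : (delta_mx i ord0 : 'cV[K]_m) *m (delta_mx j ord0 : 'cV[K]_m)^T
      = delta_mx i j by rewrite trmx_delta mul_delta_mx.
  rewrite -[in X in X + _](opprK (w2val X)) -w2valP addrC.
  under eq_bigr => i _ do under eq_bigr => j _ do
    rewrite /= !dE scalerBr.
  under eq_bigr => i _ do rewrite sumrB.
  rewrite sumrB -matrix_sum_delta; congr (_ - _).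
  rewrite [LHS]matrix_sum_delta exchange_big /=.
  by apply: eq_bigr => i _; apply: eq_bigr => j _; rewrite mxE.
exists phi => [v w | psi psiE X].
  have -> : f v w = 2^-1 *: (f v w - f w v) by rewrite (fC v w) opprK two.
  rewrite [f v w]fE [f w v]fE -sumrB; congr (_ *: _); apply: eq_bigr => i _.
  rewrite -sumrB; apply: eq_bigr => j _; rewrite -scalerBl.
  by rewrite !mxE !big_ord1 !mxE.
rewrite [in LHS](XE X) linearZ /= linear_sum /= /h; congr (_ *: _).
apply: eq_bigr => i _; rewrite linear_sum; apply: eq_bigr => j _.
by rewrite linearZ psiE.
Qed.

End Wedge.

Section CrossRing.
Variable K : comNzRingType.
Local Notation KXY := {mpoly K[2]}.

(* The ideal (xy) of K[x, y], with x = 'X_ord0 and y = 'X_ord_max. *)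
Definition xy_ideal : {pred KXY} :=
  [pred p | `[< exists q : KXY, p = q * ('X_ord0 * 'X_ord_max) >]].

Fact xy_ideal_idealr : idealr_closed xy_ideal.
Proof.
split=> [||a p q].
- by apply/asboolP; exists 0; rewrite mul0r.
- apply/asboolP=> -[q] /(congr1 (meval (fun=> 0))).
  rewrite meval1 !mevalM !mevalXU !mulr0 => /eqP; exact/negP/oner_neq0.
- move=> /asboolP[p' ->] /asboolP[q' ->]; apply/asboolP; exists (a * p' + q').
  by rewrite mulrDl !mulrA.
Qed.

HB.instance Definition _ := isIdealr.Build KXY xy_ideal xy_ideal_idealr.

Definition cross_ring := {ideal_quot xy_ideal}.
HB.instance Definition _ := GRing.ComNzRing.on cross_ring.

Definition cross_pi (p : KXY) : cross_ring := \pi_({ideal_quot xy_ideal})%qT p.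

Fact cross_pi_zmod : zmod_morphism cross_pi.
Proof. exact: (raddfB \pi_({ideal_quot xy_ideal})%qT). Qed.
HB.instance Definition _ :=
  GRing.isZmodMorphism.Build KXY cross_ring cross_pi cross_pi_zmod.

Fact cross_pi_monoid : monoid_morphism cross_pi.
Proof.
split; first exact: (rmorph1 \pi_({ideal_quot xy_ideal})%qT).
exact: (rmorphM \pi_({ideal_quot xy_ideal})%qT).
Qed.
HB.instance Definition _ :=
  GRing.isMonoidMorphism.Build KXY cross_ring cross_pi cross_pi_monoid.

Definition cross_scale (c : K) (P : cross_ring) : cross_ring :=
  cross_pi c%:MP * P.

Fact cross_scaleA a b v : cross_scale a (cross_scale b v) = cross_scale (a * b) v.
Proof. by rewrite /cross_scale mulrA -rmorphM /= mpolyCM. Qed.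
Fact cross_scale1 : left_id 1 cross_scale.
Proof. by move=> v; rewrite /cross_scale rmorph1 mul1r. Qed.
Fact cross_scaleDr : right_distributive cross_scale +%R.
Proof. by move=> c u v; rewrite /cross_scale mulrDr. Qed.
Fact cross_scaleDl v : {morph cross_scale^~ v : a b / a + b}.
Proof. by move=> a b; rewrite /cross_scale mpolyCD rmorphD mulrDl. Qed.
HB.instance Definition _ := GRing.Zmodule_isLmodule.Build K cross_ring
  cross_scaleA cross_scale1 cross_scaleDr cross_scaleDl.

Fact cross_scaleAl (c : K) (P Q : cross_ring) : c *: (P * Q) = c *: P * Q.
Proof. exact: mulrA. Qed.
HB.instance Definition _ :=
  GRing.Lmodule_isLalgebra.Build K cross_ring cross_scaleAl.
HB.instance Definition _ := GRing.Lalgebra_isComAlgebra.Build K cross_ring.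

Lemma cross_piZ c p : cross_pi (c *: p) = c *: cross_pi p.
Proof. by rewrite -mul_mpolyC rmorphM. Qed.

(* P |-> P(0), the value at the double point; independent of the representative
   by [cross_eval0_pi]. *)
Definition cross_eval0 (P : cross_ring) : K :=
  (repr (P : {ideal_quot xy_ideal})).@[fun=> 0].

Lemma cross_eval0_pi p : cross_eval0 (cross_pi p) = p.@[fun=> 0].
Proof.
apply/eqP; rewrite -subr_eq0 -mevalB.
have : repr (cross_pi p : {ideal_quot xy_ideal}) - p \in xy_ideal.
  by rewrite Quotient.idealrBE reprK.
by move=> /asboolP[q ->]; rewrite !mevalM !mevalXU !mulr0.
Qed.

End CrossRing.

Section LocalWeyl.
Variables (K : comNzRingType) (m : nat).
Local Notation g := (sl K m).

Definition cartan (h : g) : Prop := is_diag_mx (slval h).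

Definition nplus (a : g) : Prop :=
  forall i j : 'I_m, (j <= i)%N -> slval a i j = 0.

Definition weight_vector (M : lieMod g) (w : M) : Prop :=
  exists mu : g -> K, forall h, cartan h -> act h w = mu h *: w.

(* Integrability: diagonalizable action of the Cartan subalgebra and locally
   nilpotent e_i, f_i.  The e_i, f_i of sl_m are the matrix units just above and just
   below the diagonal. *)
Definition chevalley_generator (x : g) : Prop :=
  exists i j : 'I_m, (i.+1 = j \/ j.+1 = i) /\ slval x = delta_mx i j.

Definition integrable (M : lieMod g) : Prop :=
  (forall v : M, exists (k : nat) (w : 'I_k -> M),
     (forall i, weight_vector (w i)) /\ v = \sum_i w i) /\
  (forall x, chevalley_generator x ->
     forall v : M, exists N, iter N (act x) v = 0).

Variables (A : comAlgType K) (ev : A -> K) (lambda : g -> K).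

(* Only the restriction of [lambda] to the Cartan subalgebra is used. *)
Definition weyl_type (M : lieMod (current A m)) (v0 : M) : Prop :=
  [/\ integrable (res_sl M),
      cyclic_vector v0,
      forall a P, nplus a -> act (ptens a P) v0 = 0 &
      forall h P, cartan h -> act (ptens h P) v0 = (lambda h * ev P) *: v0].

Definition local_weyl_module (W : lieMod (current A m)) (w0 : W) : Prop :=
  weyl_type w0 /\
  forall (M : lieMod (current A m)) (v0 : M), weyl_type v0 ->
    exists f : {linear W -> M},
      [/\ lie_equivariant f, (forall v, exists w, f w = v) & f w0 = v0].

End LocalWeyl.

Definition omega1 (K : comNzRingType) (r : nat) (h : sl K r.+1) : K :=
  slval h ord0 ord0.

Lemma omega1_highest_weight (K : comNzRingType) (r : nat) :
  let e0 : vec_mod K r.+1 := delta_mx ord0 ord0 : 'cV[K]_r.+1 in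
  (forall a, nplus a -> act a e0 = 0) /\
  (forall h, cartan h -> act h e0 = omega1 h *: e0).
Proof.
have actE (a : sl K r.+1) i j :
    (slval a *m (delta_mx ord0 ord0 : 'cV_r.+1)) i j = slval a i ord0.
  by rewrite ord1 -colE mxE.
split=> [a an | h /is_diag_mxP hd]; apply/matrixP=> i j; rewrite actE !mxE.
  exact: an.
rewrite ord1 eqxx andbT; have [-> | i0] := eqVneq i ord0; first by rewrite mulr1.
by rewrite mulr0 hd.
Qed.

(* V (x) (V (x) ... (V (x) M)) with k factors V = K^m; for M the trivial module
   this is the tensor power V^{(x) k}. *)
Definition tens_pow (K : comNzRingType) (m k : nat) (M : lieMod (sl K m)) :
  lieMod (sl K m) := iter k (@vec_tens K m) M.

(* Main.v *)
(* The defining relations identify W with a quotient of the n-th symmetric power of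
   V (x) A: polarizing the cyclic vector gives a symmetric multilinear map Xi whose
   values span W, and on which the power sums of x and of y over the n slots act by
   zero.
   By Newton's identities the elementary symmetric functions of x and of y act by
   zero as well.  With words u recording basis vectors of V^{(x) n}, this
   straightens any exponent to one attached to a descent set D and a cut c in D or
   c = 0, with powers of x before c and powers of y after it.  For each c, as in
   Solomon's descent decomposition of the coinvariants, the contributions of all D
   are governed by one function on words, arbitrary for c = 0 and antisymmetric in
   the places c-1, c for the n-1 other cuts: these are the summands V^{(x) n} and
   V^{(x) (n-2)} (x) /\^2 V.
   There are no further relations: W maps onto a module spanned by alternants,
   determinants of coefficients of monomials x^a y^b, and evaluating these at the
   exponents complementary to those of (D, c) singles out (D, c) among the pairs
   with the same degree and no larger spread of exponents. *)

Require Import Defs.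
From HB Require Import structures.
From mathcomp Require Import all_boot all_order all_algebra fingroup perm.
From mathcomp Require Import boolp functions.
From mathcomp Require Import reals complex mpoly.
From mathcomp Require Import ring lra zify.

Set Implicit Arguments.
Unset Strict Implicit.
Unset Printing Implicit Defensive.

Import Order.TTheory GRing.Theory Num.Theory.

Local Open Scope nat_scope.
Local Open Scope ring_scope.

(** * Permutations preserving the fibres of a function *)

(** The correction terms of a normal ordered product are associative products of matrices, so
    polarization cannot stay inside sl. The action is therefore extended to all matrices over A,
    with P times the identity acting by n P(0). With this normalization every matrix whose first
    column is zero kills the cyclic vector. By sl_2-theory a product of n+1 matrices supported in
    the first column kills it too, and this is what limits the slots to n.

    Two statistics order the exponents: the height, the sum of |a_p|, and the spread, the sum of
    |a_p - a_q|. In the relation given by an elementary symmetric function all surviving terms have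
    the same height, and the terms of largest spread coincide once the coefficients are symmetric
    enough. Rewriting therefore lowers the spread, while passing to a larger descent set raises the
    height, which is bounded on step exponents. Independence uses the opposite order: height
    upwards, spread downwards.

    The descent decomposition rests on positivity. Symmetrizers and antisymmetrizers are
    self-adjoint for a Hermitian form, so a vanishing sum of their squared norms vanishes term by
    term. *)

Section Stabilizer.
Variable n : nat.
Implicit Types (N : 'I_n -> nat) (s t : 'S_n).

Definition stab N : {set 'S_n} := [set s : 'S_n | [forall p, N (s p) == N p]].

Lemma stabP N s : reflect (forall p, N (s p) = N p) (s \in stab N).
Proof.
by rewrite inE; apply: (iffP forallP) => h p; move/(_ p): h => /eqP.
Qed.

Lemma stab1 N : 1%g \in stab N.
Proof. by apply/stabP => p; rewrite perm1. Qed.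

Lemma stabV N s : s \in stab N -> s^-1%g \in stab N.
Proof. by move=> /stabP h; apply/stabP=> p; rewrite -[in RHS](permKV s p) h. Qed.

Lemma stabM N s t : s \in stab N -> t \in stab N -> (s * t)%g \in stab N.
Proof. by move=> /stabP hs /stabP ht; apply/stabP=> p; rewrite permM ht hs. Qed.

Lemma stab_tperm N p q : N p = N q -> tperm p q \in stab N.
Proof. by move=> h; apply/stabP=> k; case: tpermP => [->|->|]. Qed.

Lemma stab_mulr N s t : s \in stab N -> ((t * s)%g \in stab N) = (t \in stab N).
Proof.
move=> hs; apply/idP/idP=> h; last exact: stabM.
by rewrite -(mulgK s t); apply: stabM => //; apply: stabV.
Qed.

Lemma stab_mull N s t : s \in stab N -> ((s * t)%g \in stab N) = (t \in stab N).
Proof.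
move=> hs; apply/idP/idP=> h; last exact: stabM.
by rewrite -(mulKg s t); apply: stabM => //; apply: stabV.
Qed.

Lemma stab_invr N s : (s^-1%g \in stab N) = (s \in stab N).
Proof. by apply/idP/idP=> /stabV; rewrite ?invgK. Qed.

Lemma card_stab_gt0 N : (0 < #|stab N|)%N.
Proof. by apply/card_gt0P; exists 1%g; apply: stab1. Qed.

(** The values of f and of f composed with s form the same multiset, and a multiset has only one
    increasing listing. *)
Lemma monotone_perm (f : 'I_n -> int) s :
  (forall p q : 'I_n, (p <= q)%N -> f p <= f q) ->
  (forall p q : 'I_n, (p <= q)%N -> f (s p) <= f (s q)) ->
  forall p, f (s p) = f p.
Proof.
move=> fm fsm p.
have srt (g : 'I_n -> int) : (forall p q : 'I_n, (p <= q)%N -> g p <= g q) ->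
    sorted <=%R [seq g i | i <- enum 'I_n].
  move=> gm; rewrite sorted_map.
  have : sorted (relpre val leq) (enum 'I_n).
    by rewrite -sorted_map val_enum_ord iota_sorted.
  by apply: sub_sorted => i j; apply: gm.
have e : [seq f (s i) | i <- enum 'I_n] = [seq f i | i <- enum 'I_n].
  apply: (sorted_eq le_trans le_anti); rewrite ?srt //.
  rewrite (map_comp f s); apply: perm_map; apply: uniq_perm.
  - by rewrite map_inj_uniq ?enum_uniq //; apply: perm_inj.
  - exact: enum_uniq.
  move=> i; rewrite mem_enum; apply/mapP; exists (s^-1%g i); rewrite ?mem_enum //.
  by rewrite permKV.
by move/eq_in_map: e => /(_ p); rewrite mem_enum; apply.
Qed.

Lemma tperm_swap_sum (g f : 'I_n -> int) (i j : 'I_n) : i != j ->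
  \sum_p g p * f (tperm i j p) =
  \sum_p g p * f p + (g i - g j) * (f j - f i).
Proof.
move=> ij.
rewrite (bigD1 i) //= (bigD1 j) /=; last by rewrite eq_sym.
rewrite [in RHS](bigD1 i) //= [in RHS](bigD1 j) /=; last by rewrite eq_sym.
rewrite tpermL tpermR.
rewrite (eq_bigr (fun p => g p * f p)); first by ring.
by move=> p /andP[pi pj]; rewrite tpermD // eq_sym.
Qed.

(* Maximizing sum_p p f(t p) over the stabilizer sorts f along the fibres of N,
   since exchanging an inversion increases the sum. *)
Lemma block_sort N (f : 'I_n -> int) :
  exists2 t, t \in stab N &
    forall p q : 'I_n, (p <= q)%N -> N p = N q -> f (t p) <= f (t q).
Proof.
pose G (s : 'S_n) : int := \sum_(p < n) (p : nat)%:Z * f (s p).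
have [t ht tmax] := arg_maxP G (stab1 N).
exists t => // p q; rewrite leq_eqVlt => /orP[/eqP/val_inj->//|pq] Npq.
rewrite leNgt; apply/negP=> lt.
have := tmax (tperm p q * t)%g (stabM (stab_tperm Npq) ht).
apply/negP; rewrite -ltNge /G.
have -> : \sum_(p0 < n) (p0 : nat)%:Z * f ((tperm p q * t)%g p0) =
          \sum_(p0 < n) (p0 : nat)%:Z * (f \o t) (tperm p q p0).
  by apply: eq_bigr => k _; rewrite permM.
have npq : p != q by rewrite -val_eqE /=; lia.
rewrite (tperm_swap_sum _ _ npq) /= ltrDl; nia.
Qed.

End Stabilizer.

(** * Rearrangement of words *)

Section Words.
Variable n : nat.

Definition pword (T : Type) (s : 'S_n) (u : {ffun 'I_n -> T}) : {ffun 'I_n -> T} :=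
  [ffun p => u (s p)].

Lemma pword1 T (u : {ffun 'I_n -> T}) : pword 1%g u = u.
Proof. by apply/ffunP=> p; rewrite ffunE perm1. Qed.

Lemma pwordM T s t (u : {ffun 'I_n -> T}) : pword s (pword t u) = pword (s * t)%g u.
Proof. by apply/ffunP=> p; rewrite !ffunE permM. Qed.

Variable m : nat.
Local Notation word := {ffun 'I_n -> 'I_m}.
Implicit Types (N : 'I_n -> nat) (u v : word).

(** The sum of the rearrangement inequality: it grows when larger letters move to larger values of
    N. It is the order for the triangularity arguments on words. *)
Definition content N u : int := \sum_(p < n) (N p)%:Z * (u p)%:Z.

Definition sorted_on N u := forall p q : 'I_n, (p <= q)%N -> N p = N q -> (u p <= u q)%N.

Lemma content_stab N s u : s \in stab N -> content N (pword s u) = content N u.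
Proof.
move=> /stabP h; rewrite /content [RHS](reindex_inj (@perm_inj _ s)) /=.
by apply: eq_bigr => p _; rewrite ffunE h.
Qed.

Lemma content_tperm N u p q : p != q ->
  content N (pword (tperm p q) u) =
  content N u + ((N p)%:Z - (N q)%:Z) * ((u q)%:Z - (u p)%:Z).
Proof.
move=> pq; rewrite -(tperm_swap_sum (fun p => (N p)%:Z) (fun p => (u p)%:Z)) //.
by apply: eq_bigr => k _; rewrite ffunE.
Qed.

Lemma sorted_on_uniq N s u : {homo N : p q / (p <= q)%N} -> s \in stab N ->
  sorted_on N u -> sorted_on N (pword s u) -> pword s u = u.
Proof.
move=> Nm /stabP sN us sus.
(* Since u p < m, this number encodes the lexicographic order on the pairs (N p, u p), which reduces
   the claim to [monotone_perm]. *)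
pose f p : int := (N p * m + u p)%:Z.
have fE : forall p, f (s p) = f p.
  apply: monotone_perm => p q pq; rewrite /f ?sN lez_nat;
    have := Nm _ _ pq; rewrite leq_eqVlt => /orP[/eqP e|lt].
  - by rewrite e leq_add2l us.
  - by have := ltn_ord (u p); have := ltn_ord (u q); nia.
  - by rewrite e leq_add2l; have := sus p q pq e; rewrite !ffunE.
  - by have := ltn_ord (u (s p)); have := ltn_ord (u (s q)); nia.
apply/ffunP=> p; rewrite ffunE; apply/val_inj => /=.
by have := fE p; rewrite /f sN => -[] /addnI.
Qed.

Lemma block_sort_word N u : exists2 t, t \in stab N & sorted_on N (pword t u).
Proof.
have [t tN h] := block_sort N (fun p => (u p)%:Z).
by exists t => // p q pq e; rewrite !ffunE -lez_nat h.
Qed.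

(** By the rearrangement inequality a word sorted on the fibres of N' has maximal content in its
    orbit, and the other maximizers differ from it only inside the finer fibres of N. *)
Lemma content_max N N' s u :
  {homo N : p q / (p <= q)%N} -> {homo N' : p q / (p <= q)%N} ->
  (forall p q, N p = N q -> N' p = N' q) -> sorted_on N' u ->
  s \in stab N' -> content N u <= content N (pword s u) ->
  exists2 t, t \in stab N & pword s u = pword t u.
Proof.
move=> Nm N'm NN' us.
have subN t : t \in stab N -> t \in stab N'.
  by move=> /stabP h; apply/stabP=> p; apply: NN'.
pose G t := content N (pword t u).
(* A maximizer, once sorted on the fibres of N, has no inversion left in a fibre of N': exchanging
   it would raise the content. By uniqueness of the sorted word it is u. *)
have key s0 : s0 \in stab N' -> (forall t, t \in stab N' -> G t <= G s0) ->
    exists2 t, t \in stab N & pword (t * s0)%g u = u.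
  move=> s0N mx; have [t tN ts] := block_sort_word N (pword s0 u).
  exists t => //; apply: (sorted_on_uniq N'm) => //; first exact: stabM (subN _ tN) s0N.
  move=> p q pq e; have [Npq|Npq] := eqVneq (N p) (N q).
    by rewrite -pwordM ts.
  have {}Npq : (N p < N q)%N by rewrite ltn_neqAle Npq Nm.
  have npq : p != q by apply/eqP=> e0; rewrite e0 ltnn in Npq.
  rewrite leqNgt; apply/negP=> lt.
  have := mx _ (stabM (stab_tperm e) (stabM (subN _ tN) s0N)).
  rewrite /G -pwordM content_tperm // -[in X in _ <= X](content_stab _ tN) pwordM.
  by rewrite gerDl leNgt => /negP; apply; rewrite nmulr_rgt0 subr_lt0 ltz_nat.
move=> sN le.
have [s0 s0N s0mx] := arg_maxP G (stab1 N').
have [t0 t0N e0] := key s0 s0N s0mx.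
have [t tN e] : exists2 t, t \in stab N & pword (t * s)%g u = u.
  apply: key => // t tN; apply: le_trans le; apply: le_trans (s0mx _ tN) _.
  by rewrite /G -(content_stab _ t0N) pwordM e0.
by exists t^-1%g; rewrite ?stabV // -[in RHS]e pwordM mulKg.
Qed.

(* Among the rearrangements of u along the fibres of N', the content is minimal
   only at u itself when N increases and u decreases strictly on these fibres. *)
Lemma content_min N N' s u :
  {homo N' : p q / (p <= q)%N} ->
  (forall p q : 'I_n, (p < q)%N -> N' p = N' q -> (N p < N q)%N && (u q < u p)%N) ->
  s \in stab N' -> s != 1%g -> content N u < content N (pword s u).
Proof.
move=> N'm h.
pose G t := content N (pword t u).
have key t : t \in stab N' -> t != 1%g -> exists2 t', t' \in stab N' & G t' < G t.
  move=> /stabP tN t1.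
  have [p [q [pq tpq]]] : exists p q : 'I_n, (p < q)%N /\ (t q < t p)%N.
    have [/existsP[p /existsP[q /andP[]]]|] :=
      boolP [exists p : 'I_n, exists q : 'I_n, (p < q)%N && (t q < t p)%N].
      by exists p, q.
    move=> /negP no; case/negP: t1; apply/eqP/permP=> p; rewrite perm1.
    have mono (x y : 'I_n) : (x <= y)%N -> (t x <= t y)%N.
      rewrite leq_eqVlt => /orP[/eqP/val_inj->//|xy]; rewrite leqNgt.
      apply/negP=> lt; apply: no; apply/existsP; exists x; apply/existsP; exists y.
      by rewrite xy.
    have /(_ _ _ p) := @monotone_perm _ (fun p => (p : nat)%:Z) t.
    by move=> /(_ (fun x y h => h)) H; apply/val_inj/eqP; rewrite -eqz_nat H.
  have e : N' p = N' q.
    apply/eqP; rewrite eqn_leq N'm ?(ltnW pq) //= -(tN p) -(tN q).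
    by rewrite N'm // ltnW.
  exists (tperm p q * t)%g; first by apply: stabM; rewrite ?stab_tperm //; apply/stabP.
  rewrite /G -pwordM content_tperm; last by rewrite -val_eqE neq_ltn pq.
  have /andP[h1 _] := h p q pq e.
  have /andP[_] := h (t q) (t p) tpq (etrans (tN q) (etrans (esym e) (esym (tN p)))).
  by move=> h2; rewrite !ffunE gtrDl nmulr_rlt0 ?subr_lt0 ?subr_gt0 ltz_nat.
move=> sN s1.
have [s0 s0N s0mn] := arg_minP G (stab1 N').
have s01 : s0 = 1%g.
  apply/eqP; apply: contraTT isT => s01.
  by have [t tN] := key _ s0N s01; rewrite ltNge s0mn.
have [t tN lt] := key _ sN s1; apply: le_lt_trans lt.
by have := s0mn _ tN; rewrite s01 /G pword1.
Qed.

End Words.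

(** * Descent sets and their Young subgroups *)

Section Steps.
Variable n : nat.
Implicit Types (D E : {set 'I_n.+1}) (p q : 'I_n.+1).

(** The index of the block containing p when the positions are cut in front of each element of D.
    Hence [stab (step D)] is the Young subgroup of this composition. *)
Definition step D p : nat := #|[set d in D | (d <= p)%N]|.

Definition codesc D : {set 'I_n.+1} := ~: D :\ ord0.

Lemma step_homo D : {homo step D : p q / (p <= q)%N}.
Proof.
move=> p q pq; apply/subset_leq_card/subsetP=> d; rewrite !inE => /andP[-> h].
exact: leq_trans h pq.
Qed.

Lemma step_ltP D p q : (p <= q)%N ->
  reflect (exists2 d, d \in D & (p < d <= q)%N) (step D p < step D q)%N.
Proof.
move=> pq.
have sub : [set d in D | (d <= p)%N] \subset [set d in D | (d <= q)%N].
  by apply/subsetP=> d; rewrite !inE => /andP[-> h]; exact: leq_trans h pq.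
apply: (iffP idP) => [lt|[d dD /andP[h1 h2]]].
  have : [set d in D | (d <= p)%N] \proper [set d in D | (d <= q)%N].
    by rewrite properEcard sub.
  case/properP=> _ [d]; rewrite !inE => /andP[dD h2]; rewrite dD /= -ltnNge => h1.
  by exists d; rewrite ?h1.
apply/proper_card/properP; split=> //; exists d; rewrite !inE dD ?h2 //=.
by rewrite -ltnNge.
Qed.

Lemma step_eqP D p q : (p <= q)%N ->
  (step D p = step D q) <-> (forall d, d \in D -> (p < d)%N -> (q < d)%N).
Proof.
move=> pq; split=> [e d dD pd|h].
  rewrite ltnNge; apply/negP=> dq; have : (step D p < step D q)%N.
    by apply/step_ltP => //; exists d; rewrite ?pd.
  by rewrite e ltnn.
apply/eqP; rewrite eqn_leq step_homo //= leqNgt; apply/negP=> /step_ltP -/(_ pq).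
by case=> d dD /andP[h1 h2]; have := h d dD h1; rewrite ltnNge h2.
Qed.

Lemma step_sub D E p q : E \subset D -> step D p = step D q -> step E p = step E q.
Proof.
move=> /subsetP ED; wlog pq : p q / (p <= q)%N.
  by case/orP: (leq_total p q) => h H e; [|symmetry]; apply: H.
by move/(step_eqP _ pq) => h; apply/(step_eqP _ pq) => d /ED; apply: h.
Qed.

Lemma stab_step_sub D E s : E \subset D -> s \in stab (step D) -> s \in stab (step E).
Proof. by move=> ED /stabP h; apply/stabP=> p; apply: step_sub ED _. Qed.

Lemma step_rem D i p : i \in D -> step D p = (step (D :\ i) p + (i <= p))%N.
Proof.
move=> iD; rewrite /step; have [ip|ip] := leqP i p.
  rewrite (cardsD1 i) !inE iD ip addnC; congr (_ + _)%N.
  by apply: eq_card => d; rewrite !inE andbA.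
rewrite addn0; apply: eq_card => d; rewrite !inE.
by case: eqVneq => // ->; rewrite leqNgt ip andbF.
Qed.

(** D and [codesc D] partition the nonzero positions, exactly p of which are at most p. This makes
    the exponents attached to D and to [codesc D] complementary. *)
Lemma step_codesc D p : ord0 \notin D -> (step D p + step (codesc D) p = p)%N.
Proof.
move=> D0; rewrite /step -cardsUI.
rewrite [X in (_ + #|pred_of_set X|)%N](_ : _ = set0) ?cards0 ?addn0; last first.
  by apply/setP=> d; rewrite !inE; case: (d \in D); rewrite ?andbF.
rewrite (_ : _ :|: _ = [set d : 'I_n.+1 | (0 < d <= p)%N]); last first.
  apply/setP=> d; rewrite !inE; have [->|d0] := eqVneq d ord0.
    by rewrite (negPf D0).
  by rewrite lt0n -[_ == 0%N]/(d == ord0) d0; case: (d \in D) => //=; rewrite orbF.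
have f_inj : injective (fun i : 'I_p => lift ord0 (widen_ord (ltn_ord p : p <= n)%N i)).
  by move=> i j /lift_inj /(congr1 val) /= /val_inj.
rewrite -[RHS]card_ord -(card_imset _ f_inj) //.
apply: eq_card => d; rewrite !inE; apply/idP/imsetP => [/andP[d0 dp]|[i _ ->]].
  have di : (d.-1 < p)%N by rewrite prednK.
  by exists (Ordinal di) => //; apply/val_inj; rewrite /= /bump /= add1n prednK.
by rewrite /= /bump /= add1n ltn_ord.
Qed.

Lemma step0 D : ord0 \notin D -> step D ord0 = 0%N.
Proof. by move=> /(step_codesc ord0)/eqP; rewrite addn_eq0 => /andP[/eqP]. Qed.

Variable m : nat.
Local Notation word := {ffun 'I_n.+1 -> 'I_m}.
Implicit Types (u v w : word).

(** The descent set of u is D, each descent being recorded at the later of its two positions. *)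
Definition descends_at D u := forall p q, (q == p.+1 :> nat) ->
  if q \in D then (u q < u p)%N else (u p <= u q)%N.

(** Two positions in one block of [codesc D] are separated only by elements of D, that is by strict
    descents; the induction is on their distance. *)
Lemma descends_at_lt D u : ord0 \notin D -> descends_at D u ->
  forall p q, (p < q)%N -> step (codesc D) p = step (codesc D) q -> (u q < u p)%N.
Proof.
move=> D0 gu p q; move: {-2}(q - p.+1)%N (erefl (q - p.+1)%N) => k.
elim: k p => [|k IH] p ek pq e.
  have qp : q == p.+1 :> nat by lia.
  have /(step_eqP _ (ltnW pq)) /(_ q) := e; rewrite ltnn pq.
  have := gu p q qp; case: ifP => // qD _; rewrite !inE qD andbT.
  by case: eqVneq => [q0|_ /(_ isT isT)//]; rewrite q0 in pq.
have lt : (p.+1 < n.+1)%N by have := ltn_ord q; lia.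
pose p' := Ordinal lt.
have pp' : (p <= p')%N by rewrite /=; lia.
have p'q : (p' <= q)%N by rewrite /=; lia.
have e1 : step (codesc D) p = step (codesc D) p'.
  by apply/eqP; rewrite eqn_leq step_homo //= e step_homo.
apply: (@ltn_trans (u p')); first by apply: IH; rewrite /= -?e1 //; lia.
have /(step_eqP _ pp') /(_ p') := e1; rewrite ltnn /= ltnS leqnn.
have := gu p p' (eqxx _); case: ifP => // p'D _; rewrite !inE p'D andbT.
by rewrite -val_eqE /= => /(_ isT isT).
Qed.

(** Since u already rises inside the blocks, it can only fail by not falling at some i in D. Across
    such an i the two adjacent blocks join into one sorted block. *)
Lemma sorted_on_merge D u : sorted_on (step D) u -> ~ descends_at D u ->
  exists2 i, i \in D & sorted_on (step (D :\ i)) u.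
Proof.
move=> us ng.
have [/existsP[i /existsP[p /and3P[iD ip le]]]|no] :=
  boolP [exists i : 'I_n.+1, exists p : 'I_n.+1, [&& i \in D, i == p.+1 :> nat & (u p <= u i)%N]].
  exists i => // p' q' pq /(step_eqP _ pq) h.
  have [/andP[p'i iq']|ni] := boolP ((p' < i) && (i <= q'))%N; last first.
    apply: us => //; apply/(step_eqP _ pq) => d dD p'd.
    have [di|di] := eqVneq d i; last by apply: h => //; rewrite !inE di.
    by move: ni; rewrite -di p'd /= -ltnNge.
  have p'p : (p' <= p)%N by lia.
  apply: (@leq_trans (u p)).
    apply: us => //; apply/(step_eqP _ p'p) => d dD p'd.
    have [->|di] := eqVneq d i; first by rewrite (eqP ip).
    by have := h d; rewrite !inE di dD => /(_ isT p'd); lia.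
  apply: (leq_trans le); apply: us => //; apply/(step_eqP _ iq') => d dD id'.
  apply: h; rewrite ?inE ?dD ?andbT; last by lia.
  by apply/eqP=> e; rewrite e ltnn in id'.
case: ng => p q qp; have pq : (p <= q)%N by lia.
case: ifP => qD.
  rewrite ltnNge; apply/negP=> le; case/negP: no; apply/existsP; exists q.
  by apply/existsP; exists p; rewrite qD qp.
apply: us => //; apply/(step_eqP _ pq) => d dD pd.
have : d != q by apply/eqP=> dq; rewrite dq qD in dD.
by rewrite -val_eqE /=; lia.
Qed.

End Steps.

(** * Place permutations of functions on words *)

Section PlaceAction.
Variables (K : numClosedFieldType) (n m : nat).
Local Notation word := {ffun 'I_n -> 'I_m}.
Local Notation fn := {ffun word -> K^o}.
Implicit Types (F G x : fn) (N : 'I_n -> nat) (s t : 'S_n) (u v w : word).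

Definition pfun s F : fn := [ffun u => F (pword s u)].
Definition sym N F : fn := \sum_(s in stab N) pfun s F.
Definition alt N F : fn := \sum_(s in stab N) (-1) ^+ s *: pfun s F.
Definition symmetric_on N F := forall s, s \in stab N -> pfun s F = F.

Lemma pfun_is_linear s : linear (pfun s).
Proof. by move=> c F G; apply/ffunP=> u; rewrite !ffunE. Qed.
HB.instance Definition _ s := GRing.isLinear.Build K fn fn *:%R (pfun s) (pfun_is_linear s).

Lemma pfunM s t F : pfun s (pfun t F) = pfun (t * s)%g F.
Proof. by apply/ffunP=> u; rewrite !ffunE pwordM. Qed.

Lemma pfun1 F : pfun 1%g F = F.
Proof. by apply/ffunP=> u; rewrite !ffunE pword1. Qed.

Lemma sym_is_linear N : linear (sym N).
Proof.
move=> c F G; rewrite scaler_sumr -big_split /=; apply: eq_bigr => s _.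
by rewrite linearP.
Qed.
HB.instance Definition _ N := GRing.isLinear.Build K fn fn *:%R (sym N) (sym_is_linear N).

Lemma alt_is_linear N : linear (alt N).
Proof.
move=> c F G; rewrite scaler_sumr -big_split /=; apply: eq_bigr => s _.
by rewrite linearP scalerDr !scalerA mulrC.
Qed.
HB.instance Definition _ N := GRing.isLinear.Build K fn fn *:%R (alt N) (alt_is_linear N).

Lemma symE N F u : sym N F u = \sum_(s in stab N) F (pword s u).
Proof. by rewrite sum_ffunE; apply: eq_bigr => s _; rewrite ffunE. Qed.

Lemma altE N F u : alt N F u = \sum_(s in stab N) (-1) ^+ s * F (pword s u).
Proof. by rewrite sum_ffunE; apply: eq_bigr => s _; rewrite !ffunE. Qed.

Lemma sym_pfun N s F : s \in stab N -> sym N (pfun s F) = sym N F.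
Proof.
move=> sN; rewrite /sym [RHS](reindex_inj (mulgI s)) /=; apply: eq_big => t.
  by rewrite stab_mull.
by rewrite pfunM.
Qed.

Lemma pfun_sym N s F : s \in stab N -> pfun s (sym N F) = sym N F.
Proof.
move=> sN; rewrite linear_sum [RHS](reindex_inj (mulIg s)) /=; apply: eq_big => t.
  by rewrite stab_mulr.
by rewrite pfunM.
Qed.

Lemma alt_pfun N s F : s \in stab N -> alt N (pfun s F) = (-1) ^+ s *: alt N F.
Proof.
move=> sN; rewrite /alt [in RHS](reindex_inj (mulgI s)) /= scaler_sumr.
apply: eq_big => t; first by rewrite stab_mull.
by rewrite pfunM odd_permM scalerA signr_addb mulrA -expr2 sqrr_sign mul1r.
Qed.

Lemma pfun_alt N s F : s \in stab N -> pfun s (alt N F) = (-1) ^+ s *: alt N F.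
Proof.
move=> sN; rewrite linear_sum [in RHS]/alt [in RHS](reindex_inj (mulIg s)) /=.
rewrite scaler_sumr; apply: eq_big => t; first by rewrite stab_mulr.
move=> _; rewrite linearZ /= pfunM odd_permM scalerA signr_addb mulrC -mulrA -expr2.
by rewrite sqrr_sign mulr1.
Qed.

Lemma sym_symmetric N F : symmetric_on N (sym N F).
Proof. by move=> s; apply: pfun_sym. Qed.

Lemma symmetric_onP N c F G : symmetric_on N F -> symmetric_on N G ->
  symmetric_on N (c *: F + G).
Proof. by move=> hF hG s sN; rewrite linearP /= hF ?hG. Qed.

Lemma symmetric_on0 N : symmetric_on N 0.
Proof. by move=> s _; rewrite linear0. Qed.

Lemma symmetric_on_sum N (I : Type) (r : seq I) (P : pred I) (F : I -> fn) :
  (forall i, P i -> symmetric_on N (F i)) -> symmetric_on N (\sum_(i <- r | P i) F i).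
Proof.
move=> h s sN; rewrite linear_sum; apply: eq_bigr => i Pi; exact: h.
Qed.

Lemma sym_id N F : symmetric_on N F -> sym N F = #|stab N|%:R *: F.
Proof.
move=> h; rewrite /sym (eq_bigr (fun=> F)) => [|s /h //].
by rewrite sumr_const scaler_nat.
Qed.

Lemma symmetric_onW N N' F : (forall s, s \in stab N -> s \in stab N') ->
  symmetric_on N' F -> symmetric_on N F.
Proof. by move=> sub h s /sub; apply: h. Qed.

Lemma card_stab_neq0 N : #|stab N|%:R != 0 :> K.
Proof. by rewrite pnatr_eq0 -lt0n card_stab_gt0. Qed.

Lemma sym_subset N N' F : (forall s, s \in stab N -> s \in stab N') ->
  sym N' (sym N F) = #|stab N|%:R *: sym N' F.
Proof.
move=> sub; rewrite {1}/sym; rewrite [sym N F]/sym.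
under eq_bigr => s _ do rewrite linear_sum.
rewrite exchange_big /=.
rewrite (eq_bigr (fun=> sym N' F)) ?sumr_const ?scaler_nat // => s sN.
by rewrite -[LHS]/(sym N' (pfun s F)) sym_pfun // sub.
Qed.

Lemma symmetric_on_ffun N F s u : symmetric_on N F -> s \in stab N ->
  F (pword s u) = F u.
Proof. by move=> h /h /ffunP/(_ u); rewrite ffunE. Qed.

Lemma alt0_of_symmetric N F p q : p != q -> N p = N q ->
  pfun (tperm p q) F = F -> alt N F = 0.
Proof.
move=> pq e h; have := alt_pfun F (stab_tperm e).
rewrite h odd_tperm pq expr1 scaleN1r => /eqP.
by rewrite -addr_eq0 -mulr2n -(@scaler_nat K) scaler_eq0 pnatr_eq0 => /eqP.
Qed.

(** The standard Hermitian form on functions of words; its positivity turns orthogonality into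
    vanishing. *)
Definition dotf F G : K := \sum_u F u * (G u)^*.

Lemma dotfDl F G x : dotf (F + G) x = dotf F x + dotf G x.
Proof. by rewrite -big_split /=; apply: eq_bigr => u _; rewrite ffunE mulrDl. Qed.

Lemma dotfZl c F x : dotf (c *: F) x = c * dotf F x.
Proof. by rewrite mulr_sumr; apply: eq_bigr => u _; rewrite ffunE mulrA. Qed.

Lemma dotf0l x : dotf 0 x = 0.
Proof. by rewrite -[0](scale0r x) dotfZl mul0r. Qed.

Lemma dotf_suml (I : Type) (r : seq I) (P : pred I) (F : I -> fn) x :
  dotf (\sum_(i <- r | P i) F i) x = \sum_(i <- r | P i) dotf (F i) x.
Proof. exact: (big_morph (dotf^~ x) (fun F G => dotfDl F G x) (dotf0l x)). Qed.

Lemma dotfC F G : dotf F G = (dotf G F)^*.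
Proof.
by rewrite rmorph_sum; apply: eq_bigr => u _; rewrite rmorphM /= conjCK mulrC.
Qed.

Lemma dotf_ge0 F : 0 <= dotf F F.
Proof. by apply: sumr_ge0 => u _; rewrite mul_conjC_ge0. Qed.

Lemma dotf_eq0 F : dotf F F = 0 -> F = 0.
Proof.
move=> /eqP; rewrite psumr_eq0 => [|u _]; last by rewrite mul_conjC_ge0.
move=> /allP h; apply/ffunP=> u; rewrite ffunE.
by have := h u (mem_index_enum _); rewrite mul_conjC_eq0 => /eqP.
Qed.

Lemma dotf_pfun s F G : dotf (pfun s F) G = dotf F (pfun s^-1%g G).
Proof.
rewrite /dotf (reindex (pword s^-1%g)) /=.
  by apply: eq_bigr => u _; rewrite !ffunE pwordM mulgV pword1.
by exists (pword s) => u _; rewrite pwordM ?mulgV ?mulVg pword1.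
Qed.

(** The adjoint of a place permutation is its inverse, and [stab N] is closed under inversion. *)
Lemma dotf_sym N F G : dotf (sym N F) G = dotf F (sym N G).
Proof.
rewrite [RHS]dotfC !dotf_suml rmorph_sum /= [RHS](reindex_inj invg_inj) /=.
by apply: eq_big => s; rewrite ?stab_invr // => _; rewrite dotf_pfun -dotfC.
Qed.

Lemma dotf_alt N F G : dotf (alt N F) G = dotf F (alt N G).
Proof.
rewrite [RHS]dotfC !dotf_suml rmorph_sum /= [RHS](reindex_inj invg_inj) /=.
apply: eq_big => s; rewrite ?stab_invr // => _; rewrite !dotfZl rmorphM /=.
by rewrite dotf_pfun -dotfC odd_permV rmorph_sign.
Qed.

Lemma alt_alt N F : alt N (alt N F) = #|stab N|%:R *: alt N F.
Proof.
rewrite {1}/alt (eq_bigr (fun=> alt N F)) ?sumr_const ?scaler_nat // => s sN.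
by rewrite pfun_alt // scalerA -expr2 sqrr_sign scale1r.
Qed.

End PlaceAction.

(** * Solomon's descent decomposition for functions on words *)

Section Descents.
Variables (K : numClosedFieldType) (n m : nat).
Local Notation word := {ffun 'I_n.+1 -> 'I_m}.
Local Notation fn := {ffun word -> K^o}.
Implicit Types (F G x : fn) (N : 'I_n.+1 -> nat) (u v w : word).
Implicit Types (D : {set 'I_n.+1}).

(** Sums of functions invariant under Young subgroups in which two adjacent blocks of D are merged:
    the part of the D-symmetric functions that smaller descent sets already account for. *)
Definition coarse D x := exists y : 'I_n.+1 -> fn,
  (forall i, i \in D -> symmetric_on (step (D :\ i)) (y i)) /\ x = \sum_(i in D) y i.

Lemma coarse_lin D c x y : coarse D x -> coarse D y -> coarse D (c *: x + y).
Proof.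
move=> [a [ha ->]] [b [hb ->]]; exists (fun i => c *: a i + b i); split.
  by move=> i iD; apply: symmetric_onP; [apply: ha|apply: hb].
by rewrite scaler_sumr -big_split.
Qed.

Lemma coarse0 D : coarse D 0.
Proof.
by exists (fun=> 0); split; [move=> i _; apply: symmetric_on0|rewrite big1].
Qed.

Lemma coarse_sum D (I : Type) (r : seq I) (P : pred I) (c : I -> K) (F : I -> fn) :
  (forall i, P i -> coarse D (F i)) -> coarse D (\sum_(i <- r | P i) c i *: F i).
Proof.
move=> h; elim/big_ind: _; first exact: coarse0.
- by move=> x y hx hy; rewrite -[x]scale1r; apply: coarse_lin.
by move=> i /h hi; rewrite -[_ *: _]addr0; apply: coarse_lin (coarse0 _).
Qed.

Lemma coarse1 D i x : i \in D -> symmetric_on (step (D :\ i)) x -> coarse D x.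
Proof.
move=> iD h; exists (fun j => if j == i then x else 0); split=> [j jD|].
  by case: eqVneq => [->//|_]; apply: symmetric_on0.
by rewrite (bigD1 i) //= eqxx big1 ?addr0 // => j /andP[_ /negPf->].
Qed.

Lemma coarse_symmetric D x : coarse D x -> symmetric_on (step D) x.
Proof.
move=> [y [h ->]]; apply: symmetric_on_sum => i iD.
apply: symmetric_onW (h i iD) => s; apply: stab_step_sub; exact: subD1set.
Qed.

Definition delta v : fn := [ffun w => (w == v)%:R].

Lemma sym_delta N v w : sym N (delta v) w != 0 -> exists2 t, t \in stab N & w = pword t v.
Proof.
rewrite symE => h.
have [/existsP[t /andP[tN /eqP e]]|/existsPn no] :=
    boolP [exists t, (t \in stab N) && (pword t w == v)].
  by exists t^-1%g; rewrite ?stabV // -e pwordM mulVg pword1.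
move: h; rewrite big1 ?eqxx // => t tN; rewrite ffunE; case: eqP => // e.
by have := no t; rewrite tN e eqxx.
Qed.

Lemma sym_delta_neq0 N v : sym N (delta v) v != 0.
Proof.
rewrite symE (bigD1 1%g) ?stab1 //= pword1 ffunE eqxx.
apply: lt0r_neq0; rewrite ltr_wpDr ?ltr01 //; apply: sumr_ge0 => t _.
by rewrite ffunE ler0n.
Qed.

Definition descent_orbit D v := exists2 t, t \in stab (step D) & descends_at D (pword t v).

(* A word whose sorted representative u misses the descent at i is the dominant
   term of the orbit sum of u under the coarser Young subgroup. *)
Lemma coarse_reduction D v : ~ descent_orbit D v ->
  exists2 f, coarse D f & forall w, content (step D) v <= content (step D) w ->
    f w = sym (step D) (delta v) w.
Proof.
move=> bad; have [t tN us] := block_sort_word (step D) v.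
set u := pword t v in us.
have [i iD usi] : exists2 i, i \in D & sorted_on (step (D :\ i)) u.
  by apply: sorted_on_merge us _ => g; apply: bad; exists t.
pose F := sym (step (D :\ i)) (delta u).
pose G := sym (step D) (delta v).
have Fu : F u != 0 by apply: sym_delta_neq0.
have subD s : s \in stab (step D) -> s \in stab (step (D :\ i)).
  by apply: stab_step_sub; apply: subD1set.
have FS : symmetric_on (step (D :\ i)) F by apply: sym_symmetric.
exists ((G u / F u) *: F).
  rewrite -[_ *: _]addr0; apply: coarse_lin (coarse0 _).
  exact: coarse1 iD FS.
move=> w le; rewrite ffunE -/G -[_ *: _]/(_ * _).
have vE : v = pword t^-1%g u by rewrite pwordM mulVg pword1.
have onorb s : s \in stab (step D) -> G u / F u * F (pword s u) = G (pword s u).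
  move=> sN; rewrite (symmetric_on_ffun _ FS (subD _ sN)) divfK //.
  by rewrite (symmetric_on_ffun _ (@sym_symmetric _ _ _ _ _) sN).
have [Fw|Fw] := eqVneq (F w) 0; last first.
  have [s sN e] := sym_delta Fw.
  have [s' s'N e'] : exists2 t, t \in stab (step D) & pword s u = pword t u.
    apply: (content_max (N' := step (D :\ i)) _ _ _ usi sN); try exact: step_homo.
      by move=> p q; apply: step_sub; apply: subD1set.
    by rewrite -e -(content_stab _ (stabV tN)) -vE.
  by rewrite e e' onorb.
have [Gw|Gw] := eqVneq (G w) 0; first by rewrite Fw Gw mulr0.
have [s sN e] := sym_delta Gw.
by rewrite e vE pwordM onorb // stabM ?stabV.
Qed.

Lemma content_ge0 N v : 0 <= content N v.
Proof. by apply: sumr_ge0 => p _; rewrite -PoszM. Qed.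

(** Call a word bad if its orbit under the Young subgroup contains no word of descent set D. By
    [coarse_reduction] the bad words of largest content can be removed at the price of terms of
    smaller content, so the content of the bad support decreases. *)
Lemma coarse_decomposition D x : symmetric_on (step D) x ->
  exists y, [/\ coarse D y, symmetric_on (step D) (x - y) &
    forall v, ~ descent_orbit D v -> (x - y) v = 0].
Proof.
have /choice[f hf] : forall v, exists g, ~ descent_orbit D v -> coarse D g /\
    forall w, content (step D) v <= content (step D) w -> g w = sym (step D) (delta v) w.
  move=> v; have [g|/coarse_reduction[F ? ?]] := pselect (descent_orbit D v); last by exists F.
  by exists 0.
suff H (k : nat) y : symmetric_on (step D) y ->
    (forall v, ~ descent_orbit D v -> y v != 0 -> content (step D) v < k%:Z) ->
    exists z, [/\ coarse D z, symmetric_on (step D) (y - z) &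
      forall v, ~ descent_orbit D v -> (y - z) v = 0].
  (* Contents are nonnegative, so their total bounds each of them and gives a valid start for the
     induction. *)
  move=> xS; apply: (H (absz (\sum_v content (step D) v)).+1) => // v _ _.
  rewrite intS gez0_abs ?sumr_ge0 // => [|u _]; last exact: content_ge0.
  rewrite addrC ltzD1 (bigD1 v) //= lerDl sumr_ge0 // => u _; exact: content_ge0.
elim: k y => [|k IH] y yS yk.
  exists 0; split; rewrite ?subr0 //; first exact: coarse0.
  move=> v bad; apply/eqP/negPn/negP => /(yk v bad).
  by rewrite ltNge content_ge0.
pose P v := `[< ~ descent_orbit D v >] && (content (step D) v == k).
(* On words of content at least k the [f v] are plain orbit sums; with the division by the group
   order they add up to y on the bad words of content k, because y is symmetric. *)
pose z := \sum_(v | P v) (y v / #|stab (step D)|%:R) *: f v.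
have zC : coarse D z by apply: coarse_sum => v /andP[/asboolP /hf[]].
have zS := coarse_symmetric zC.
have yzS : symmetric_on (step D) (y - z).
  by rewrite -scaleN1r addrC; apply: symmetric_onP.
have [|z' [z'C z'S z'0]] := IH (y - z) yzS; last first.
  have E : y - (z' + z) = y - z - z' by rewrite opprD addrA addrAC.
  by exists (z' + z); split; rewrite ?E // -[z']scale1r; apply: coarse_lin.
move=> w bad nz; rewrite ltNge; apply/negP => le; case/eqP: nz.
have zE : z w = \sum_(v | P v) y v / #|stab (step D)|%:R * sym (step D) (delta v) w.
  rewrite sum_ffunE; apply: eq_bigr => v /andP[/asboolP vb /eqP vk].
  by rewrite ffunE (hf v vb).2 ?vk.
rewrite !ffunE zE; apply/eqP; rewrite subr_eq0; apply/eqP.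
have [wk|wk] := eqVneq (content (step D) w) k%:Z; last first.
  rewrite big1 => [|v /andP[_ /eqP vk]]; last first.
    apply/eqP; rewrite mulf_eq0; apply/orP; right; apply/negPn/negP=> /sym_delta[t tN].
    by move=> e; case/eqP: wk; rewrite e content_stab.
  apply/eqP/negPn/negP=> /(yk w bad); rewrite intS addrC ltzD1 => le2.
  by case/eqP: wk; apply/eqP; rewrite eq_le le le2.
have : y w = #|stab (step D)|%:R^-1 * sym (step D) y w.
  by rewrite sym_id // ffunE -[_ *: _]/(_ * _) mulKf ?card_stab_neq0.
move=> ->; rewrite symE mulr_sumr.
under [RHS]eq_bigr => v _ do rewrite symE mulr_sumr.
rewrite exchange_big /=; apply: eq_bigr => t tN.
have P1 : P (pword t w).
  rewrite /P content_stab // wk eqxx andbT; apply/asboolP => -[s sN sg].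
  by apply: bad; exists (s * t)%g; rewrite ?stabM // -pwordM.
rewrite (bigD1 (pword t w)) //= ffunE eqxx mulr1 big1 ?addr0 1?mulrC // => v /andP[_].
by rewrite ffunE eq_sym => /negPf->; rewrite mulr0.
Qed.

(** At a word u of descent set D, of maximal content in the support of x, the antisymmetrization
    equals x u. By [content_min] every other term sits at a word of larger content, whose orbit
    would contain a competitor of u. *)
Lemma descent_supported_eq0 D x : ord0 \notin D -> symmetric_on (step D) x ->
  (forall v, ~ descent_orbit D v -> x v = 0) -> alt (step (codesc D)) x = 0 -> x = 0.
Proof.
move=> D0 xS xb xa; apply/ffunP=> v0; rewrite ffunE; apply/eqP/negPn/negP=> xv0.
have [t0 t0N g0] : descent_orbit D v0 by apply: contrapT => /xb e; rewrite e eqxx in xv0.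
pose P v := `[< descends_at D v >] && (x v != 0).
have P0 : P (pword t0 v0).
  by rewrite /P (symmetric_on_ffun _ xS t0N) xv0 andbT; apply/asboolP.
have [u /andP[/asboolP gu xu] umax] := arg_maxP (content (step D)) P0.
have /ffunP/(_ u) := xa; rewrite altE [RHS]ffunE (bigD1 1%g) ?stab1 //=.
rewrite odd_perm1 expr0 mul1r pword1 big1 ?addr0 => [e|s /andP[sN s1]].
  by rewrite e eqxx in xu.
apply/eqP; rewrite mulf_eq0 signr_eq0 /=; apply/negPn/negP=> xs.
have [t tN gt] : descent_orbit D (pword s u).
  by apply: contrapT => /xb e; rewrite e eqxx in xs.
have Pt : P (pword t (pword s u)).
  by rewrite /P (symmetric_on_ffun _ xS tN) xs andbT; apply/asboolP.
have := umax _ Pt; rewrite content_stab //= leNgt; case/negP.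
apply: (content_min (@step_homo _ _) _ sN s1) => p q pq e.
rewrite (descends_at_lt D0 gu pq e) andbT.
by rewrite -(ltn_add2r (step (codesc D) p)) [X in (_ < _ + X)%N]e !step_codesc.
Qed.

(** For i in D the positions i-1 and i lie in one block of [codesc D], while a function symmetric
    for D without i is fixed by their transposition. Hence its antisymmetrization equals its own
    negative. *)
Lemma alt_codesc_coarse D x : ord0 \notin D -> coarse D x ->
  alt (step (codesc D)) x = 0.
Proof.
move=> D0 [y [hy ->]]; rewrite linear_sum big1 // => i iD.
have i0 : (0 < i)%N by rewrite lt0n; apply: contraNneq D0 => /(@ord_inj _ i ord0) <-.
have lt : (i.-1 < n.+1)%N by rewrite prednK // ltnW // ltn_ord.
pose p := Ordinal lt; have pi : (p <= i)%N by rewrite /= leq_pred.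
have btw (d : 'I_n.+1) : (p < d)%N -> d != i -> (i < d)%N.
  by rewrite -val_eqE /=; lia.
apply: (@alt0_of_symmetric _ _ _ _ _ p i).
- by rewrite -val_eqE /=; lia.
- apply/(step_eqP _ pi) => d dD pd; apply: btw => //.
  by apply/eqP=> e; move: dD; rewrite e !inE iD andbF.
apply: hy => //; apply: stab_tperm; apply/(step_eqP _ pi) => d.
by rewrite !inE => /andP[di _] pd; apply: btw.
Qed.

(* Solomon's descent decomposition: the coarse functions are
   exactly the D-symmetric functions killed by the complementary
   antisymmetrizer, and being orthogonal to them forces x = 0. *)
Lemma descent_core D x : ord0 \notin D -> symmetric_on (step D) x ->
  alt (step (codesc D)) x = 0 ->
  (forall i, i \in D -> sym (step (D :\ i)) x = 0) -> x = 0.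
Proof.
move=> D0 xS xa xh.
have [y [yC yS yb]] := coarse_decomposition xS.
have xy : x - y = 0.
  apply: (descent_supported_eq0 D0 yS yb).
  by rewrite linearB /= xa (alt_codesc_coarse D0 yC) subr0.
move/eqP: xy; rewrite subr_eq0 => /eqP xy.
have [z [hz yE]] := yC; apply: dotf_eq0; rewrite {1}xy yE dotf_suml big1 // => i iD.
have := card_stab_neq0 K (step (D :\ i)) => c0.
apply: (mulfI c0); rewrite mulr0 -dotfZl -(sym_id (hz i iD)) dotf_sym xh //.
by rewrite dotfC dotf0l rmorph0.
Qed.

(** An injective endomorphism T of a finite-dimensional space is onto. Solving x = T y and
    symmetrizing both sides expresses x through an antisymmetrized function up to coarse terms. *)
Lemma descent_surjective D x : ord0 \notin D -> symmetric_on (step D) x ->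
  exists y : fn, (forall s, s \in stab (step (codesc D)) -> pfun s y = (-1) ^+ s *: y) /\
    coarse D (sym (step D) y - x).
Proof.
move=> D0 xS.
have D1 i : i \in D -> forall s, s \in stab (step D) -> s \in stab (step (D :\ i)).
  by move=> _ s; apply: stab_step_sub; apply: subD1set.
pose hD := sym (K := K) (m := m) (step D).
pose aD := alt (K := K) (m := m) (step (codesc D)).
pose c : K := #|stab (step D)|%:R.
have c0 : c != 0 by apply: card_stab_neq0.
(* All three summands are positive semidefinite. The last is c times the projection away from the
   D-symmetric functions, so it forces the kernel to be D-symmetric. *)
pose T y : fn := hD (aD (hD y)) + (\sum_(i in D) sym (step (D :\ i)) y) + (c *: y - hD y).
have Tlin : linear T.
  move=> k y z; rewrite /T /hD /aD !linearP /=.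
  under eq_bigr => i _ do rewrite linearP /=.
  rewrite big_split /= -scaler_sumr [X in X + _ = _]addrACA [X in _ + X = _]addrACA.
  by rewrite [LHS]addrACA -!scalerDr.
pose TL : {linear fn -> fn} := HB.pack T (GRing.isLinear.Build _ _ _ _ T Tlin).
have hT y : hD (T y) = c *: (hD (aD (hD y)) + \sum_(i in D) sym (step (D :\ i)) y).
  rewrite /T /hD !linearD linearZ linearN /= !(sym_id (@sym_symmetric _ _ _ _ _)) -/c.
  rewrite subrr addr0; congr (_ + _); rewrite linear_sum scaler_sumr.
  apply: eq_bigr => i iD /=; rewrite sym_id //.
  by apply: symmetric_onW (D1 i iD) (@sym_symmetric _ _ _ _ _).
have Tinj y : T y = 0 -> y = 0.
  move=> Ty; have e0 : hD (aD (hD y)) + \sum_(i in D) sym (step (D :\ i)) y = 0.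
    have := hT y; rewrite Ty /hD linear0 => /esym/eqP.
    by rewrite scaler_eq0 (negPf c0) => /eqP.
  have hy : c *: y = hD y.
    by apply/eqP; rewrite -subr_eq0; apply/eqP; rewrite -Ty /T e0 add0r.
  have yE : y = c^-1 *: hD y by rewrite -hy scalerA mulVf // scale1r.
  have yS : symmetric_on (step D) y.
    rewrite yE -[_ *: _]addr0; apply: symmetric_onP; last exact: symmetric_on0.
    exact: sym_symmetric.
  pose ca : K := #|stab (step (codesc D))|%:R.
  have dA : dotf (hD (aD (hD y))) y = (c * c / ca) * dotf (aD y) (aD y).
    rewrite dotf_sym -/hD -hy /aD linearZ /= dotfZl.
    have cr : c^* = c by rewrite conjC_nat.
    rewrite dotfC dotfZl rmorphM /= cr -dotfC mulrA.
    rewrite [X in _ * X](_ : _ = ca^-1 * dotf (aD y) (aD y)) ?mulrA //.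
    rewrite /aD -dotf_alt alt_alt dotfZl mulKf //; exact: card_stab_neq0.
  have dH i : i \in D -> dotf (sym (step (D :\ i)) y) y =
      #|stab (step (D :\ i))|%:R^-1 * dotf (sym (step (D :\ i)) y) (sym (step (D :\ i)) y).
    move=> iD; rewrite -dotf_sym (sym_id (@sym_symmetric _ _ _ _ _)) dotfZl mulKf //.
    exact: card_stab_neq0.
  (* Pairing with y writes 0 as a combination of squared norms with positive coefficients, so each
     norm vanishes and [descent_core] applies. *)
  have := congr1 (fun a => dotf a y) e0; rewrite dotfDl dotf_suml dotf0l dA.
  under eq_bigr => i iD do rewrite (dH i iD).
  move=> /eqP.
  rewrite paddr_eq0; first last.
  - by apply: sumr_ge0 => i _; rewrite mulr_ge0 ?invr_ge0 ?ler0n ?dotf_ge0.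
  - by rewrite !mulr_ge0 ?invr_ge0 ?ler0n ?dotf_ge0.
  case/andP; rewrite !mulf_eq0 invr_eq0 (negPf c0) (negPf (card_stab_neq0 K _)) /=.
  move=> /eqP/dotf_eq0 ya; rewrite psumr_eq0; last first.
    by move=> i _; rewrite mulr_ge0 ?invr_ge0 ?ler0n ?dotf_ge0.
  move=> /allP yh; apply: (descent_core D0 yS ya) => i iD.
  have := yh i (mem_index_enum _); rewrite iD mulf_eq0 invr_eq0.
  by rewrite (negPf (card_stab_neq0 K _)) => /eqP/dotf_eq0.
have [y yE] : exists y, x = T y.
  pose f := linfun TL.
  have kf : lker f == 0%VS.
    apply/lker0P => a b; rewrite !lfunE => ab.
    apply/eqP; rewrite -subr_eq0; apply/eqP/Tinj.
    by rewrite -[T _]/(TL _) linearB /= -[X in X - _]/(TL a) ab subrr.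
  exists ((f^-1)%VF x); rewrite -[T _]/(TL _) -lfunE -/f.
  by rewrite lker0_lfunVK.
exists (aD (hD y)); split; first by move=> s sN; rewrite pfun_alt.
exists (fun i => - sym (step (D :\ i)) y); split=> [i iD|].
  by rewrite -scaleN1r -[_ *: _]addr0; apply: symmetric_onP;
    [exact: sym_symmetric|exact: symmetric_on0].
have := hT y; rewrite -yE /hD (sym_id xS) -/c => /(scalerI c0) ->.
by rewrite opprD addrA subrr add0r sumrN.
Qed.

End Descents.

(** * Normal ordered products *)

Definition upd (I : eqType) (T : Type) (s : I -> T) (i : I) (x : T) : I -> T :=
  fun j => if j == i then x else s j.

Lemma upd_same (I : eqType) T (s : I -> T) i x : upd s i x i = x.
Proof. by rewrite /upd eqxx. Qed.

Lemma upd_other (I : eqType) T (s : I -> T) i j x : j != i -> upd s i x j = s j.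
Proof. by rewrite /upd => /negPf->. Qed.

Lemma updC (I : eqType) T (s : I -> T) i j x y : i != j ->
  upd (upd s i x) j y =1 upd (upd s j y) i x.
Proof. by rewrite /upd => /negPf ij k; case: eqVneq => // ->; rewrite eq_sym ij. Qed.

Lemma upd_upd (I : eqType) T (s : I -> T) i x y : upd (upd s i x) i y =1 upd s i y.
Proof. by rewrite /upd => k; case: eqP. Qed.

Lemma upd_id (I : eqType) T (s : I -> T) i : upd s i (s i) =1 s.
Proof. by move=> k; rewrite /upd; case: eqP => [->|]. Qed.

Definition swap (i j p : nat) := if p == i then j else if p == j then i else p.

Section NormalOrder.
Variables (B : pzRingType) (W : zmodType) (rho : B -> W -> W).
Hypothesis rhoDl : forall a b w, rho (a + b) w = rho a w + rho b w.
Hypothesis rhoDr : forall a w x, rho a (w + x) = rho a w + rho a x.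
Hypothesis rho_lie : forall a b w,
  rho (a * b - b * a) w = rho a (rho b w) - rho b (rho a w).

Implicit Types (s : nat -> B) (w : W).

(* In the n-th tensor power of a B-module this is the normal ordered product
   :s_0 ... s_(k-1):, the sum over all placements of the s_i in distinct tensor
   slots; it therefore vanishes there as soon as k > n. *)
Fixpoint nprod k s w : W := if k is k'.+1 then
    rho (s k') (nprod k' s w) - \sum_(j < k') nprod k' (upd s j (s k' * s j)) w
  else w.

Lemma nprod_ext k s s' w : (forall i, (i < k)%N -> s i = s' i) ->
  nprod k s w = nprod k s' w.
Proof.
elim: k s s' => //= k IH s s' e.
rewrite e // (IH s s') => [|i ik]; last by rewrite e // ltnW.
congr (_ - _); apply: eq_bigr => j _; apply: IH => i ik.
have jk := ltn_ord j.
by rewrite /upd !e //; lia.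
Qed.

Lemma eq_nprod k s s' w : s =1 s' -> nprod k s w = nprod k s' w.
Proof. by move=> e; apply: nprod_ext => i _. Qed.

Lemma rho0r a : rho a 0 = 0.
Proof. by apply: (addrI (rho a 0)); rewrite -rhoDr !addr0. Qed.

Lemma rho0l w : rho 0 w = 0.
Proof. by apply: (addrI (rho 0 w)); rewrite -rhoDl !addr0. Qed.

Lemma rhoBr a w x : rho a (w - x) = rho a w - rho a x.
Proof. by apply: (addIr (rho a x)); rewrite -rhoDr !subrK. Qed.

Lemma rhoBl a b w : rho (a - b) w = rho a w - rho b w.
Proof. by apply: (addIr (rho b w)); rewrite -rhoDl !subrK. Qed.

Lemma rho_sumr a (I : Type) (r : seq I) (P : pred I) (F : I -> W) :
  rho a (\sum_(i <- r | P i) F i) = \sum_(i <- r | P i) rho a (F i).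
Proof. exact: (big_morph (rho a) (rhoDr a) (rho0r a)). Qed.

Lemma nprod_updD k s i a b w : (i < k)%N ->
  nprod k (upd s i (a + b)) w = nprod k (upd s i a) w + nprod k (upd s i b) w.
Proof.
elim: k s i a b => //= k IH s i a b; rewrite ltnS leq_eqVlt => /orP[/eqP->|ik].
  rewrite !upd_same rhoDl.
  have e x : nprod k (upd s k x) w = nprod k s w.
    by apply: nprod_ext => j jk; rewrite upd_other // neq_ltn jk.
  have e2 x (j : 'I_k) : nprod k (upd (upd s k x) j (x * upd s k x j)) w =
      nprod k (upd s j (x * s j)) w.
    apply: nprod_ext => l lk; rewrite [upd s k x j]upd_other ?neq_ltn ?ltn_ord //.
    by rewrite /upd; case: eqP => // _; case: eqP => // e0; rewrite e0 ltnn in lk.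
  rewrite !e !(eq_bigr _ (fun j _ => e2 _ j)).
  rewrite (eq_bigr (fun j : 'I_k => nprod k (upd s j (a * s j)) w +
    nprod k (upd s j (b * s j)) w)); last by move=> j _; rewrite mulrDl IH.
  by rewrite big_split /= opprD addrACA.
have ki : k != i by rewrite neq_ltn ik orbT.
rewrite ![upd s i _ k]upd_other // IH // rhoDr addrACA -opprD -big_split /=.
congr (_ - _); apply: eq_bigr => j _.
have [->|ji] := eqVneq (j : nat) i.
  by rewrite !upd_same mulrDr !(eq_nprod _ _ (upd_upd _ _ _ _)) IH.
rewrite ![upd s i _ j]upd_other //.
have ij : i != j by rewrite eq_sym.
by rewrite !(eq_nprod _ _ (updC _ _ _ ij)) IH.
Qed.

Lemma nprod_upd0 k s i w : (i < k)%N -> nprod k (upd s i 0) w = 0.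
Proof.
move=> ik; apply: (addrI (nprod k (upd s i 0) w)).
by rewrite -nprod_updD // !addr0.
Qed.

Lemma nprod_upd_sum k s i w (I : Type) (r : seq I) (P : pred I) (F : I -> B) :
  (i < k)%N -> nprod k (upd s i (\sum_(j <- r | P j) F j)) w =
  \sum_(j <- r | P j) nprod k (upd s i (F j)) w.
Proof.
move=> ik; apply: (big_morph (fun x => nprod k (upd s i x) w)).
  by move=> a b; apply: nprod_updD.
exact: nprod_upd0.
Qed.

Lemma swapK i j : involutive (swap i j).
Proof.
move=> p; rewrite /swap; case: (eqVneq p i) => [->|pi].
  by rewrite eqxx; case: eqP.
by case: (eqVneq p j) => [->|pj]; rewrite ?eqxx // (negPf pi) (negPf pj).
Qed.

Lemma upd_swap T (s : nat -> T) i j l x :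
  upd (s \o swap i j) l x =1 upd s (swap i j l) x \o swap i j.
Proof. by move=> p; rewrite /upd /= (can_eq (swapK i j)). Qed.

(** Let a and b be the two top factors. After two steps of the recursion, everything is visibly
    symmetric in a and b except rho b (rho a .) - rho (b a), which is symmetric by [rho_lie]. Here
    [c] collects the terms absorbed by one lower slot and [d] those absorbed by two distinct
    ones. *)
Lemma nprod_swap_top k s w : nprod k.+2 (s \o swap k k.+1) w = nprod k.+2 s w.
Proof.
set a := s k; set b := s k.+1.
pose d u v : W := \sum_(j < k) \sum_(l < k | l != j)
  nprod k (upd (upd s j (u * s j)) l (v * s l)) w.
pose c u : W := \sum_(j < k) nprod k (upd s j (u * s j)) w.
have E (x : nat -> B) u v : x k = u -> x k.+1 = v -> (forall i, (i < k)%N -> x i = s i) ->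
    nprod k.+2 x w = rho v (rho u (nprod k s w)) - rho (v * u) (nprod k s w)
      - (\sum_(j < k) rho v (nprod k (upd s j (u * s j)) w) +
         \sum_(j < k) rho u (nprod k (upd s j (v * s j)) w))
      + (d v u + (c (u * v) + c (v * u))).
  move=> xu xv xs; rewrite /= xu xv.
  have ex i y : nprod k (upd x i y) w = nprod k (upd s i y) w.
    by apply: nprod_ext => l lk; rewrite /upd xs.
  rewrite (nprod_ext _ xs) big_ord_recr /= xu upd_same.
  rewrite (@nprod_ext k (upd x k (v * u)) s w); last first.
    by move=> l lk; rewrite upd_other ?xs // neq_ltn lk.
  rewrite (eq_bigr (fun j : 'I_k => nprod k (upd s j (u * s j)) w)); last first.
    by move=> j _; rewrite ex xs.
  rewrite [X in _ - (_ + (_ - X))](eq_bigr (fun j : 'I_k =>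
    nprod k (upd s j ((v * u) * s j)) w)); last first.
    move=> j _; rewrite upd_other ?neq_ltn ?ltn_ord // xs //; apply: nprod_ext => l lk.
    rewrite /upd; case: eqP => // _; rewrite xs //.
    by case: eqP => // lk'; rewrite lk' ltnn in lk.
  rewrite [X in _ - (X + _)](eq_bigr (fun j : 'I_k => rho u (nprod k (upd s j (v * s j)) w)
      - (nprod k (upd s j (u * v * s j)) w + \sum_(l < k | l != j)
         nprod k (upd (upd s j (v * s j)) l (u * s l)) w))); last first.
    move=> j _. rewrite upd_other; last by rewrite neq_ltn ltn_ord orbT.
    rewrite xu xs // ex; congr (_ - _); rewrite (bigD1 j) //=; congr (_ + _).
      rewrite upd_same mulrA; apply: nprod_ext => l lk; rewrite upd_upd.
      by rewrite /upd xs.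
    apply: eq_bigr => l lj; rewrite [upd _ _ _ (l : nat)]upd_other ?xs //.
    by apply: nprod_ext => p pk; rewrite /upd xs.
  rewrite rhoBr rho_sumr sumrB big_split /= -/(d v u) -/(c (u * v)) -/(c (v * u)).
  rewrite !opprD !opprK !addrA.
  set X1 := rho v _; set X2 := \sum_(_ < k) rho v _; set X3 := \sum_(_ < k) rho u _.
  set X4 := rho (v * u) _; rewrite [LHS](AC 7%AC (1*6*2*3*5*4*7)%AC) //.
rewrite (@E (s \o swap k k.+1) b a) ?(@E s a b) //=; first last.
- by move=> i ik; rewrite /swap !ltn_eqF // ltnW.
- by rewrite /swap eqxx gtn_eqF.
- by rewrite /swap eqxx.
rewrite [X in _ - X]addrC [X in _ = _ + (_ + X)]addrC; congr (_ - _ + (_ + _)).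
  apply/eqP; rewrite -subr_eq0 opprB [X in X == 0](AC (2*2)%AC ((1*4)*(3*2))%AC).
  by rewrite /= -rho_lie -rhoBl -rhoDl -(opprB (a * b)) subrr rho0l.
rewrite /d (exchange_big_dep xpredT) //= ; apply: eq_bigr => j _.
apply: eq_big => [l|l lj]; first by rewrite eq_sym.
by apply: nprod_ext => p _; rewrite updC // eq_sym.
Qed.

Lemma nprod_swap k s i j w : (i < k)%N -> (j < k)%N ->
  nprod k (s \o swap i j) w = nprod k s w.
Proof.
elim: k s i j => // k IH s i j.
have low s' i' j' : (i' < k)%N -> (j' < k)%N ->
    nprod k.+1 (s' \o swap i' j') w = nprod k.+1 s' w.
  move=> ik jk; have sk : swap i' j' k = k by rewrite /swap !gtn_eqF.
  rewrite /= IH // sk; congr (_ - _).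
  pose t : 'S_k := tperm (Ordinal ik) (Ordinal jk).
  have tE (l : 'I_k) : t l = swap i' j' l :> nat.
    by rewrite /t /swap; case: tpermP => [->|->|] /=; rewrite ?eqxx //;
      [case: eqP|move=> /eqP/negPf; rewrite -val_eqE /= => -> /eqP/negPf;
        rewrite -val_eqE /= => ->].
  rewrite [RHS](reindex_inj (@perm_inj _ t)) /=; apply: eq_bigr => l _.
  by rewrite (eq_nprod _ _ (upd_swap _ _ _ _ _)) IH // -tE.
wlog ij : i j / (i <= j)%N.
  move=> H ik jk; case/orP: (leq_total i j) => h; first exact: H.
  rewrite -(H j i) //; apply: eq_nprod => p /=; congr s.
  by rewrite /swap; case: eqP => [->|]; case: eqP.
rewrite !ltnS => ik; rewrite leq_eqVlt => /orP[/eqP jk|jk]; last first.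
  by apply: low => //; apply: leq_ltn_trans jk.
rewrite {}jk {j ij}; move: ik; rewrite leq_eqVlt => /orP[/eqP->|ik].
  by apply: eq_nprod => p /=; congr s; rewrite /swap; case: eqP.
case: k => // k in IH low ik *; move: ik; rewrite ltnS leq_eqVlt => /orP[/eqP->|ik].
  exact: nprod_swap_top.
(* The transposition of i and k+1 is that of k and k+1 conjugated by that of i and k. *)
rewrite -(low s i k (leqW ik) (ltnSn k)) -(nprod_swap_top k (s \o swap i k)).
rewrite -(low _ i k (leqW ik) (ltnSn k)); apply: eq_nprod => p /=; congr s.
rewrite /swap; case: (p =P i) => ?; case: (p =P k) => ?; case: (p =P k.+1) => ?;
  do ?[case: eqP => ? //=]; lia.
Qed.

(** The recursion read backwards, as in Wick's formula: b either occupies a slot of its own or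
    multiplies a factor already placed. *)
Lemma rho_nprod b k s w : rho b (nprod k s w) =
  nprod k.+1 (upd s k b) w + \sum_(j < k) nprod k (upd s j (b * s j)) w.
Proof.
rewrite /= upd_same (@nprod_ext k (upd s k b) s) ?subrK => [|j jk]; last first.
  by rewrite upd_other // neq_ltn jk.
rewrite -addrA addrC -[LHS]add0r; congr (_ + _); apply/eqP; rewrite addrC eq_sym subr_eq0.
apply/eqP/eq_bigr => j _; rewrite upd_other ?neq_ltn ?ltn_ord //.
apply: nprod_ext => l lk; rewrite /upd; case: eqP => // _.
by case: eqP => // e; rewrite e ltnn in lk.
Qed.

Lemma nprod_square0 f k s w : (forall i, (i < k)%N -> s i = f) -> f * f = 0 ->
  nprod k s w = iter k (rho f) w.
Proof.
move=> + ff; elim: k s => //= k IH s sf.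
rewrite sf // (IH s) => [|i ik]; last by rewrite sf // ltnW.
rewrite big1 ?subr0 // => j _; rewrite sf ?ff ?nprod_upd0 //.
exact: ltnW (ltn_ord j).
Qed.

(** The recursion multiplies factors only from the left, so a factor below the top stays in Z. A
    factor at the top is first moved to the bottom by symmetry; a single factor kills w directly. *)
Lemma nprod_annihilator (Z : B -> Prop) w : (forall b c, Z c -> Z (b * c)) ->
  (forall c, Z c -> rho c w = 0) ->
  forall k s i, (i < k)%N -> Z (s i) -> nprod k s w = 0.
Proof.
move=> ZM Z0; elim=> // k IH.
have low s i : (i < k)%N -> Z (s i) -> nprod k.+1 s w = 0.
  move=> ik Zi /=; rewrite (IH s i ik Zi) rho0r sub0r big1 ?oppr0 // => j _.
  apply: (IH _ i ik); rewrite /upd; case: eqP => // e; apply: ZM; by rewrite -e.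
move=> s i; rewrite ltnS leq_eqVlt => /orP[/eqP->|]; last exact: low.
case: k => [|k] in IH low * => Zi; first by rewrite /= big_ord0 subr0 Z0.
by rewrite -(nprod_swap s w (ltn0Sn _) (ltnSn _)) (low _ 0%N).
Qed.

Lemma nprod_central k s i w (z : B) (h : W -> W) : (i < k)%N ->
  (forall b, z * b = b * z) ->
  (forall x y, h (x + y) = h x + h y) ->
  (forall b x, rho (z * b) x = h (rho b x)) ->
  (forall b x, rho b (h x) = h (rho b x)) ->
  nprod k (upd s i (z * s i)) w = h (nprod k s w).
Proof.
move=> ik zC hD zl zr.
have h0 : h 0 = 0 by apply: (addrI (h 0)); rewrite -hD !addr0.
have hB x y : h (x - y) = h x - h y by apply: (addIr (h y)); rewrite -hD !subrK.
elim: k s i ik => //= k IH s i; rewrite ltnS leq_eqVlt => /orP[/eqP->|ik].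
  rewrite upd_same zl (@nprod_ext k (upd s k (z * s k)) s) => [|j jk]; last first.
    by rewrite upd_other // neq_ltn jk.
  rewrite hB (big_morph h hD h0); congr (_ - _); apply: eq_bigr => j _.
  rewrite -(IH _ j) // upd_same mulrA; apply: nprod_ext => l lk.
  rewrite /upd; case: (eqVneq l j) => // _; first by rewrite ltn_eqF.
  by rewrite ltn_eqF.
rewrite upd_other; last by rewrite neq_ltn ik orbT.
rewrite IH // zr hB (big_morph h hD h0); congr (_ - _); apply: eq_bigr => j _.
have [e|ji] := eqVneq (j : nat) i.
  rewrite -(IH _ i ik) e !upd_same mulrA -zC mulrA; apply: eq_nprod => l.
  by rewrite !upd_upd -mulrA.
rewrite -(IH _ i ik) [upd s i _ j]upd_other //; apply: eq_nprod => l.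
by rewrite updC 1?eq_sym // [upd s j _ i]upd_other 1?eq_sym.
Qed.

End NormalOrder.

(** * The ring K[x, y]/(xy) *)

Section CrossRingTheory.
Variable K : comNzRingType.
Local Notation A := (cross_ring K).
Local Notation KXY := {mpoly K[2]}.
Implicit Types (P Q : A) (c d : int).

Definition cross_x : A := cross_pi 'X_ord0.
Definition cross_y : A := cross_pi 'X_ord_max.

(* The K-basis of A: x^c for c >= 0 and y^(-c) for c < 0. *)
Definition zpow c : A :=
  if c is Posz k then cross_x ^+ k else cross_y ^+ `|c|.

Lemma cross_xy : cross_x * cross_y = 0.
Proof.
rewrite -rmorphM /= -[RHS](raddf0 (@cross_pi K)); apply/eqP.
rewrite /cross_pi -Quotient.idealrBE subr0.
by apply/asboolP; exists 1; rewrite mul1r.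
Qed.

Lemma cross_repr P : exists p, P = cross_pi p.
Proof. by exists (generic_quotient.repr P); rewrite /cross_pi reprK. Qed.

Lemma zpowX c : cross_x * zpow c = if 0 <= c then zpow (c + 1) else 0.
Proof.
case: c => k; rewrite /zpow /=; first by rewrite -exprS addn1.
by rewrite exprS mulrA cross_xy mul0r.
Qed.

Lemma zpowY c : cross_y * zpow c = if c <= 0 then zpow (c - 1) else 0.
Proof.
case: c => [[|k]|k].
- by rewrite /zpow mulr1 expr1.
- by rewrite /zpow exprS mulrA [cross_y * _]mulrC cross_xy mul0r.
by have -> : Negz k - 1 = Negz k.+1 by lia; rewrite /zpow -exprS.
Qed.

Lemma zpow0 : zpow 0 = 1.
Proof. by []. Qed.

Lemma zpowM c d : zpow c * zpow d = if 0 <= c * d then zpow (c + d) else 0.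
Proof.
have xy k l : cross_x ^+ k.+1 * cross_y ^+ l.+1 = 0.
  by rewrite exprSr exprS mulrA -(mulrA _ cross_x) cross_xy mulr0 mul0r.
case: c => [[|k]|k]; first by rewrite zpow0 mul1r mul0r add0r.
- case: d => [l|l]; first by rewrite /zpow -exprD.
  by rewrite /zpow xy pmulr_rge0.
case: d => [[|l]|l]; first by rewrite zpow0 mulr1 mulr0 addr0.
  by rewrite /zpow mulrC xy pmulr_lge0.
have -> : Negz k + Negz l = Negz (k + l).+1 by lia.
have -> : 0 <= Negz k * Negz l by [].
by rewrite /zpow -exprD /= addnS.
Qed.

(** Each monomial x^a y^b is a product of two [zpow]s, hence a [zpow] or 0. *)
Lemma cross_ind (S : A -> Prop) : (forall a P Q, S P -> S Q -> S (a *: P + Q)) ->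
  (forall c, S (zpow c)) -> forall P, S P.
Proof.
move=> Slin Sz P; have [p ->] := cross_repr P.
have S0 : S 0.
  by have := Slin (-1) _ _ (Sz 0) (Sz 0); rewrite scaleN1r addNr.
rewrite [p]mpolyE raddf_sum /=; elim/big_ind: _ => // [x y Sx Sy|m _].
  by rewrite -[x]scale1r; apply: Slin.
rewrite -[cross_pi _]addr0 cross_piZ; apply: Slin => //.
rewrite mpolyXE_id rmorph_prod /= !big_ord_recl big_ord0 mulr1 !rmorphXn /=.
have -> : lift ord0 ord0 = ord_max :> 'I_2 by apply/val_inj.
rewrite -/cross_x -/cross_y -[_ ^+ _]/(zpow (m ord0)%:Z).
have -> : cross_y ^+ m ord_max = zpow (- (m ord_max)%:Z) by case: (m ord_max).
by rewrite zpowM; case: ifP.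
Qed.

Definition zmon c : 'X_{1..2} :=
  if c is Posz k then (U_(ord0) *+ k)%MM else (U_(ord_max) *+ `|c|)%MM.

Definition coef c P : K := (generic_quotient.repr P : KXY)@_(zmon c).

(** Multiples of xy contain no pure power of x or y, so the coefficient does not depend on the
    representative. *)
Lemma coef_pi c p : coef c (cross_pi p) = p@_(zmon c).
Proof.
apply/eqP; rewrite -subr_eq0 -mcoeffB.
have : generic_quotient.repr (cross_pi p : {ideal_quot @xy_ideal K}) - p \in @xy_ideal K.
  by rewrite Quotient.idealrBE reprK.
move=> /asboolP[q ->]; rewrite -mpolyXD.
have : zmon c \notin msupp (q * 'X_[U_(ord0) + U_(ord_max)]).
  rewrite (perm_mem (msuppMX _ _)); apply/mapP => -[m _ /mnmP e].
  have := e ord0; have := e ord_max; rewrite !mnmDE !mnm1E /=.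
  case: c {e} => k; rewrite /zmon /= !mulmnE !mnm1E /=; lia.
by move=> /memN_msupp_eq0 ->.
Qed.

Lemma coef_linear c : linear (coef c : A -> K^o).
Proof.
move=> a P Q; have [[p ->] [q ->]] := (cross_repr P, cross_repr Q).
by rewrite -cross_piZ -raddfD !coef_pi mcoeffD mcoeffZ.
Qed.

Lemma coefD c P Q : coef c (P + Q) = coef c P + coef c Q.
Proof. by have := coef_linear c 1 P Q; rewrite !scale1r. Qed.

Lemma coef0 c : coef c 0 = 0.
Proof. by apply: (addrI (coef c 0)); rewrite -coefD !addr0. Qed.

Lemma coefZ c a P : coef c (a *: P) = a * coef c P.
Proof. by have := coef_linear c a P 0; rewrite !addr0 coef0 addr0. Qed.

Lemma coef_zpow c d : coef c (zpow d) = (c == d)%:R.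
Proof.
have -> : zpow d = cross_pi 'X_[zmon d].
  by case: d => k; rewrite /zpow /zmon -mpolyXn rmorphXn.
rewrite coef_pi mcoeffX; congr (nat_of_bool _)%:R; apply/eqP/eqP => [|->//].
move=> /mnmP e; have := e ord0; have := e ord_max.
by case: c {e} => k; case: d => l; rewrite /zmon /= !mulmnE !mnm1E /= ; lia.
Qed.

Lemma cross_eval0_zpow c : cross_eval0 (zpow c) = (c == 0)%:R.
Proof.
case: c => k; rewrite /zpow -rmorphXn /= cross_eval0_pi rmorphXn /= mevalXU expr0n; by case: k.
Qed.

Lemma cross_eval0D P Q : cross_eval0 (P + Q) = cross_eval0 P + cross_eval0 Q.
Proof.
have [[p ->] [q ->]] := (cross_repr P, cross_repr Q).
by rewrite -raddfD !cross_eval0_pi mevalD.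
Qed.

Lemma cross_eval0Z a P : cross_eval0 (a *: P) = a * cross_eval0 P.
Proof.
by have [p ->] := cross_repr P; rewrite -cross_piZ !cross_eval0_pi mevalZ.
Qed.

Lemma coef_zpowM l c P :
  coef l (zpow c * P) = if 0 <= c * (l - c) then coef (l - c) P else 0.
Proof.
move: P; apply: cross_ind => [a P Q hP hQ|d].
  rewrite mulrDr -scalerAr !coefD !coefZ hP hQ; case: ifP => _ //.
  by rewrite mulr0 addr0.
rewrite zpowM; have [->|ne] := eqVneq l (c + d).
  have -> : c + d - c = d by lia.
  by case: ifP; rewrite ?coef_zpow ?coef0 ?eqxx.
have -> : coef (l - c) (zpow d) = 0.
  by rewrite coef_zpow (_ : (l - c == d) = false) //; apply/eqP => e; move/eqP: ne; lia.
by case: ifP => _; rewrite ?coef0 ?if_same // coef_zpow (negPf ne).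
Qed.

Lemma coef_zpow_zpow l c d :
  coef l (zpow c * zpow d) = ((0 <= c * d) && (c + d == l))%:R.
Proof.
by rewrite zpowM; case: ifP => _; rewrite ?coef0 // coef_zpow eq_sym.
Qed.

End CrossRingTheory.

(** * Polarization of the cyclic vector *)

Section ActTheory.
Variables (K : comNzRingType) (L : lieAlgType K) (M : lieMod L).
Implicit Types (x y : L) (v : M).

Lemma act0l v : act 0 v = 0.
Proof.
have := act_linearl v 1 0 0; rewrite scale1r addr0 scale1r => h.
by apply: (addrI (act 0 v)); rewrite -h addr0.
Qed.

Lemma actDl x y v : act (x + y) v = act x v + act y v.
Proof. by rewrite -[x]scale1r act_linearl !scale1r. Qed.

Lemma actZl c x v : act (c *: x) v = c *: act x v.
Proof. by rewrite -[_ *: x]addr0 act_linearl act0l addr0. Qed.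

End ActTheory.

(** * Highest weight vectors for sl_2 *)

Section SL2.
Variables (K : numFieldType) (L : lieAlgType K) (M : lieMod L) (e f h : L).
Hypotheses (ef : lie e f = h) (hf : lie h f = - 2%:R *: f).

Lemma sl2_h_iter (v : M) c k : act h v = c *: v ->
  act h (iter k (act f) v) = (c - k%:R * 2%:R) *: iter k (act f) v.
Proof.
move=> hv; elim: k => [|k IH] /=; first by rewrite mul0r subr0.
have /eqP := act_lie h f (iter k (act f) v).
rewrite hf IH linearZ /= actZl eq_sym subr_eq => /eqP ->.
by rewrite -scalerDl -natr1; congr (_ *: _); ring.
Qed.

Lemma sl2_e_iter (v : M) c k : act e v = 0 -> act h v = c *: v ->
  act e (iter k.+1 (act f) v) = (k.+1%:R * (c - k%:R)) *: iter k (act f) v.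
Proof.
move=> ev hv.
have comm u : act e (act f u) = act f (act e u) + act h u.
  by rewrite -ef act_lie addrC subrK.
elim: k => [|k IH]; first by rewrite /= comm ev linear0 add0r hv subr0 mul1r.
rewrite [iter k.+2 _ _]/= comm IH linearZ /= -[act f (iter k _ _)]/(iter k.+1 (act f) v).
rewrite (sl2_h_iter _ hv) -scalerDl -!natr1; congr (_ *: _); ring.
Qed.

(** Since e f^(k+1) v = (k+1)(c-k) f^k v, vanishing passes from f^(k+1) v to f^k v as long as c !=
    k. It is applied with c = n, k0 = n+1, and with c = -2, k0 = 0, where it kills v itself. *)
Lemma sl2_truncate (v : M) c k0 : act e v = 0 -> act h v = c *: v ->
  (exists N, iter N (act f) v = 0) -> (forall k, (k0 <= k)%N -> c != k%:R) ->
  iter k0 (act f) v = 0.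
Proof.
move=> ev hv [N fN] ck; elim: N fN => [|N IH] fN.
  by move: fN => /= ->; elim: k0 {ck} => //= k ->; rewrite linear0.
have [/ck cN|] := leqP k0 N; last first.
  by move/subnK => <-; rewrite iterD fN; elim: (k0 - _)%N => //= k ->; rewrite linear0.
apply: IH; have := sl2_e_iter N ev hv; rewrite fN linear0 => /esym/eqP.
by rewrite scaler_eq0 mulf_eq0 pnatr_eq0 subr_eq0 (negPf cN) => /eqP.
Qed.

End SL2.

Lemma invr_scale_mulrn (K : numFieldType) (V : lmodType K) (v : V) (m : nat) :
  (m.+1%:R^-1 *: v) *+ m.+1 = v.
Proof. by rewrite -scaler_nat scalerA mulfV ?scale1r // pnatr_eq0. Qed.

(** * Extension of the action from traceless to all matrices *)

Section Reductive.
Variables (K : numFieldType) (A : comAlgType K) (r : nat) (ev : A -> K).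
Hypotheses (evD : forall P Q, ev (P + Q) = ev P + ev Q)
  (evZ : forall a P, ev (a *: P) = a * ev P).
Local Notation m := r.+1.
Local Notation gA := (current A m).
Local Notation B := 'M[A]_m.

Fact traceless_part_subproof (X : B) :
  X - (m%:R^-1 *: \tr X)%:M \in @traceless A m.
Proof.
by rewrite inE raddfB /= mxtrace_scalar invr_scale_mulrn subrr.
Qed.

Definition traceless_part (X : B) : gA := Sl (traceless_part_subproof X).

Lemma traceless_partD X Y :
  traceless_part (X + Y) = traceless_part X + traceless_part Y.
Proof.
apply/val_inj; rewrite /= linearD /= scalerDr raddfD /= opprD.
by rewrite addrACA.
Qed.

Lemma traceless_partZ c X : traceless_part (c%:A *: X) = c *: traceless_part X.
Proof.
apply/val_inj; rewrite /= mxtraceZ scalerBr scale_scalar_mx; congr (_ - _%:M).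
by rewrite -scalerAr.
Qed.

Lemma traceless_part_val (X : gA) : traceless_part (slval X) = X.
Proof.
apply/val_inj => /=; have /eqP -> := slvalP X.
by rewrite scaler0 raddf0 subr0.
Qed.

Variables (M : lieMod gA) (n : nat).

(* The action of gl(A) on M extending that of sl(A), where the central element
   P I acts by n P(0). *)
Definition gl_act (X : B) (w : M) : M :=
  act (traceless_part X) w + (n%:R * ev (\tr X) / m%:R) *: w.

Lemma gl_actDl X Y w : gl_act (X + Y) w = gl_act X w + gl_act Y w.
Proof.
rewrite /gl_act traceless_partD actDl linearD /= evD mulrDr mulrDl scalerDl.
by rewrite addrACA.
Qed.

Lemma gl_actDr X w x : gl_act X (w + x) = gl_act X w + gl_act X x.
Proof. by rewrite /gl_act linearD /= scalerDr addrACA. Qed.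

Lemma gl_actZl c X w : gl_act (c%:A *: X) w = c *: gl_act X w.
Proof.
rewrite /gl_act traceless_partZ actZl scalerDr scalerA mxtraceZ -scalerAl mul1r.
rewrite evZ; congr (_ + _ *: _). by ring.
Qed.

Lemma gl_actZr c X w : gl_act X (c *: w) = c *: gl_act X w.
Proof. by rewrite /gl_act linearZ /= scalerDr !scalerA mulrC. Qed.

Lemma gl_act_val (X : gA) w : gl_act (slval X) w = act X w.
Proof.
rewrite /gl_act traceless_part_val; have /eqP -> := slvalP X.
by rewrite -(scale0r (0 : A)) evZ mul0r mulr0 mul0r scale0r addr0.
Qed.

(** Scalar matrices are central and act by scalars, so both sides depend only on the traceless
    parts. *)
Lemma gl_act_lie (X Y : B) w :
  gl_act (X * Y - Y * X) w = gl_act X (gl_act Y w) - gl_act Y (gl_act X w).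
Proof.
set Z : gA := lie (traceless_part X) (traceless_part Y).
have -> : X * Y - Y * X = slval Z.
  rewrite /= !mulmxBl !mulmxBr !mul_scalar_mx !mul_mx_scalar !scale_scalar_mx.
  have addE (U V : B) i j : (U + V) i j = U i j + V i j by rewrite mxE.
  have oppE (U : B) i j : (- U) i j = - U i j by rewrite mxE.
  rewrite (mulrC (_ *: \tr Y)); apply/matrixP=> i j; rewrite !(addE, oppE) !mulmxE.
  by ring.
rewrite gl_act_val act_lie /gl_act.
set x := act (traceless_part X) w; set y := act (traceless_part Y) w.
set a := _ * ev (\tr X) / _; set b := _ * ev (\tr Y) / _.
rewrite ![act _ (_ + _)]linearD /= ![act _ (_ *: w)]linearZ /= -/x -/y. rewrite !scalerDr !scalerA.
rewrite (mulrC b) [_ + b *: x + _]addrAC -[X in _ = X - _]addrA.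
rewrite [act _ x + _ + _]addrAC -[X in _ = _ - X]addrA.
by rewrite [b *: x + _ + _](AC 3 (3*2*1)) /= opprD addrACA subrr addr0.
Qed.

End Reductive.

(** * Matrix units applied to the cyclic vector *)

Section WeylRelations.
Variables (K : numFieldType) (A : comAlgType K) (r : nat) (ev : A -> K).
Hypotheses (evD : forall P Q, ev (P + Q) = ev P + ev Q)
  (evZ : forall a P, ev (a *: P) = a * ev P) (ev1 : ev 1 = 1).
Local Notation m := r.+1.
Local Notation gA := (current A m).
Local Notation B := 'M[A]_m.
Variables (M : lieMod gA) (n : nat) (v0 : M).
Hypothesis v0_weyl : weyl_type ev (fun h => n%:R * omega1 h) v0.
Implicit Types (i j k l : 'I_m) (P Q : A).

Local Notation rho := (gl_act ev n).

Definition unitm i j P : B := P *: delta_mx i j.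

Lemma unitmM i j k l P Q :
  unitm i j P * unitm k l Q = if j == k then unitm i l (P * Q) else 0.
Proof.
rewrite /unitm -mulmxE -scalemxAl -scalemxAr scalerA mul_delta_mx_cond.
by case: eqP => _; rewrite ?mulr1n // mulr0n scaler0.
Qed.

Lemma unitm_tr i j P : \tr (unitm i j P) = if i == j then P else 0.
Proof.
rewrite /unitm mxtraceZ /mxtrace (bigD1 i) //= mxE eqxx /= big1 ?addr0 => [|k /negPf ki].
  by case: eqP; rewrite ?mulr1 ?mulr0.
by rewrite mxE ki.
Qed.

Fact offdiag_subproof i j : i != j -> (delta_mx i j : 'M[K]_m) \in @traceless K m.
Proof.
move=> ij; rewrite inE /mxtrace big1 // => k _; rewrite mxE.
by case: eqP => // ->; rewrite (negPf ij).
Qed.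

Lemma ptens_offdiag i j P (ij : i != j) :
  ptens (Sl (offdiag_subproof ij)) P = traceless_part (unitm i j P).
Proof.
apply/val_inj; rewrite /= map_delta_mx unitm_tr (negPf ij).
by rewrite scaler0 raddf0 subr0.
Qed.

Lemma gl_act_tr0 (X : B) (w : M) : \tr X = 0 ->
  rho X w = act (traceless_part X : gA) w.
Proof.
move=> X0; rewrite /gl_act X0 -(scale0r (0 : A)) evZ.
by rewrite mul0r mulr0 mul0r scale0r addr0.
Qed.

Fact diag_subproof j : delta_mx j j - (m%:R^-1)%:M \in @traceless K m.
Proof.
rewrite inE raddfB /= mxtrace_scalar /mxtrace (bigD1 j) //= mxE eqxx.
rewrite big1 ?addr0 => [|k /negPf kj]; last by rewrite mxE kj.
by rewrite -[_ *+ m]mulr_natl mulfV ?subrr // pnatr_eq0.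
Qed.

(** The multiples of 1/m in the traceless part and in the central character cancel. As on the n-th
    tensor power of e_0, only the first diagonal unit survives. *)
Lemma gl_act_diag j P : rho (unitm j j P) v0 = (n%:R * (j == ord0)%:R * ev P) *: v0.
Proof.
have [_ _ _ vh] := v0_weyl; rewrite /gl_act.
have -> : traceless_part (unitm j j P) = ptens (Sl (diag_subproof j)) P.
  apply/val_inj; rewrite /= unitm_tr eqxx map_mxB map_delta_mx map_scalar_mx /=.
  by rewrite scalerBr scale_scalar_mx -scalerAr mulr1.
rewrite vh => [|/=]; last first.
  apply/is_diag_mxP => i l il'; have il : i != l by rewrite -val_eqE.
  rewrite !mxE (negPf il) subr0.
  case: eqP => // ij; case: eqP => // lj; case/eqP: il; by rewrite ij lj.
rewrite unitm_tr eqxx -scalerDl; congr (_ *: _).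
rewrite /omega1 /= !mxE eqxx andbb eq_sym mulr1n.
have : (m%:R : K) != 0 by rewrite pnatr_eq0.
by move: (m%:R : K) => c c0; field.
Qed.

Lemma gl_act_upper i j P : (i < j)%N -> rho (unitm i j P) v0 = 0.
Proof.
move=> lt; have ij : i != j by rewrite -val_eqE neq_ltn lt.
have [_ _ vn _] := v0_weyl; rewrite gl_act_tr0 ?unitm_tr ?(negPf ij) // -(ptens_offdiag P ij).
apply: vn => a b /= ba; rewrite mxE; case: eqP => // ai; case: eqP => // bj.
by move: lt; rewrite -ai -bj ltnNge ba.
Qed.

Lemma bracket_unitm i j P : i != j ->
  lie (traceless_part (unitm j i 1)) (traceless_part (unitm i j P)) =
  traceless_part (unitm j j P - unitm i i P) :> gA.
Proof.
move=> ij; have ji : j != i by rewrite eq_sym.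
apply/val_inj; rewrite /= [\tr (_ - _)]raddfB /= !unitm_tr (negPf ij) (negPf ji) !eqxx.
rewrite subrr scaler0 raddf0 !subr0 !mulmxE !unitmM !eqxx.
by rewrite mul1r mulr1.
Qed.

Lemma sl2_triple i j P : i != j ->
  lie (traceless_part (unitm j j 1 - unitm i i 1)) (traceless_part (unitm i j P)) =
  - 2%:R *: traceless_part (unitm i j P) :> gA.
Proof.
move=> ij; have ji : j != i by rewrite eq_sym.
rewrite -traceless_partZ; apply/val_inj.
rewrite /= [\tr (_ - _)]raddfB /= [\tr (_%:A *: _)]mxtraceZ !unitm_tr (negPf ij) !eqxx.
rewrite subrr mulr0 scaler0 raddf0 !subr0 !mulmxE mulrBl mulrBr !unitmM !eqxx.
rewrite (negPf ji) mul1r mulr1 sub0r subr0.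
by rewrite -opprD -mulr2n !scaleNr !scaler_nat.
Qed.


Lemma trB_unitm i j P : \tr (unitm j j P - unitm i i P) = 0.
Proof. by rewrite [\tr (_ - _)]raddfB /= !unitm_tr !eqxx subrr. Qed.

Lemma act_diagB i j P : act (traceless_part (unitm j j P - unitm i i P) : gA) v0 =
  (n%:R * ((j == ord0)%:R - (i == ord0)%:R) * ev P) *: v0.
Proof.
rewrite -gl_act_tr0 ?trB_unitm // (rhoBl (gl_actDl evD n)) !gl_act_diag.
by rewrite -scalerBl mulrBr mulrBl.
Qed.

Lemma chevalley_nilpotent i j (w : M) : i.+1 = j \/ j.+1 = i ->
  exists N, iter N (act (traceless_part (unitm i j 1) : gA)) w = 0.
Proof.
move=> h; have ij : i != j by rewrite -val_eqE /=; case: h; lia.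
have [[_ nil] _ _ _] := v0_weyl.
have [|N hN] := nil (Sl (offdiag_subproof ij)) _ w; first by exists i, j.
by exists N; rewrite -(ptens_offdiag 1 ij).
Qed.

(** The vector x is killed by the raising unit E_ji, because the bracket of E_ji with E_ij P is
    diagonal and acts by 0 away from the first index. Its weight for this sl_2 is -2, which local
    nilpotency excludes for a nonzero vector. *)
Lemma gl_act_simple i j P : j != ord0 -> j.+1 = i -> rho (unitm i j P) v0 = 0.
Proof.
move=> j0 ji; have ij : i != j by rewrite -val_eqE /= -ji; lia.
have i0 : i != ord0 by rewrite -val_eqE /= -ji.
set x := rho _ _.
have xE : x = act (traceless_part (unitm i j P) : gA) v0.
  by rewrite -gl_act_tr0 // unitm_tr (negPf ij).
have e0 : act (traceless_part (unitm j i 1) : gA) v0 = 0.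
  by rewrite -gl_act_tr0 ?gl_act_upper -?ji // unitm_tr eq_sym (negPf ij).
clearbody x.
apply: (sl2_truncate (k0 := 0) (v := x) (c := - 2%:R) (bracket_unitm 1 ij) (sl2_triple 1 ij)).
- have := act_lie (traceless_part (unitm j i 1) : gA) (traceless_part (unitm i j P)) v0.
  rewrite bracket_unitm // act_diagB (negPf i0) (negPf j0) subrr mulr0 mul0r scale0r.
  by rewrite e0 linear0 subr0 -xE => <-.
- have := act_lie (traceless_part (unitm j j 1 - unitm i i 1) : gA)
    (traceless_part (unitm i j P)) v0.
  rewrite sl2_triple // act_diagB (negPf i0) (negPf j0) subrr mulr0 mul0r scale0r.
  by rewrite linear0 subr0 actZl -xE => <-.
- by apply: chevalley_nilpotent; right.
by move=> k _; rewrite eq_sym -subr_eq0 opprK -natrD pnatr_eq0 addn2.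
Qed.

(** E_ij P is the commutator of E_ik and E_kj P with k = i-1, and both factors kill v0 by
    induction. *)
Lemma gl_act_lower i j P : j != ord0 -> (j < i)%N -> rho (unitm i j P) v0 = 0.
Proof.
move=> j0; move: {-2}(i - j.+1)%N (erefl (i - j.+1)%N) => d.
elim: d i => [|d IH] i ed ji; first by apply: gl_act_simple => //; lia.
have lt : (i.-1 < m)%N by have := ltn_ord i; lia.
pose k := Ordinal lt.
have jk : (j < k)%N by rewrite /=; lia.
have ij : j != i by rewrite -val_eqE neq_ltn ji.
have k0 : k != ord0 by rewrite -val_eqE /= -lt0n; apply: leq_ltn_trans jk.
have := gl_act_lie evZ n (unitm i k 1) (unitm k j P) v0.
have ki : k.+1 = i by rewrite /=; lia.
have dk : (k - j.+1)%N = d by rewrite /=; lia.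
rewrite !unitmM eqxx (negPf ij) mul1r subr0 (IH k (esym dk) jk) (gl_act_simple _ k0 ki).
by rewrite !(rho0r (gl_actDr ev n)) subr0.
Qed.

Lemma gl_act_column i j P : j != ord0 -> rho (unitm i j P) v0 = 0.
Proof.
move=> j0; have [ij|ji|/val_inj->] := ltngtP i j; first exact: gl_act_upper.
  exact: gl_act_lower.
by rewrite gl_act_diag (negPf j0) mulr0 mul0r scale0r.
Qed.

(** The hypotheses force i = 1: local nilpotency is available for Chevalley generators, and E_10 is
    the lowering one in the first column. *)
Lemma gl_act_truncate i : i.-1 = 0%N -> (0 < i)%N ->
  iter n.+1 (rho (unitm i ord0 1)) v0 = 0.
Proof.
move=> i1 i_gt0; have i0 : i != ord0 by rewrite -val_eqE /= -lt0n.
have tr0 : \tr (unitm i ord0 (1 : A)) = 0 by rewrite unitm_tr (negPf i0).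
have -> : iter n.+1 (rho (unitm i ord0 1)) v0 =
    iter n.+1 (act (traceless_part (unitm i ord0 1) : gA)) v0.
  by elim: n.+1 => //= k ->; rewrite gl_act_tr0.
apply: (sl2_truncate (c := n%:R) (bracket_unitm 1 i0) (sl2_triple 1 i0)).
- rewrite -gl_act_tr0 ?gl_act_column // unitm_tr eq_sym (negPf i0) //.
- by rewrite act_diagB eqxx (negPf i0) subr0 mulr1 ev1 mulr1.
- by apply: chevalley_nilpotent; right => /=; lia.
by move=> k; rewrite eqr_nat; lia.
Qed.

End WeylRelations.

(** * The symmetric multilinear map obtained from the cyclic vector *)

Section Polarization.
Variables (K : numFieldType) (A : comAlgType K) (r : nat) (ev : A -> K).
Hypotheses (evD : forall P Q, ev (P + Q) = ev P + ev Q)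
  (evZ : forall a P, ev (a *: P) = a * ev P) (ev1 : ev 1 = 1).
Hypothesis r_gt0 : (0 < r)%N.
Local Notation m := r.+1.
Local Notation gA := (current A m).
Local Notation B := 'M[A]_m.
Local Notation V := 'cV[A]_m.
Variables (M : lieMod gA) (n : nat) (v0 : M).
Implicit Types (j : 'I_m) (P Q : A) (X : B) (x y : V).

Local Notation rho := (gl_act (M := M) ev n).

(** The rank-one operator sending e_j to x and the other basis vectors to 0. *)
Definition in_col j x : B := x *m (delta_mx ord0 j : 'rV[A]_m).

Lemma in_colM X j x : X * in_col j x = in_col j (X *m x).
Proof. by rewrite -mulmxE mulmxA. Qed.

Lemma in_colMv j x y : in_col j x *m y = y j ord0 *: x.
Proof.
rewrite /in_col -mulmxA -rowE; apply/matrixP=> a b.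
by rewrite !mxE big_ord1 !mxE !ord1 mulrC.
Qed.

Lemma in_col_sum X : X = \sum_j in_col j (col j X).
Proof.
apply/matrixP=> a b; rewrite summxE (bigD1 b) //= !mxE big_ord1 !mxE !eqxx mulr1.
rewrite big1 ?addr0 // => j /negPf jb; rewrite !mxE big_ord1 !mxE eq_sym jb.
by rewrite mulr0.
Qed.

Lemma in_col_unitm j x : in_col j x = \sum_i unitm i j (x i ord0).
Proof.
apply/matrixP=> a b; rewrite summxE (bigD1 a) //= !mxE big_ord1 !mxE !eqxx.
rewrite big1 ?addr0 // => i /negPf ia; rewrite !mxE eq_sym ia mulr0 //.
Qed.

Lemma in_colD j x y : in_col j (x + y) = in_col j x + in_col j y.
Proof. exact: mulmxDl. Qed.

Lemma in_colZ j P x : in_col j (P *: x) = P%:M * in_col j x.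
Proof. by rewrite -mulmxE mul_scalar_mx /in_col scalemxAl. Qed.

Definition basisv (i : 'I_m) : V := delta_mx i ord0.

Lemma in_col_basis (i : 'I_m) j : in_col j (basisv i) = unitm i j 1.
Proof. by rewrite /in_col mul_delta_mx /unitm scale1r. Qed.

Definition extend (v : 'I_n -> V) (i : nat) : V := oapp v 0 (insub i).

Lemma extend_ord v (i : 'I_n) : extend v i = v i.
Proof. by rewrite /extend valK. Qed.

(* The map (V (x) A)^n -> M induced by Sym^n(V (x) A) -> M, e_0^n |-> n! v0. *)
Definition polar (v : 'I_n -> V) : M :=
  nprod rho n (fun i => in_col ord0 (extend v i)) v0.

Let rhoDl := gl_actDl evD (M := M) n.
Let rhoDr := gl_actDr (M := M) ev n.
Let rho_lie := gl_act_lie evZ (M := M) n.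

Lemma polar_upd v (i : 'I_n) x :
  polar (upd v i x) = nprod rho n (upd (fun a => in_col ord0 (extend v a)) i (in_col ord0 x)) v0.
Proof.
apply: nprod_ext => j jn; rewrite -[j]/(val (Ordinal jn)) /= !(extend_ord _ (Ordinal jn)).
rewrite /upd -val_eqE /=; case: eqP => // _; by rewrite (extend_ord _ (Ordinal jn)).
Qed.

Lemma eq_polar v w : v =1 w -> polar v = polar w.
Proof.
move=> e; apply: nprod_ext => j jn.
by rewrite !(extend_ord _ (Ordinal jn)) e.
Qed.

Lemma polarD v i x y : polar (upd v i (x + y)) = polar (upd v i x) + polar (upd v i y).
Proof. by rewrite !polar_upd in_colD (nprod_updD rhoDl rhoDr). Qed.

Lemma polarZ v i c x : polar (upd v i (c%:A *: x)) = c *: polar (upd v i x).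
Proof.
rewrite !polar_upd in_colZ.
set s := upd _ (i : nat) (in_col _ x).
rewrite -(@nprod_central _ _ _ _ s i v0 (c%:A)%:M (fun w => c *: w)) //.
- apply: eq_nprod => j; rewrite /s /upd; case: (j == i) => //; by rewrite eqxx.
- by move=> b; rewrite -!mulmxE scalar_mxC.
- by move=> a b; rewrite scalerDr.
- by move=> b w; rewrite -mulmxE mul_scalar_mx gl_actZl.
- by move=> b w; rewrite gl_actZr.
Qed.

Lemma polar_tperm v (i i' : 'I_n) : polar (v \o tperm i i') = polar v.
Proof.
rewrite /polar -[RHS](nprod_swap rhoDl rhoDr rho_lie _ _ (ltn_ord i) (ltn_ord i')).
apply: nprod_ext => l ln; rewrite -[l]/(val (Ordinal ln)) extend_ord /=.
have -> : swap i i' l = tperm i i' (Ordinal ln).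
  rewrite /swap; case: tpermP => [<-|<-|/eqP/negPf + /eqP/negPf] /=; rewrite ?eqxx //.
    by case: eqP.
  by rewrite -!val_eqE /= => -> ->.
by rewrite extend_ord.
Qed.

Lemma polar_perm v (s : 'S_n) : polar (v \o s) = polar v.
Proof.
have [ts -> _] := prod_tpermP s; elim: ts v => [|t ts IH] v.
  by rewrite big_nil; apply: eq_polar => i /=; rewrite perm1.
rewrite big_cons -[RHS]IH -[in RHS](polar_tperm _ t.1 t.2); apply: eq_polar => i /=.
by rewrite permM.
Qed.

Hypothesis v0_weyl : weyl_type ev (fun h => n%:R * omega1 h) v0.

(** Matrices supported in one column other than the first kill v0 and remain such under left
    multiplication, so [nprod_annihilator] applies. *)
Lemma nprod_column k s i j x : (i < k)%N -> j != ord0 -> s i = in_col j x ->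
  nprod rho k s v0 = 0.
Proof.
move=> ik j0 si.
apply: (nprod_annihilator rhoDl rhoDr rho_lie
  (Z := fun c => exists j x, j != ord0 /\ c = in_col j x) (w := v0) _ _ ik).
- by move=> b c [l [y [l0 ->]]]; exists l, (b *m y); rewrite in_colM.
- move=> c [l [y [l0 ->]]]; rewrite in_col_unitm.
  rewrite (big_morph (fun X => rho X v0) (fun X Y => rhoDl X Y v0) (rho0l rhoDl v0)).
  by rewrite big1 // => a _; rewrite gl_act_column.
- by exists j, x.
Qed.

(** For n+1 equal factors E_10 this is the sl_2 truncation. Arbitrary vectors replace the copies of
    e_1 one at a time, each replacement giving a nonzero integer multiple of the next case. *)
Lemma nprod_overflow (y : nat -> V) : nprod rho n.+1 (fun i => in_col ord0 (y i)) v0 = 0.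
Proof.
have i1P : (1 < m)%N by [].
pose i1 := Ordinal i1P.
suff H t z : (t <= n.+1)%N ->
    nprod rho n.+1 (fun i => in_col ord0 (if (i < t)%N then z i else basisv i1)) v0 = 0.
  by rewrite -[RHS](H n.+1 y) //; apply: nprod_ext => i ->.
elim: t z => [|t IH] z tn.
  rewrite (nprod_square0 rhoDl rhoDr (f := unitm i1 ord0 1)) ?gl_act_truncate //.
    by move=> i _; rewrite ltn0 in_col_basis.
  by rewrite unitmM.
pose s i := in_col ord0 (if (i < t)%N then z i else basisv i1).
set target := nprod _ _ _ _.
(* This matrix sends e_1 to z t, and as an extra factor it makes the product vanish on v0. Acting on
   the previous case it replaces each remaining e_1 in turn by z t, all results being equal by
   symmetry. In the first t slots it only produces instances of the previous case. *)
have /(congr1 (rho (in_col i1 (z t)))) := IH z (ltnW tn).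
rewrite (rho0r rhoDr) rho_nprod // (@nprod_column n.+2 _ n.+1 i1 (z t)) ?upd_same ?add0r //.
have -> : \sum_(j < n.+1) nprod rho n.+1 (upd s j (in_col i1 (z t) * s j)) v0 =
    \sum_(j < n.+1 | (t <= j)%N) target.
  rewrite [RHS]big_mkcond; apply: eq_bigr => j _; rewrite in_colM in_colMv.
  case: leqP => tj.
    rewrite mxE eqxx scale1r.
    have tn' : (t < n.+1)%N by [].
    rewrite -(nprod_swap rhoDl rhoDr rho_lie _ _ tn' (ltn_ord j)).
    apply: nprod_ext => l ln; rewrite /= /s /upd /swap ltnS.
    case: (eqVneq l t) => [->|lt]; first by rewrite eqxx leqnn.
    case: (eqVneq l j) => [lj|lj].
      have tl : (t < l)%N by rewrite ltn_neqAle eq_sym lt lj.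
      by rewrite -lj (ltn_eqF tl) ltnn leqNgt tl.
    by rewrite (negPf lj) [(l <= t)%N]leq_eqVlt (negPf lt).
  rewrite -[RHS](IH (upd z j ((z j) i1 ord0 *: z t)) (ltnW tn)).
  by apply: nprod_ext => l _; rewrite /s /upd; case: eqP => // ->; rewrite tj.
rewrite sumr_const => /eqP; rewrite -scaler_nat scaler_eq0 pnatr_eq0 => /orP[|/eqP //].
by rewrite -leqn0 leqNgt; case/negP; apply/card_gt0P; exists (Ordinal tn); apply: leqnn.
Qed.

(** Wick's formula gives the derivation rule plus a product with X as an extra factor. The first
    column of X contributes 0 by [nprod_overflow], the others by [nprod_column]. *)
Lemma gl_act_polar X v : rho X (polar v) = \sum_i polar (upd v i (X *m v i)).
Proof.
rewrite /polar rho_nprod // {1}[X]in_col_sum.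
rewrite (nprod_upd_sum rhoDl rhoDr) // big1 ?add0r => [|j _].
  by apply: eq_bigr => i _; rewrite in_colM extend_ord -polar_upd.
have [->|j0] := eqVneq j ord0; last first.
  by apply: (nprod_column (ltnSn n) j0); rewrite upd_same.
rewrite -[RHS](nprod_overflow (upd (extend v) n (col ord0 X))).
by apply: nprod_ext => i _; rewrite /upd; case: eqP.
Qed.

Lemma act_polar (X : gA) v : act X (polar v) = \sum_i polar (upd v i (slval X *m v i)).
Proof. by rewrite -gl_act_polar (gl_act_val evZ). Qed.

(** The matrix P I acts both as a derivation and by its central character n P(0); equating the two
    gives the power sum relations. *)
Lemma polar_scalar P v : \sum_i polar (upd v i (P *: v i)) = (n%:R * ev P) *: polar v.
Proof.
have := gl_act_polar P%:M v.
under [X in _ = X]eq_bigr => i _ do rewrite mul_scalar_mx.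
move=> <-; rewrite /gl_act mxtrace_scalar.
have -> : traceless_part P%:M = 0 :> gA.
  by apply/val_inj => /=; rewrite mxtrace_scalar -scalerMnr invr_scale_mulrn subrr.
rewrite act0l add0r; congr (_ *: _).
rewrite -scaler_nat evZ.
have : (m%:R : K) != 0 by rewrite pnatr_eq0.
by move: (m%:R : K) => c c0; field.
Qed.

(** The unit E_00 is idempotent and acts on v0 by n, so after k factors the k corrections reduce the
    next eigenvalue to n - k. *)
Lemma polar_const : polar (fun=> basisv ord0) = n`!%:R *: v0.
Proof.
rewrite -ffactnn /polar.
suff H k s : (k <= n)%N -> (forall i, (i < k)%N -> s i = unitm ord0 ord0 1) ->
    nprod rho k s v0 = (n ^_ k)%:R *: v0.
  by rewrite H // => i ik; rewrite (extend_ord _ (Ordinal ik)) in_col_basis.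
elim: k s => [|k IH] s kn se; first by rewrite ffactn0 scale1r.
rewrite /= se // IH ?(ltnW kn) // => [|i ik]; last by rewrite se // ltnW.
rewrite gl_actZr gl_act_diag // eqxx mulr1 ev1 mulr1.
rewrite (eq_bigr (fun=> (n ^_ k)%:R *: v0)) => [|j _]; last first.
  rewrite IH ?(ltnW kn) // => i ik; rewrite /upd.
  case: eqP => _; last by rewrite se // ltnW.
  by rewrite se ?unitmM ?mul1r // ltnS ltnW.
rewrite sumr_const card_ord -scaler_nat !scalerA -scalerBl; congr (_ *: _).
by rewrite ffactnSr natrM natrB ?(ltnW kn) // mulrBr (mulrC k%:R).
Qed.

Lemma polar_span (S : M -> Prop) :
  (forall c u w, S u -> S w -> S (c *: u + w)) -> (forall v, S (polar v)) ->
  forall w, S w.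
Proof.
move=> Slin Sp.
have S0 : S 0 by have := Slin (-1) _ _ (Sp (fun=> 0)) (Sp (fun=> 0)); rewrite scaleN1r addNr.
(* An arbitrary S need not be stable under the action; the span of the values of [polar], encoded
   here, is stable, so cyclicity applies to it. *)
pose S' w := forall X : M -> Prop, (forall c u w, X u -> X w -> X (c *: u + w)) ->
  (forall v, X (polar v)) -> X w.
suff H w : S' w by move=> w; apply: H.
have [_ cyc _ _] := v0_weyl; apply: cyc w.
- by move=> c u u' Su Su' X Xl Xp; exact: Xl (Su X Xl Xp) (Su' X Xl Xp).
- move=> x w Sw X Xl Xp.
  have X0 : X 0 by have := Xl (-1) _ _ (Xp (fun=> 0)) (Xp (fun=> 0)); rewrite scaleN1r addNr.
  apply: (Sw (fun w => X (act x w))) => [c u u' hu hu'|v].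
    by rewrite act_linearr; apply: Xl.
  rewrite act_polar; elim/big_ind: _ => // a b Xa Xb.
  by rewrite -[a]scale1r; apply: Xl.
move=> X Xl Xp.
have X0 : X 0 by have := Xl (-1) _ _ (Xp (fun=> 0)) (Xp (fun=> 0)); rewrite scaleN1r addNr.
have -> : v0 = (n`!%:R)^-1 *: polar (fun=> basisv ord0) + 0.
  by rewrite polar_const addr0 scalerA mulVf ?scale1r // pnatr_eq0 -lt0n fact_gt0.
exact: Xl.
Qed.

End Polarization.

(** * Straightening of exponents *)

Lemma sum_remove_elem (V : nmodType) (I : finType) k (F : {set I} -> I -> V) :
  \sum_(S : {set I} | #|S| == k.+1) \sum_(i in S) F (S :\ i) i =
  \sum_(S : {set I} | #|S| == k) \sum_(i in ~: S) F S i.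
Proof.
rewrite (exchange_big_dep xpredT) //= [RHS](exchange_big_dep xpredT) //=.
apply: eq_bigr => i _.
rewrite (reindex_onto (fun S => i |: S) (fun S => S :\ i)) /=; last first.
  by move=> S /andP[_ iS]; rewrite setD1K.
apply: eq_big => [S|S /andP[_ /eqP->]//].
rewrite setU11 andbT inE cardsU1.
have [iS|iS] /= := boolP (i \in S).
  rewrite andbF; apply/negP=> /andP[_ /eqP/setP/(_ i)].
  by rewrite !inE eqxx iS.
by rewrite add1n eqSS andbT setU1K // eqxx andbT.
Qed.

Section Exponents.
Variable n : nat.
Implicit Types (a b : {ffun 'I_n -> int}) (S : {set 'I_n}).

Definition addset a S : {ffun 'I_n -> int} := [ffun p => a p + (p \in S)%:Z].
Definition height a : nat := (\sum_p `|a p|)%N.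
Definition spread a : nat := (\sum_p \sum_q `|a p - a q|)%N.
Definition topset a S := forall p q, p \in S -> q \notin S -> a q <= a p.

Lemma height_pword s a : height (pword s a) = height a.
Proof.
rewrite /height [RHS](reindex_inj (@perm_inj _ s)).
by apply: eq_bigr => p _; rewrite ffunE.
Qed.

Lemma spread_pword s a : spread (pword s a) = spread a.
Proof.
rewrite /spread [RHS](reindex_inj (@perm_inj _ s)); apply: eq_bigr => p _.
rewrite [RHS](reindex_inj (@perm_inj _ s)).
by apply: eq_bigr => q _; rewrite !ffunE.
Qed.

Lemma height_addset a S : (forall p, p \in S -> 0 <= a p) ->
  height (addset a S) = (height a + #|S|)%N.
Proof.
move=> h; rewrite /height -sum1_card [X in (_ + X)%N]big_mkcond -big_split /=.
apply: eq_bigr => p _; rewrite ffunE; have := h p.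
by case: (p \in S) => [/(_ isT)|_]; lia.
Qed.

Lemma sum_separated S :
  (\sum_p \sum_q ((p \in S) != (q \in S)) = (#|S| * (n - #|S|)).*2)%N.
Proof.
have cC : #|~: S| = (n - #|S|)%N by rewrite cardsCs setCK card_ord.
have -> : (\sum_p \sum_q ((p \in S) != (q \in S)) =
    \sum_p (if p \in S then n - #|S| else #|S|))%N.
  apply: eq_bigr => p _; case: (p \in S).
    rewrite -cC -sum1_card [RHS]big_mkcond; apply: eq_bigr => q _.
    by rewrite inE; case: (q \in S).
  by rewrite -sum1_card [RHS]big_mkcond; apply: eq_bigr => q _; case: (q \in S).
rewrite (bigID (mem S)) /= (eq_bigr (fun=> (n - #|S|)%N)) => [|p -> //].
rewrite [X in (_ + X)%N](eq_bigr (fun=> #|S|)) => [|p /negPf -> //].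
rewrite !sum_nat_const -addnn; congr (_ + _)%N.
rewrite mulnC -cC; congr (_ * _)%N; apply: eq_card => p; by rewrite inE unfold_in.
Qed.

Lemma spread_topset a S : topset a S ->
  spread (addset a S) = (spread a + (#|S| * (n - #|S|)).*2)%N.
Proof.
move=> h; rewrite -sum_separated /spread -big_split /=; apply: eq_bigr => p _.
rewrite -big_split /=; apply: eq_bigr => q _; rewrite !ffunE.
have := h p q; have := h q p.
case: (p \in S); case: (q \in S) => /= h1 h2; lia.
Qed.

(** Raising S by one widens each separated pair by at most one, and it narrows a pair whose larger
    entry lies outside S. *)
Lemma spread_not_topset a S : ~ topset a S ->
  (spread (addset a S) < spread a + (#|S| * (n - #|S|)).*2)%N.
Proof.
move=> ntop.
have [p0 [q0 [pS qS lt]]] : exists p q, [/\ p \in S, q \notin S & a p < a q].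
  apply: contrapT => no; apply: ntop => p q pS qS; rewrite leNgt; apply/negP => lt.
  by apply: no; exists p, q.
rewrite -sum_separated /spread -big_split /=.
rewrite (bigD1 p0) //= [X in (_ < X)%N](bigD1 p0) //= -addSn leq_add //; last first.
  apply: leq_sum => p _; rewrite -big_split /= leq_sum // => q _; rewrite !ffunE.
  by case: (p \in S); case: (q \in S) => /=; lia.
rewrite -big_split /= (bigD1 q0) //= [X in (_ < X)%N](bigD1 q0) //= -addSn leq_add //.
  by rewrite !ffunE pS (negPf qS) /=; lia.
apply: leq_sum => q _; rewrite !ffunE.
by case: (p0 \in S); case: (q \in S) => /=; lia.
Qed.

Lemma pword_addset a S i j : i \in S -> j \notin S -> a i = a j ->
  pword (tperm i j) (addset a S) = addset a (j |: (S :\ i)).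
Proof.
move=> iS jS e; apply/ffunP=> p; rewrite !ffunE !inE.
have ij : i != j by apply: contraNneq jS => <-.
case: tpermP => [->|->|/eqP/negPf pi /eqP/negPf pj].
- by rewrite (negPf ij) eqxx (negPf jS) e.
- by rewrite eqxx iS e.
by rewrite pi pj.
Qed.

End Exponents.

(** * Newton's identities and the basic rewriting step *)

Section SymmetricMultilinear.
Variables (K : numClosedFieldType) (A : comAlgType K) (m n : nat) (ev : A -> K).
Variables (W : lmodType K) (Xi : ('I_n -> 'cV[A]_m) -> W).
Local Notation V := 'cV[A]_m.
Local Notation word := {ffun 'I_n -> 'I_m}.
Local Notation fn := {ffun word -> K^o}.

(** The properties shared by [polar] and by the alternants [theta]. The last one says that the sum
    over the slots of multiplication by P is the scalar n P(0). *)
Record symmetric_multilinear : Prop := SymmetricMultilinear {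
  sml_ext : forall v w, v =1 w -> Xi v = Xi w;
  smlD : forall v i x y, Xi (upd v i (x + y)) = Xi (upd v i x) + Xi (upd v i y);
  smlZ : forall v i c x, Xi (upd v i (c%:A *: x)) = c *: Xi (upd v i x);
  sml_perm : forall v (s : 'S_n), Xi (v \o s) = Xi v;
  sml_scalar : forall P v, \sum_i Xi (upd v i (P *: v i)) = (n%:R * ev P) *: Xi v
}.

Hypothesis XiP : symmetric_multilinear.
Implicit Types (a b : {ffun 'I_n -> int}) (F G : fn).

Lemma sml0 v i : v i = 0 -> Xi v = 0.
Proof.
move=> vi; apply: (addrI (Xi v)).
have e : Xi v = Xi (upd v i 0).
  by apply: (sml_ext XiP) => j; rewrite /upd; case: eqP => // ->.
by rewrite addr0 {3}e -[in RHS](addr0 0) (smlD XiP) -e.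
Qed.

Variable x : A.
Hypothesis ev_x : forall l, ev (x ^+ l.+1) = 0.

Definition mulset (S : {set 'I_n}) (v : 'I_n -> V) : 'I_n -> V :=
  fun p => if p \in S then x *: v p else v p.

(** Let M(k, l) be the sum of x_S x_i^(l+1) over |S| = k and i outside S. Multiplying the (l+1)-st
    power sum by the elementary function of degree k+1 gives M(k, l+1) + M(k+1, l), so the vanishing
    propagates from the power sums M(0, l). *)
Lemma sum_power_elem k l v :
  \sum_(S : {set 'I_n} | #|S| == k) \sum_(i in ~: S)
    Xi (upd (mulset S v) i (x ^+ l.+1 *: v i)) = 0.
Proof.
elim: k l => [|k IH] l.
  rewrite (big_pred1 set0) => [|S]; last by rewrite cards_eq0.
  rewrite setC0 -[RHS](scale0r (Xi v)) -[0 in RHS](mulr0 n%:R) -(ev_x l).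
  rewrite -(sml_scalar XiP); apply: eq_big => [i|i _]; first by rewrite inE.
  by apply: (sml_ext XiP) => p; rewrite /upd /mulset inE.
have : \sum_(S : {set 'I_n} | #|S| == k.+1)
    \sum_i Xi (upd (mulset S v) i (x ^+ l.+1 *: mulset S v i)) = 0.
  by rewrite big1 // => S _; rewrite (sml_scalar XiP) ev_x mulr0 scale0r.
under eq_bigr => S _.
  rewrite (bigID (mem S)) /=.
  rewrite (eq_bigr (fun i => Xi (upd (mulset (S :\ i) v) i (x ^+ l.+2 *: v i)))); last first.
    move=> i iS; apply: (sml_ext XiP) => p; rewrite /upd /mulset iS !inE.
    by case: eqP => //= _; rewrite scalerA -exprSr.
  over.
rewrite big_split /=.
rewrite (sum_remove_elem k (fun S i => Xi (upd (mulset S v) i (x ^+ l.+2 *: v i)))).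
rewrite IH add0r => e; rewrite -[RHS]e; apply: eq_bigr => S _.
apply: eq_big => [i|i]; first by rewrite inE.
by rewrite inE /mulset => /negPf ->.
Qed.

(* Newton's identities: the elementary symmetric functions of positive degree in
   x_1, ..., x_n act by zero because the power sums do. *)
Lemma sum_elementary k v :
  \sum_(S : {set 'I_n} | #|S| == k.+1) Xi (mulset S v) = 0.
Proof.
have := sum_power_elem k 0 v.
under eq_bigr => S _.
  rewrite (eq_bigr (fun i => Xi (mulset (i |: S) v))); last first.
    move=> i; rewrite inE => iS; apply: (sml_ext XiP) => p.
    rewrite /upd /mulset !inE expr1; by case: eqP => //= ->.
  over.
rewrite -(sum_remove_elem k (fun S i => Xi (mulset (i |: S) v))).
under eq_bigr => S /eqP cS.
  rewrite (eq_bigr (fun=> Xi (mulset S v))); last by move=> i iS; rewrite setD1K.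
  rewrite sumr_const cS -scaler_nat.
  over.
rewrite -scaler_sumr => /eqP; rewrite scaler_eq0 pnatr_eq0 => /eqP h.
by rewrite -[RHS]h; apply: eq_bigl => S.
Qed.

Variable z : int -> A.
Hypothesis xz : forall c, x * z c = if 0 <= c then z (c + 1) else 0.

(** F is a coefficient function on words, a the exponents of the slots; z c will be the basis
    element x^c or y^(-c). *)
Definition bracket (F : fn) (a : {ffun 'I_n -> int}) : W :=
  \sum_u F u *: Xi (fun p => z (a p) *: delta_mx (u p) ord0).

Lemma bracket_linear a : linear (bracket^~ a).
Proof.
move=> c F G; rewrite /bracket scaler_sumr -big_split /=; apply: eq_bigr => u _.
by rewrite !ffunE scalerDl scalerA.
Qed.

Lemma bracketD F G a : bracket (F + G) a = bracket F a + bracket G a.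
Proof. by rewrite -[F]scale1r bracket_linear !scale1r. Qed.

Lemma bracket0 a : bracket 0 a = 0.
Proof. by apply: (addrI (bracket 0 a)); rewrite -bracketD !addr0. Qed.

Lemma bracketZ c F a : bracket (c *: F) a = c *: bracket F a.
Proof. by rewrite -[c *: F]addr0 bracket_linear bracket0 addr0. Qed.

Lemma bracket_sum (I : Type) (r : seq I) (P : pred I) (F : I -> fn) a :
  bracket (\sum_(i <- r | P i) F i) a = \sum_(i <- r | P i) bracket (F i) a.
Proof. exact: (big_morph (bracket^~ a) (fun F G => bracketD F G a) (bracket0 a)). Qed.

Lemma bracket_pfun s F a : bracket (pfun s F) a = bracket F (pword s a).
Proof.
rewrite /bracket (reindex (pword s^-1%g)) /=; last first.
  by exists (pword s) => u _; rewrite pwordM ?mulgV ?mulVg pword1.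
apply: eq_bigr => u _; rewrite ffunE pwordM mulgV pword1; congr (_ *: _).
rewrite -(sml_perm XiP _ s); apply: (sml_ext XiP) => p /=.
by rewrite !ffunE permK.
Qed.

(** This is the elementary relation of degree k+1. Sets meeting a slot of negative exponent drop
    out, since x annihilates the powers of y. *)
Lemma sum_bracket_addset F a k :
  \sum_(S : {set 'I_n} | (#|S| == k.+1) && [forall p in S, 0 <= a p])
    bracket F (addset a S) = 0.
Proof.
rewrite /bracket exchange_big /= big1 // => u _; rewrite -scaler_sumr.
have rel := sum_elementary k (fun p => z (a p) *: delta_mx (u p) ord0).
rewrite (bigID (fun S : {set 'I_n} => [forall p in S, 0 <= a p])) /= in rel.
suff -> : \sum_(S : {set 'I_n} | (#|S| == k.+1) && [forall p in S, 0 <= a p])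
    Xi (fun p => z (addset a S p) *: delta_mx (u p) ord0) = 0 by rewrite scaler0.
rewrite -[RHS]rel.
rewrite [X in _ = _ + X]big1 ?addr0 => [|S /andP[_ /forall_inPn[p pS neg]]].
  apply: eq_bigr => S /andP[_ /forall_inP h]; apply: (sml_ext XiP) => p.
  rewrite /mulset ffunE; case: ifP => pS; last by rewrite addr0.
  by rewrite scalerA xz h.
by apply: (@sml0 _ p); rewrite /mulset pS scalerA xz (negPf neg) scale0r.
Qed.

(** Two top sets of equal size differ by exchanging slots of equal exponent, for which F is
    symmetric; each exchange brings S closer to S0. *)
Lemma topset_bracket F a (S S0 : {set 'I_n}) (t : int) :
  (forall p, p \in S0 -> t <= a p) -> (forall p, p \notin S0 -> a p <= t) ->
  (forall p q, a p = a q -> pfun (tperm p q) F = F) ->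
  #|S| = #|S0| -> topset a S -> bracket F (addset a S) = bracket F (addset a S0).
Proof.
move=> h1 h2 hF; move: {2}#|S :\: S0| (leqnn #|S :\: S0|) => d.
elim: d S => [|d IH] S dS cS top.
  move: dS; rewrite leqn0 cards_eq0 setD_eq0 => sub.
  by congr (bracket _ (addset _ _)); apply/eqP; rewrite eqEcard sub cS leqnn.
have [e|[i +]] := set_0Vmem (S :\: S0); first by apply: IH; rewrite ?e ?cards0.
rewrite !inE => /andP[iS0 iS].
have [e|[j]] := set_0Vmem (S0 :\: S).
  have sub : S0 \subset S by rewrite -setD_eq0 e.
  have e' : S0 = S by apply/eqP; rewrite eqEcard sub cS leqnn.
  by rewrite e' iS in iS0.
rewrite !inE => /andP[jS jS0].
have aij : a i = a j.
  by apply/le_anti; rewrite (top i j) // andbT (le_trans (h2 i iS0)) ?h1.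
rewrite -[in LHS](hF i j aij) bracket_pfun pword_addset //.
have cS' : #|j |: (S :\ i)| = #|S0|.
  by rewrite cardsU1 !inE (negPf jS) andbF -cS (cardsD1 i S) iS.
apply: IH => //.
  rewrite -ltnS (leq_trans _ dS) //; apply: proper_card; apply/properP; split.
    apply/subsetP=> p; rewrite !inE => /andP[pS0 /orP[/eqP pj|/andP[_ ->]]].
      by rewrite pj jS0 in pS0.
    by rewrite pS0.
  by exists i; rewrite !inE ?iS0 ?iS // eqxx /= orbF; apply: contraNneq jS => <-.
move=> p q; rewrite !inE negb_or negb_and negbK => hp /andP[qj hq].
have aqi : a q <= a i.
  by case/orP: hq => [/eqP -> //|qS]; apply: top.
case/orP: hp => [/eqP -> |/andP[_ pS]]; first by rewrite -aij.
by case/orP: hq => [/eqP qi|qS]; [rewrite qi aij top|apply: top].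
Qed.

(** In the elementary relation of degree |S0| all top sets contribute the bracket at S0, while the
    other sets give the same height and a smaller spread. The number of top sets is invertible in
    K. *)
Lemma straighten F a (S0 : {set 'I_n}) (t : int) (S : W -> Prop) : 0 <= t -> (0 < #|S0|)%N ->
  (forall p, p \in S0 -> t <= a p) -> (forall p, p \notin S0 -> a p <= t) ->
  (forall p q, a p = a q -> pfun (tperm p q) F = F) ->
  (forall c u w, S u -> S w -> S (c *: u + w)) ->
  (forall b, height b = height (addset a S0) ->
     (spread b < spread (addset a S0))%N -> S (bracket F b)) ->
  S 0 -> S (bracket F (addset a S0)).
Proof.
move=> t0 S0_gt0 h1 h2 hF Slin Slow Szero.
have := sum_bracket_addset F a #|S0|.-1; rewrite prednK // => rel.
pose good (X : {set 'I_n}) := (#|X| == #|S0|) && [forall p in X, 0 <= a p].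
have top0 : topset a S0 by move=> p q /h1 le /h2 ge; apply: le_trans le.
have ge0 p : p \in S0 -> 0 <= a p by move=> /h1; apply: le_trans.
have good0 : good S0 by rewrite /good eqxx; apply/forall_inP.
rewrite (bigID (fun X => `[< topset a X >])) /= in rel.
rewrite (eq_bigr (fun=> bracket F (addset a S0))) in rel; last first.
  move=> X /andP[/andP[/eqP cX _] /asboolP top]; exact: (topset_bracket h1 h2 hF cX top).
rewrite sumr_const in rel; set N := #|_| in rel.
have N0 : N%:R != 0 :> K.
  rewrite pnatr_eq0 -lt0n; apply/card_gt0P; exists S0.
  by rewrite unfold_in -/(good S0) good0; apply/asboolP.
move/eqP: rel; rewrite addr_eq0 -scaler_nat => /eqP rel.
have -> : bracket F (addset a S0) = N%:R^-1 *: (N%:R *: bracket F (addset a S0)) + 0.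
  by rewrite scalerA mulVf // scale1r addr0.
apply: (Slin) => //; rewrite rel -scaleN1r -[_ *: _]addr0; apply: (Slin) => //.
elim/big_ind: _ => // [u w Su Sw|X /andP[/andP[/eqP cX /forall_inP Xge0] /asboolPn ntop]].
  by rewrite -[u]scale1r; apply: (Slin).
apply: (Slow); first by rewrite !height_addset // cX.
rewrite (spread_topset top0) -cX; exact: spread_not_topset.
Qed.

End SymmetricMultilinear.

(** * Exponents attached to a descent set with a cut *)

Section StepExponents.
Variable n : nat.
Implicit Types (D E : {set 'I_n.+1}) (a b : {ffun 'I_n.+1 -> int}) (c p q : 'I_n.+1).

(* A descent set D (not containing 0) together with a cut c in D or c = 0: the
   descents up to c carry powers of x, those beyond c powers of y. *)
Definition cut D c := (ord0 \notin D) && ((c == ord0) || (c \in D)).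

Definition stepexp D c : {ffun 'I_n.+1 -> int} := [ffun p => (step D c)%:Z - (step D p)%:Z].

Definition oppexp a : {ffun 'I_n.+1 -> int} := [ffun p => - a p].

(** Imposed on both a and [oppexp a], it says that the values of a form an interval containing 0. *)
Definition gapfree a := forall t : int, 0 <= t -> (exists p, t < a p) -> exists p, a p = t.

Lemma oppexpK a : oppexp (oppexp a) = a.
Proof. by apply/ffunP=> p; rewrite !ffunE opprK. Qed.

Lemma height_opp a : height (oppexp a) = height a.
Proof. by apply: eq_bigr => p _; rewrite ffunE abszN. Qed.

Lemma spread_opp a : spread (oppexp a) = spread a.
Proof.
apply: eq_bigr => p _; apply: eq_bigr => q _; rewrite !ffunE.
by rewrite -opprD abszN.
Qed.

Lemma step_setD D E p : D \subset E -> step E p = (step D p + step (E :\: D) p)%N.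
Proof.
move=> /subsetP DE; rewrite /step -cardsUI.
rewrite [X in (_ + #|pred_of_set X|)%N](_ : _ = set0) ?cards0 ?addn0; last first.
  by apply/setP=> d; rewrite !inE; case: (d \in D); rewrite ?andbF.
apply: eq_card => d; rewrite !inE; have := DE d.
by case: (d \in D) => [/(_ isT) ->|_]; case: (d \in E); case: (d <= p)%N.
Qed.

(** Between c and q the steps of D and those of E without D go in the same direction, so their
    absolute values add up. *)
Lemma height_stepexp_lt D E c : cut D c -> ord0 \notin E -> D \proper E ->
  (height (stepexp D c) < height (stepexp E c))%N.
Proof.
move=> /andP[D0 cD] E0 /properP[DE [e eE eD]].
have mono q : (`|stepexp D c q| + `|(step (E :\: D) c)%:Z - (step (E :\: D) q)%:Z|
    = `|stepexp E c q|)%N.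
  rewrite !ffunE !(step_setD _ DE).
  have /orP[le|le] := leq_total q c; have := step_homo D le;
    have := step_homo (E :\: D) le; lia.
(* The new descent e must separate q from c: q = 0 if e is at most c, and q = e otherwise. *)
have [q ne] : exists q, step (E :\: D) c != step (E :\: D) q.
  have [ec|ce] := leqP e c.
    exists ord0; rewrite (@step0 _ (E :\: D)); last by rewrite !inE negb_and E0 orbT.
    rewrite -lt0n; apply/card_gt0P; exists e; by rewrite !inE eE eD.
  exists e; rewrite neq_ltn; apply/orP; left; apply/step_ltP; first exact: ltnW.
  by exists e; rewrite ?inE ?eE ?eD ?ce /=.
rewrite /height (bigD1 q) //= [X in (_ < X)%N](bigD1 q) //= -addSn leq_add //.
  by rewrite -mono; lia.
by apply: leq_sum => p _; rewrite -mono leq_addr.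
Qed.

Lemma step_le D p : (step D p <= n.+1)%N.
Proof. by rewrite -[n.+1]card_ord max_card. Qed.

Lemma height_stepexp_le D c : (height (stepexp D c) <= n.+1 * n.+1)%N.
Proof.
rewrite /height -[X in (_ <= X * _)%N]card_ord -sum_nat_const leq_sum // => p _.
by rewrite ffunE; have := step_le D c; have := step_le D p; lia.
Qed.

Lemma gapfree_pword s a : gapfree a -> gapfree (pword s a).
Proof.
move=> h t t0 [p]; rewrite ffunE => lt; have [|q <-] := h t t0; first by exists (s p).
by exists (s^-1%g q); rewrite ffunE permKV.
Qed.

(** A decreasing sequence whose values fill an interval drops by one at a time; D records the
    drops. *)
Lemma decreasing_stepexp b : (forall p q, (p <= q)%N -> b q <= b p) ->
  gapfree b -> gapfree (oppexp b) -> exists D c, cut D c /\ b = stepexp D c.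
Proof.
move=> bm g1 g2.
have drop p q : q = p.+1 :> nat -> b p <= b q + 1.
  move=> qp; rewrite leNgt; apply/negP=> lt.
  have nov t : b q < t -> t < b p -> forall l, b l != t.
    move=> h1 h2 l; apply/eqP=> e; have [lp|pl] := leqP l p.
      by have := bm _ _ lp; lia.
    by have := bm q l; rewrite qp => /(_ pl); lia.
  have [t0|t0] := leP 0 (b p - 1).
    have [|l el] := g1 _ t0; first by exists p; lia.
    have : b l != b p - 1 by apply: nov; lia.
    by rewrite el eqxx.
  have t1 : 0 <= - (b q + 1) by lia.
  have [|l] := g2 _ t1; first by exists q; rewrite ffunE; lia.
  rewrite ffunE => el; have : b l != b q + 1 by apply: nov; lia.
  by move=> /eqP; lia.
pose D := [set q : 'I_n.+1 | [exists p : 'I_n.+1, (p.+1 == q) && (b p != b q)]].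
have D0 : ord0 \notin D by rewrite inE; apply/existsPn => p.
have bE q : b q = b ord0 - (step D q)%:Z.
  have : exists k : nat, q = k :> nat by exists q.
  case=> k; elim: k q => [|k IH] q qk.
    have -> : q = ord0 by apply/val_inj.
    by rewrite (step0 D0) subr0.
  have kP : (k < n.+1)%N by rewrite -ltnS -qk ltnW // ltnS ltn_ord.
  pose p := Ordinal kP; have pq : (p <= q)%N by rewrite qk /=.
  have stepE : step D q = (step D p + (q \in D))%N.
    have [qD|qD] := boolP (q \in D).
      rewrite (step_rem p qD) (step_rem q qD) leqnn leqNgt qk ltnSn addn0.
      congr (_ + _)%N; apply/esym/(step_eqP _ pq) => d.
      by rewrite !inE -val_eqE /= qk => /andP[? _]; lia.
    rewrite addn0; apply/esym/(step_eqP _ pq) => d dD; rewrite qk /=.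
    have : d != q by apply: contraNneq qD => <-.
    by rewrite -val_eqE /= qk; lia.
  have := drop p q qk; have := bm p q pq; have := IH p (erefl _).
  rewrite stepE inE; case: existsP => [[p' /andP[/eqP pp' ne]]|no].
    have -> : p = p' by apply/val_inj; rewrite /=; lia.
    by move: ne => /eqP; lia.
  have : b p = b q.
    by apply/eqP/negPn/negP=> ne; apply: no; exists p; rewrite ne qk eqxx.
  by lia.
have [p0 bp0] : exists p, b p = 0.
  have [/existsP[p lt]|no1] := boolP [exists p, 0 < b p]; first by apply: g1 => //; exists p.
  have [/existsP[p lt]|no2] := boolP [exists p, b p < 0].
    have [|q] := g2 0 (lexx _); first by exists p; rewrite ffunE; lia.
    by rewrite ffunE => /eqP; rewrite oppr_eq0 => /eqP; exists q.
  by exists ord0; apply/le_anti; rewrite !leNgt (existsPn no1 ord0) (existsPn no2 ord0).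
have P0 : b p0 == 0 by apply/eqP.
(* The first position of exponent 0; unless it is position 0, a drop occurs there, as [cut]
   demands. *)
have [c /eqP bc cmin] := @arg_minnP _ p0 (fun p => b p == 0) (fun p => p) P0.
exists D, c; split; last first.
  apply/ffunP=> p; rewrite ffunE bE; congr (_ - _).
  by apply/eqP; rewrite -subr_eq0 -bE bc.
rewrite /cut D0; have [//|c0 /=] := eqVneq c ord0.
have c_gt0 : (0 < c)%N by rewrite lt0n; apply: contraNneq c0 => e; apply/eqP/val_inj.
have pP : (c.-1 < n.+1)%N by rewrite prednK // ltnW.
rewrite inE; apply/existsP; exists (Ordinal pP); rewrite /= prednK // eqxx bc /=.
by apply/negP=> /cmin /=; rewrite leqNgt prednK // leqnn.
Qed.

Lemma sort_stepexp a : gapfree a -> gapfree (oppexp a) ->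
  exists s D c, cut D c /\ pword s a = stepexp D c.
Proof.
move=> g1 g2.
have [t _ tm] := block_sort (fun=> 0%N) (fun p => - a p).
have [||D [c [Dc e]]] := @decreasing_stepexp (pword t a) _ (@gapfree_pword t a g1).
- by move=> p q pq; rewrite !ffunE -lerN2 tm.
- have -> : oppexp (pword t a) = pword t (oppexp a) by apply/ffunP=> p; rewrite !ffunE.
  exact: gapfree_pword.
by exists t, D, c.
Qed.

End StepExponents.

(** * Families of word functions and the two kinds of straightening *)

Section Assembly.
Variables (K : numClosedFieldType) (A : comAlgType K) (m n : nat).
Variables (W : lmodType K) (Xi : ('I_n.+1 -> 'cV[A]_m) -> W) (z : int -> A).
Local Notation word := {ffun 'I_n.+1 -> 'I_m}.
Local Notation fn := {ffun word -> K^o}.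
Local Notation br := (bracket Xi z).
Implicit Types (D E : {set 'I_n.+1}) (a b : {ffun 'I_n.+1 -> int}) (c p q : 'I_n.+1).
Implicit Types (F G : fn) (w : 'I_n.+1 -> fn).

Definition assemble w : W := \sum_D \sum_(c | cut D c) br (w c) (stepexp D c).

Definition admissible w := forall p c, c = p.+1 :> nat ->
  pfun (tperm p c) (w c) = - w c.

Lemma assemble_linear k w w' :
  assemble (fun c => k *: w c + w' c) = k *: assemble w + assemble w'.
Proof.
rewrite scaler_sumr -big_split; apply: eq_bigr => D _ /=.
rewrite scaler_sumr -big_split; apply: eq_bigr => c _ /=.
exact: bracket_linear.
Qed.

Lemma step_succ D p c : c = p.+1 :> nat -> (step D p == step D c) = (c \notin D).
Proof.
move=> cp; have pc : (p <= c)%N by rewrite cp.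
apply/eqP/idP => [/(step_eqP _ pc) h|cD].
  by apply/negP=> /h; rewrite cp ltnS leqnn -cp ltnn => /(_ isT).
apply/(step_eqP _ pc) => d dD; rewrite cp => pd.
have : d != c by apply: contraNneq cD => <-.
by rewrite -val_eqE /= cp; lia.
Qed.

Lemma pred_ord c : c != ord0 -> exists p, c = p.+1 :> nat.
Proof.
move=> c0; have c_gt0 : (0 < c)%N by rewrite lt0n; apply: contraNneq c0 => e; apply/eqP/val_inj.
have pP : (c.-1 < n.+1)%N by rewrite prednK // ltnW.
by exists (Ordinal pP); rewrite /= prednK.
Qed.

Variable ev : A -> K.
Hypothesis XiP : symmetric_multilinear ev Xi.
Variables x y : A.
Hypotheses (ev_x : forall l, ev (x ^+ l.+1) = 0) (ev_y : forall l, ev (y ^+ l.+1) = 0).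
Hypotheses (xz : forall k, x * z k = if 0 <= k then z (k + 1) else 0)
  (yz : forall k, y * z k = if k <= 0 then z (k - 1) else 0).

Let zopp k := z (- k).

Lemma bracket_opp F a : bracket Xi zopp F (oppexp a) = br F a.
Proof.
apply: eq_bigr => u _; congr (_ *: _); apply: (sml_ext XiP) => p.
by rewrite /zopp ffunE opprK.
Qed.

Lemma zopp_mul k : y * zopp k = if 0 <= k then zopp (k + 1) else 0.
Proof. by rewrite /zopp yz oppr_le0 opprD. Qed.

Lemma bracket_sym F a N : (forall p q, N p = N q -> a p = a q) ->
  br (sym N F) a = #|stab N|%:R *: br F a.
Proof.
move=> Na; rewrite /sym bracket_sum (eq_bigr (fun=> br F a)) ?sumr_const ?scaler_nat //.
move=> s /stabP sN; rewrite (bracket_pfun XiP); congr (bracket _ _ _ _).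
by apply/ffunP=> p; rewrite ffunE; apply: Na.
Qed.

Lemma bracket_antisym F a p q : pfun (tperm p q) F = - F -> a p = a q -> br F a = 0.
Proof.
move=> hF e; have : br (pfun (tperm p q) F) a = br F a.
  rewrite (bracket_pfun XiP); congr (bracket _ _ _ _); apply/ffunP=> k.
  by rewrite ffunE; case: tpermP => [->|->|].
rewrite hF -scaleN1r bracketZ scaleN1r => /eqP.
by rewrite eq_sym -subr_eq0 opprK -mulr2n -scaler_nat scaler_eq0 pnatr_eq0 => /eqP.
Qed.

Variable S : W -> Prop.
Hypothesis Slin : forall k u v, S u -> S v -> S (k *: u + v).
Hypothesis S0 : S 0.

Let SZ k u : S (k *: u) -> k != 0 -> S u.
Proof.
move=> h k0; have -> : u = k^-1 *: (k *: u) + 0 by rewrite scalerA mulVf // scale1r addr0.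
exact: Slin.
Qed.

(** For i up to c, lowering by one the exponents before i equalizes the two blocks meeting at i,
    across which F is symmetric, so [straighten] applies to the positions before i. For i beyond c
    the same is done from i on with the opposite exponents and y. *)
Lemma straighten_coarse D c i F : cut D c -> i \in D ->
  symmetric_on (step (D :\ i)) F ->
  (forall G b, height b = height (stepexp D c) ->
     (spread b < spread (stepexp D c))%N -> S (br G b)) ->
  S (br F (stepexp D c)).
Proof.
move=> /andP[D0 cD] iD FS Slow.
have remE p := step_rem p iD.
have tF p q : step (D :\ i) p = step (D :\ i) q -> pfun (tperm p q) F = F.
  by move=> e; apply/FS/stab_tperm.
have lt_step p : (p < i)%N -> (step D p < step D i)%N.
  by move=> pi; apply/step_ltP; [exact: ltnW|exists i; rewrite ?pi ?leqnn].
have i0 : i != ord0 by apply: contraNneq D0 => <-.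
have [ic|ci] := leqP i c.
  pose U := [set p : 'I_n.+1 | (p < i)%N].
  pose a0 : {ffun 'I_n.+1 -> int} := [ffun p => stepexp D c p - (p \in U)%:Z].
  have aE : stepexp D c = addset a0 U by apply/ffunP=> p; rewrite !ffunE subrK.
  rewrite aE in Slow *.
  apply: (straighten XiP ev_x xz (t := (step D c)%:Z - (step D i)%:Z)) => //.
  - by rewrite subr_ge0 lez_nat step_homo.
  - apply/card_gt0P; exists ord0; rewrite inE lt0n; apply: contraNneq i0 => e.
    exact/eqP/val_inj.
  - by move=> p; rewrite !ffunE !inE => pi; rewrite pi; have := lt_step p pi; lia.
  - move=> p; rewrite !ffunE !inE => /negPf pi; rewrite pi.
    by have := @step_homo _ D i p; rewrite leqNgt pi => /(_ isT); lia.
  - move=> p q; rewrite !ffunE !inE (remE p) (remE q) (leqNgt i p) (leqNgt i q) => e.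
    apply: tF; move: e.
    move: (step D c) (step _ p) (step _ q) (p < i)%N (q < i)%N => C s1 s2 b1 b2.
    by case: b1; case: b2 => /=; lia.
  by move=> b; apply: Slow.
rewrite -bracket_opp.
pose U := [set p : 'I_n.+1 | (i <= p)%N].
pose a0 : {ffun 'I_n.+1 -> int} := [ffun p => oppexp (stepexp D c) p - (p \in U)%:Z].
have aE : oppexp (stepexp D c) = addset a0 U by apply/ffunP=> p; rewrite !ffunE subrK.
have {}Slow G b : height b = height (addset a0 U) ->
    (spread b < spread (addset a0 U))%N -> S (bracket Xi zopp G b).
  rewrite -aE height_opp spread_opp -(height_opp b) -(spread_opp b) => h1 h2.
  by rewrite -(oppexpK b) bracket_opp; apply: Slow.
rewrite aE; apply: (straighten XiP ev_y zopp_mul (t := (step D i)%:Z - 1 - (step D c)%:Z)) => //.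
- by have := lt_step c ci; lia.
- by apply/card_gt0P; exists i; rewrite inE.
- move=> p; rewrite !ffunE !inE => ip; rewrite ip.
  by have := @step_homo _ D i p ip; lia.
- move=> p; rewrite !ffunE !inE => /negPf pi; rewrite pi.
  by have := lt_step p; rewrite ltnNge pi => /(_ isT); lia.
- move=> p q; rewrite !ffunE !inE (remE p) (remE q) => e; apply: tF; move: e.
  move: (step D c) (step _ p) (step _ q) (i <= p)%N (i <= q)%N => C s1 s2 b1 b2.
  by case: b1; case: b2 => /=; lia.
by move=> b; apply: Slow.
Qed.

(** Lowering all exponents above the missing value t by one identifies no two different exponents,
    so F averaged over the fibres of a is still symmetric enough for [straighten]. *)
Lemma straighten_gap F a : ~ gapfree a ->
  (forall G b, height b = height a -> (spread b < spread a)%N -> S (br G b)) ->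
  S (br F a).
Proof.
(* [stab] takes functions to natural numbers, and [pickle] codes the integer exponents without
   changing their fibres. *)
move=> gap Slow; pose N p := pickle (a p).
have NP p q : N p = N q <-> a p = a q.
  by split=> [/(pcan_inj (@pickleK _))|e]; rewrite /N ?e.
have [t [t0 [p0 lt0] nt]] : exists t, [/\ 0 <= t, exists p, t < a p & forall p, a p <> t].
  apply: contrapT => no; apply: gap => t t0 ex; apply: contrapT => no2; apply: no.
  by exists t; split=> // p e; apply: no2; exists p.
apply: (@SZ #|stab N|%:R); last exact: card_stab_neq0.
rewrite -(bracket_sym F (fun p q => proj1 (NP p q))).
pose U := [set p | t < a p].
pose a0 : {ffun 'I_n.+1 -> int} := [ffun p => a p - (p \in U)%:Z].
have aE : a = addset a0 U by apply/ffunP=> p; rewrite !ffunE subrK.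
have ntp p : a p < t \/ t < a p.
  by case: (ltgtP (a p) t) => [|| /nt]; [left|right|].
rewrite aE; rewrite aE in Slow; apply: (straighten XiP ev_x xz (t := t)) => //.
- by apply/card_gt0P; exists p0; rewrite inE.
- by move=> p; rewrite !ffunE inE => h; rewrite h; lia.
- by move=> p; rewrite !ffunE inE => /negPf h; rewrite h; have := ntp p; rewrite h; lia.
- move=> p q e; apply: sym_symmetric; apply/stab_tperm/NP; move: e; rewrite !ffunE !inE.
  by case: (ntp p) => np; case: (ntp q) => nq; move: (np) (nq);
    case: (ltP t (a p)) => ?; case: (ltP t (a q)) => ? /=; lia.
by move=> b; apply: Slow.
Qed.

End Assembly.

(** * Spanning by admissible families *)

Section Surjectivity.
Variables (K : numClosedFieldType) (A : comAlgType K) (m n : nat).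
Variables (W : lmodType K) (Xi : ('I_n.+1 -> 'cV[A]_m) -> W) (z : int -> A).
Local Notation word := {ffun 'I_n.+1 -> 'I_m}.
Local Notation fn := {ffun word -> K^o}.
Local Notation br := (bracket Xi z).
Implicit Types (D E : {set 'I_n.+1}) (a b : {ffun 'I_n.+1 -> int}) (c p q : 'I_n.+1).
Implicit Types (F G : fn) (w : 'I_n.+1 -> fn).
Variable ev : A -> K.
Hypothesis XiP : symmetric_multilinear ev Xi.
Variables x y : A.
Hypotheses (ev_x : forall l, ev (x ^+ l.+1) = 0) (ev_y : forall l, ev (y ^+ l.+1) = 0).
Hypotheses (xz : forall k, x * z k = if 0 <= k then z (k + 1) else 0)
  (yz : forall k, y * z k = if k <= 0 then z (k - 1) else 0).

Let image v := exists2 w, admissible w & v = assemble Xi z w.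

Let image_lin k u v : image u -> image v -> image (k *: u + v).
Proof.
move=> [w1 a1 ->] [w2 a2 ->]; exists (fun c => k *: w1 c + w2 c).
  by move=> p c pc; rewrite linearP /= a1 ?a2 // scalerN opprD.
by rewrite assemble_linear.
Qed.

Let image0 : image 0.
Proof.
exists (fun=> 0); first by move=> p c _; rewrite linear0 oppr0.
by rewrite /assemble big1 // => D _; rewrite big1 // => c _; rewrite bracket0.
Qed.

(** Induction on the height upwards, then on the spread downwards. At a step exponent the
    symmetrization of F is, modulo coarse functions, that of a function g antisymmetric for the
    complementary Young subgroup. The family equal to g at c and 0 elsewhere yields the bracket of g
    at D plus terms at larger descent sets. *)
Lemma assemble_surjective F a : exists2 w, admissible w & br F a = assemble Xi z w.
Proof.
rewrite -/(image _).
have [k] := ubnP (n.+1 * n.+1 - height a)%N; elim: k a F => // k IHk a F.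
rewrite ltnS => ak.
have [d] := ubnP (spread a); elim: d a F ak => // d IHd a F ak.
rewrite ltnS => ad.
have Slow G b : height b = height a -> (spread b < spread a)%N -> image (br G b).
  by move=> hb sb; apply: IHd; rewrite ?hb // (leq_trans sb).
have [g1|ng1] := pselect (gapfree a); last first.
  exact: (straighten_gap XiP ev_x xz image_lin image0 _ ng1 Slow).
have [g2|ng2] := pselect (gapfree (oppexp a)); last first.
  rewrite -(bracket_opp z XiP).
  apply: (straighten_gap XiP ev_y (zopp_mul yz) image_lin image0 _ ng2) => G b.
  rewrite height_opp spread_opp -(height_opp b) -(spread_opp b) => h1 h2.
  by rewrite -(oppexpK b) (bracket_opp z XiP); apply: Slow.
have [s [D [c [Dc sa]]]] := sort_stepexp g1 g2.
have -> : br F a = br (pfun s^-1%g F) (stepexp D c).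
  by rewrite -sa -(bracket_pfun XiP) pfunM mulVg pfun1.
move: {F} (pfun _ F) => F.
rewrite -(height_pword s a) -(spread_pword s a) sa in Slow ak.
have D0 : ord0 \notin D by case/andP: Dc.
have expN p q : step D p = step D q -> stepexp D c p = stepexp D c q.
  by rewrite !ffunE => ->.
have NZ := card_stab_neq0 K (step D).
have [g [ga [yy [yyS yyE]]]] := descent_surjective D0 (@sym_symmetric _ _ _ (step D) F).
have img : image (br g (stepexp D c)).
  have gE E : D \subset E -> D != E -> cut E c -> image (br g (stepexp E c)).
    move=> DE nDE Ec; apply: IHk; apply: leq_trans ak.
    have E0 : ord0 \notin E by case/andP: Ec.
    have := height_stepexp_lt Dc E0; rewrite properEneq DE nDE => /(_ isT).
    by have := height_stepexp_le E c; lia.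
  have wa : admissible (upd (fun=> 0) c g).
    move=> p c' pc; rewrite /upd; case: eqP => [e|_]; last by rewrite linear0 oppr0.
    rewrite e in pc *; have c0 : c != ord0 by rewrite -val_eqE /= pc.
    have pc' : p != c by rewrite -val_eqE /= pc; lia.
    rewrite ga ?odd_tperm ?pc' ?expr1 ?scaleN1r //; apply/stab_tperm/eqP.
    rewrite step_succ // !inE c0 negbK /=.
    by case/andP: Dc => _; rewrite (negPf c0).
  have wE : assemble Xi z (upd (fun=> 0) c g) =
      \sum_(E | cut E c) br g (stepexp E c).
    rewrite /assemble [RHS]big_mkcond; apply: eq_bigr => E _.
    rewrite big_mkcond (bigD1 c) //= upd_same big1 ?addr0 // => c' cc'.
    by rewrite upd_other // bracket0; case: ifP.
  rewrite (bigD1 D) //= in wE.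
  have -> : br g (stepexp D c) = (- 1) *: (\sum_(E | cut E c && (E != D)) br g (stepexp E c)) +
      assemble Xi z (upd (fun=> 0) c g).
    by rewrite wE scaleN1r addrCA addNr addr0.
  apply: image_lin; last by exists (upd (fun=> 0) c g).
  elim/big_ind: _ => // [u v iu iv|E /andP[Ec ED]].
    by rewrite -[u]scale1r; apply: image_lin.
  (* If some i in D is missing from E, the exponents at i-1 and i agree while g is antisymmetric
     there, so the term vanishes. *)
  have [DE|/subsetPn[i iD iE]] := boolP (D \subset E).
    by apply: gE => //; rewrite eq_sym.
  have i0 : i != ord0 by apply: contraNneq D0 => <-.
  have [p pi] := pred_ord i0; have ppi : p != i by rewrite -val_eqE /= pi; lia.
  rewrite (@bracket_antisym _ _ _ _ _ _ _ _ XiP _ _ p i) //.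
    rewrite ga ?odd_tperm ?ppi ?expr1 ?scaleN1r //; apply/stab_tperm/eqP.
    by rewrite step_succ // !inE i0 negbK.
  by rewrite !ffunE; congr (_ - Posz _); apply/eqP; rewrite step_succ.
have imgS : image (br (sym (step D) F) (stepexp D c)).
  have -> : sym (step D) F = (- 1) *: (sym (step D) g - sym (step D) F) + sym (step D) g.
    by rewrite scaleN1r opprB subrK.
  rewrite bracket_linear; apply: image_lin; last first.
    rewrite (bracket_sym z XiP g expN) -[_ *: _]addr0; exact: image_lin.
  rewrite yyE bracket_sum; elim/big_ind: _ => // [u v iu iv|i iD].
    by rewrite -[u]scale1r; apply: image_lin.
  exact: (straighten_coarse XiP ev_x ev_y xz yz image_lin image0 Dc iD (yyS i iD) Slow).
have -> : br F (stepexp D c) = #|stab (step D)|%:R^-1 *: br (sym (step D) F) (stepexp D c) + 0.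
  by rewrite (bracket_sym z XiP F expN) scalerA mulVf // scale1r addr0.
exact: image_lin.
Qed.

End Surjectivity.

(** * A module of alternants *)

Section RowReplacement.
Variables (R : comNzRingType) (n : nat).
Implicit Types (M N : 'M[R]_n) (p : 'I_n) (r : 'I_n -> R).

Lemma cofactor_row_ext M N p q : (forall a b, a != p -> M a b = N a b) ->
  cofactor M p q = cofactor N p q.
Proof.
move=> h; rewrite /cofactor; congr (_ * \det _).
by apply/matrixP=> a b; rewrite !mxE h // eq_sym neq_lift.
Qed.

Definition setrow M p r : 'M[R]_n := \matrix_(a, b) if a == p then r b else M a b.

Lemma det_setrow M p r : \det (setrow M p r) = \sum_q r q * cofactor M p q.
Proof.
rewrite (expand_det_row _ p); apply: eq_bigr => q _; rewrite mxE eqxx; congr (_ * _).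
by apply: cofactor_row_ext => a b /negPf ap; rewrite mxE ap.
Qed.

(** The derivative of det (M (1 + e N)) at e = 0, computed row by row and through the adjugate. *)
Lemma sum_det_setrow_mul M N :
  \sum_p \det (setrow M p (fun q => (M *m N) p q)) = \tr N * \det M.
Proof.
transitivity (\tr (M *m N *m \adj M)).
  rewrite /mxtrace; apply: eq_bigr => p _; rewrite det_setrow [RHS]mxE.
  by apply: eq_bigr => q _; rewrite [\adj M q p]mxE.
by rewrite mxtrace_mulC mulmxA mul_adj_mx mul_scalar_mx mxtraceZ mulrC.
Qed.

End RowReplacement.

Section Dual.
Variables (K : numClosedFieldType) (A : comAlgType K) (m n : nat).
Variables (z : int -> A) (coef : int -> A -> K) (ev : A -> K).
Hypotheses (coefD : forall l P Q, coef l (P + Q) = coef l P + coef l Q)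
  (coefZ : forall l a P, coef l (a *: P) = a * coef l P)
  (coef_zM : forall l c P,
     coef l (z c * P) = if 0 <= c * (l - c) then coef (l - c) P else 0)
  (z0 : z 0 = 1)
  (span_z : forall S : A -> Prop,
     (forall a P Q, S P -> S Q -> S (a *: P + Q)) -> (forall c, S (z c)) -> forall P, S P)
  (evD : forall P Q, ev (P + Q) = ev P + ev Q)
  (evZ : forall a P, ev (a *: P) = a * ev P)
  (ev_z : forall c, ev (z c) = (c == 0)%:R).
Local Notation V := 'cV[A]_m.
Local Notation B := 'M[A]_m.

(** A test (j, g, u): slot p is multiplied by g p and read along the basis vector u p, and j fixes
    the window of exponents j, ..., j-n+1 to be extracted. *)
Definition dual_index : Type := ('I_n * ('I_n -> A) * ('I_n -> 'I_m))%type.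
Local Notation Y := (dual_index -> K^o).
Implicit Types (v : 'I_n -> V) (g : 'I_n -> A) (u : 'I_n -> 'I_m) (j p q : 'I_n).

Definition coefmx v j g u (s : 'S_n) : 'M[K]_n :=
  \matrix_(p, q) coef (j%:Z - q%:Z) (v (s p) (u p) ord0 * g p).

(* For x^a y^b monomials the determinant is the sign of the rearrangement of the
   exponents into j, j-1, ..., j-n+1, so theta spans a space of alternants; power
   sums of positive degree kill it. *)
Definition theta v : Y := fun i =>
  \sum_(s : 'S_n) \det (coefmx v i.1.1 i.1.2 i.2 s).

Lemma eq_theta v w : v =1 w -> theta v = theta w.
Proof. by move=> /funext ->. Qed.

Lemma coefmx_upd v i x j g u (s : 'S_n) p : s p = i ->
  coefmx (upd v i x) j g u s =
  setrow (coefmx v j g u s) p (fun q => coef (j%:Z - q%:Z) (x (u p) ord0 * g p)).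
Proof.
move=> <-; apply/matrixP=> a b; rewrite !mxE /upd (inj_eq perm_inj).
by case: eqP => // ->.
Qed.

Lemma thetaD v i x y : theta (upd v i (x + y)) = theta (upd v i x) + theta (upd v i y).
Proof.
apply/funext => -[[j g] u]; rewrite /theta -[RHS]big_split /=; apply: eq_bigr => s _.
rewrite !(coefmx_upd _ _ _ _ _ (permKV s i)) !det_setrow -big_split /=.
by apply: eq_bigr => q _; rewrite mxE mulrDl coefD mulrDl.
Qed.

Lemma thetaZ v i c x : theta (upd v i (c%:A *: x)) = c *: theta (upd v i x).
Proof.
apply/funext => -[[j g] u]; rewrite /theta [RHS]mulr_sumr; apply: eq_bigr => s _.
rewrite !(coefmx_upd _ _ _ _ _ (permKV s i)) !det_setrow mulr_sumr.
apply: eq_bigr => q _; rewrite !mxE -[c%:A * _ * _]mulrA -[c%:A * _]scalerAl mul1r coefZ.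
by rewrite -mulrA.
Qed.

Lemma theta_perm v (t : 'S_n) : theta (v \o t) = theta v.
Proof.
apply/funext => -[[j g] u]; rewrite /theta [RHS](reindex_inj (mulIg t)) /=.
apply: eq_bigr => s _; congr (\det _); apply/matrixP=> p q.
by rewrite !mxE /= permM.
Qed.

Lemma sum_theta (f : 'I_n -> 'I_n -> V) i :
  (\sum_j theta (f j)) i = \sum_j theta (f j) i.
Proof. by elim/big_rec2: _ => // j a b _ <-. Qed.

(** Multiplying a slot by z c shifts the columns of its row by c, hence multiplies that row by a
    matrix N with zero diagonal. Summed over the rows this is tr N times the determinant. *)
Lemma theta_zshift v (c : int) : c != 0 -> \sum_i theta (upd v i (z c *: v i)) = 0.
Proof.
move=> c0; apply/funext => -[[j g] u].
rewrite sum_theta.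
rewrite /theta exchange_big /= big1 // => s _.
pose N : 'M[K]_n := \matrix_(q', q)
  ((q'%:Z == q%:Z + c) && (0 <= c * (j%:Z - q%:Z - c)))%:R.
have trN : \tr N = 0.
  rewrite /mxtrace big1 // => q _; rewrite mxE.
  suff -> : (q%:Z == q%:Z + c) = false by [].
  by apply/eqP; move/eqP: c0; lia.
rewrite (reindex_inj (@perm_inj _ s)) /=.
transitivity (\tr N * \det (coefmx v j g u s)); last by rewrite trN mul0r.
rewrite -sum_det_setrow_mul; apply: eq_bigr => p _.
rewrite (coefmx_upd _ _ _ _ _ (erefl (s p))); congr (\det (setrow _ _ _)).
apply/funext => q; rewrite !mxE -mulrA coef_zM.
case: ifP => cond; last first.
  by rewrite big1 // => q' _; rewrite !mxE cond andbF mulr0.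
(* The sign condition keeps q + c on the side of j from which the shift starts, so the shifted
   column stays inside the window. *)
have [q' eq'] : exists q' : 'I_n, q'%:Z = q%:Z + c.
  have lt : (absz (q%:Z + c)%R < n)%N.
    have := ltn_ord j; have := ltn_ord q; case: (ltgtP c 0) c0 cond => // h _ cond.
      by have : j%:Z - q%:Z - c <= 0 by [nra]; lia.
    by have : 0 <= j%:Z - q%:Z - c by [nra]; lia.
  exists (Ordinal lt) => /=; rewrite gez0_abs //.
  case: (ltgtP c 0) c0 cond => // h _ cond; last by lia.
  by have : j%:Z - q%:Z - c <= 0 by [nra]; lia.
rewrite (bigD1 q') //= !mxE eq' eqxx cond mulr1 big1 ?addr0 => [|q2 ne].
  by rewrite opprD addrA.
rewrite !mxE; case: eqP => [e|]; last by rewrite mulr0.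
by case/eqP: ne; apply/val_inj/eqP; rewrite -eqz_nat e eq'.
Qed.

Lemma theta_scalar P v : \sum_i theta (upd v i (P *: v i)) = (n%:R * ev P) *: theta v.
Proof.
move: P; apply: span_z => [a P Q hP hQ|c].
  have eZ i : (a *: P + Q) *: v i = a%:A *: (P *: v i) + Q *: v i.
    by rewrite scalerDl scalerA -scalerAl mul1r.
  under eq_bigr => i _ do rewrite eZ thetaD thetaZ.
  rewrite big_split /= -scaler_sumr hP hQ evD evZ scalerA -scalerDl.
  by congr (_ *: _); ring.
rewrite ev_z;  have [->|c0] := eqVneq c 0; last by rewrite theta_zshift // mulr0 scale0r.
rewrite mulr1 scaler_nat -[X in _ = _ *+ X]card_ord -sumr_const.
apply: eq_bigr => i _; apply: eq_theta => p; rewrite z0 scale1r; exact: upd_id.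
Qed.

Lemma coef_sum l (I : Type) (t : seq I) (P : pred I) (F : I -> A) :
  coef l (\sum_(i <- t | P i) F i) = \sum_(i <- t | P i) coef l (F i).
Proof.
apply: (big_morph (coef l) (fun P Q => coefD l P Q)).
by rewrite -(scale0r (0 : A)) coefZ mul0r.
Qed.

(** The transposed action on test indices. It is defined on all of Y, so the action on the span of
    the alternants needs no check of their linear relations. *)
Definition dual_act (X : B) (F : Y) : Y := fun i =>
  \sum_p \sum_l F (i.1.1, upd i.1.2 p (X (i.2 p) l * i.1.2 p), upd i.2 p l).

Lemma dual_act_linear X : linear (dual_act X).
Proof.
move=> c F G; apply/funext => i; rewrite /dual_act.
rewrite [RHS](_ : _ = c * (dual_act X F i) + dual_act X G i) // /dual_act.
rewrite mulr_sumr -big_split; apply: eq_bigr => p _ /=.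
by rewrite mulr_sumr -big_split.
Qed.

Lemma dual_act_theta X v :
  dual_act X (theta v) = \sum_i theta (upd v i (X *m v i)).
Proof.
apply/funext => -[[j g] u]; rewrite sum_theta.
rewrite /dual_act /theta /= [RHS]exchange_big /=.
under eq_bigr => p _ do rewrite exchange_big.
rewrite exchange_big; apply: eq_bigr => s _ /=.
rewrite [RHS](reindex_inj (@perm_inj _ s)); apply: eq_bigr => p _ /=.
rewrite (coefmx_upd _ _ _ _ _ (erefl (s p))).
rewrite (eq_bigr (fun l => \det (setrow (coefmx v j g u s) p
  (fun q => coef (j%:Z - q%:Z) (v (s p) l ord0 * (X (u p) l * g p)))))); last first.
  move=> l _; congr (\det _); apply/matrixP => a b; rewrite !mxE /upd.
  by case: eqP => // ->.
under eq_bigr => l _ do rewrite det_setrow.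
rewrite det_setrow exchange_big; apply: eq_bigr => q _ /=.
rewrite -mulr_suml mxE; congr (_ * _); rewrite mulr_suml coef_sum; apply: eq_bigr => l _.
by congr (coef _ _); ring.
Qed.

End Dual.

(** * The module spanned by the alternants *)

Section Span.
Variables (K : pzRingType) (I : Type) (i0 : I) (Y : lmodType K) (gen : I -> Y).

Definition generated : {pred Y} := [pred F | `[< forall S : Y -> Prop,
  (forall c u v, S u -> S v -> S (c *: u + v)) -> (forall i, S (gen i)) -> S F >]].

Fact generated_submod : submod_closed generated.
Proof.
split=> [|c u v /asboolP hu /asboolP hv]; apply/asboolP => S Sl Sg.
  by have := Sl (-1) _ _ (Sg i0) (Sg i0); rewrite scaleN1r addNr.
exact: Sl (hu S Sl Sg) (hv S Sl Sg).
Qed.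
End Span.

Section SpanModule.
Variables (K : numClosedFieldType) (A : comAlgType K) (r n : nat) (ev : A -> K).
Local Notation m := r.+1.
Local Notation gA := (current A m).
Local Notation B := 'M[A]_m.
Local Notation V := 'cV[A]_m.
Variables (Y : lmodType K) (theta : ('I_n -> V) -> Y) (dact : B -> Y -> Y).
Hypotheses (thetaP : symmetric_multilinear ev theta)
  (dact_linear : forall X, linear (dact X))
  (dact_theta : forall X v, dact X (theta v) = \sum_i theta (upd v i (X *m v i))).
Hypotheses (evD : forall P Q, ev (P + Q) = ev P + ev Q)
  (evZ : forall a P, ev (a *: P) = a * ev P).

Definition theta_span : {pred Y} := generated theta.

HB.instance Definition _ := GRing.isSubmodClosed.Build K Y theta_span
  (generated_submod (fun=> 0) theta).

Record span_carrier := SpanElt { span_val : Y; span_valP : span_val \in theta_span }.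
HB.instance Definition _ := [isSub for span_val].
HB.instance Definition _ := [Choice of span_carrier by <:].
HB.instance Definition _ := [SubChoice_isSubLmodule of span_carrier by <:].

Lemma span_val_sum (I : Type) (s : seq I) (P : pred I) (F : I -> span_carrier) :
  span_val (\sum_(i <- s | P i) F i) = \sum_(i <- s | P i) span_val (F i).
Proof. exact: (big_morph span_val (fun _ _ => erefl) erefl). Qed.

Fact theta_in_span v : theta v \in theta_span.
Proof. by apply/asboolP => S _; apply. Qed.

Definition span_theta v : span_carrier := SpanElt (theta_in_span v).

Lemma span_ind (S : span_carrier -> Prop) :
  (forall c u v, S u -> S v -> S (c *: u + v)) -> (forall v, S (span_theta v)) ->
  forall w, S w.
Proof.
move=> Sl Sg [F FP]; have /asboolP hF := FP.
have [FP' SF] : exists H : F \in theta_span, S (SpanElt H).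
  apply: (hF (fun F => exists H : F \in theta_span, S (SpanElt H))) => [c u v [Hu Su] [Hv Sv]|v].
    exists (rpredD (rpredZ c Hu) Hv).
    rewrite (_ : SpanElt _ = c *: SpanElt Hu + SpanElt Hv); first exact: Sl.
    exact: val_inj.
  by exists (theta_in_span v); exact: (Sg v).
by rewrite (_ : SpanElt FP = SpanElt FP') //; apply: val_inj.
Qed.

Lemma span_thetaP : symmetric_multilinear ev span_theta.
Proof.
split=> [v w e|v i x y|v i c x|v s|P v]; apply/val_inj => /=.
- exact: (sml_ext thetaP).
- exact: (smlD thetaP).
- exact: (smlZ thetaP).
- exact: (sml_perm thetaP).
- by rewrite span_val_sum; exact: (sml_scalar thetaP).
Qed.

Fact span_act_subproof (X : B) (w : span_carrier) : dact X (span_val w) \in theta_span.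
Proof.
elim/span_ind: w => [c u v hu hv|v] /=.
  by rewrite dact_linear rpredD ?rpredZ.
by rewrite dact_theta rpred_sum // => i _; apply: theta_in_span.
Qed.

Definition span_act (X : gA) (w : span_carrier) : span_carrier :=
  SpanElt (span_act_subproof (slval X) w).

Lemma span_act_linearr X c u v :
  span_act X (c *: u + v) = c *: span_act X u + span_act X v.
Proof. by apply/val_inj; rewrite /= dact_linear. Qed.

Lemma span_act_theta X v :
  span_act X (span_theta v) = \sum_i span_theta (upd v i (slval X *m v i)).
Proof.
by apply/val_inj; rewrite /= dact_theta span_val_sum.
Qed.

Lemma span_act_linearl w c (X Z : gA) :
  span_act (c *: X + Z) w = c *: span_act X w + span_act Z w.
Proof.
elim/span_ind: w => [a u v hu hv|v].
  rewrite !span_act_linearr hu hv !scalerDr !scalerA addrACA.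
  by rewrite (mulrC c).
rewrite !span_act_theta scaler_sumr -big_split; apply: eq_bigr => i _ /=.
by rewrite mulmxDl -scalemxAl (smlD span_thetaP) (smlZ span_thetaP).
Qed.

Lemma span_actD X u v : span_act X (u + v) = span_act X u + span_act X v.
Proof. by rewrite -[u]scale1r span_act_linearr !scale1r. Qed.

Lemma span_act0 X : span_act X 0 = 0.
Proof. by apply: (addrI (span_act X 0)); rewrite -span_actD !addr0. Qed.

Lemma span_act_sum X (J : Type) (s : seq J) (P : pred J) F :
  span_act X (\sum_(j <- s | P j) F j) = \sum_(j <- s | P j) span_act X (F j).
Proof. exact: (big_morph (span_act X) (span_actD X) (span_act0 X)). Qed.

(** Terms in which X and Z act in different slots cancel; in a common slot they give the matrix
    commutator. *)
Lemma span_act_lie X Z w :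
  span_act (lie X Z) w = span_act X (span_act Z w) - span_act Z (span_act X w).
Proof.
elim/span_ind: w => [a u v hu hv|v].
  by rewrite !span_act_linearr hu hv scalerBr opprD addrACA.
have two (X1 X2 : gA) : span_act X1 (span_act X2 (span_theta v)) =
    \sum_i span_theta (upd v i (slval X1 *m (slval X2 *m v i))) +
    \sum_i \sum_(j | j != i)
      span_theta (upd (upd v i (slval X2 *m v i)) j (slval X1 *m v j)).
  rewrite span_act_theta span_act_sum -big_split; apply: eq_bigr => i _ /=.
  rewrite span_act_theta (bigD1 i) //= upd_same; congr (_ + _).
    by apply: (sml_ext span_thetaP); apply: upd_upd.
  by apply: eq_bigr => j ji; rewrite upd_other.
rewrite !two [X in _ - (_ + X)](exchange_big_dep xpredT) //=.
rewrite [X in _ - (_ + X)](eq_bigr (fun i => \sum_(j | j != i)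
  span_theta (upd (upd v i (slval Z *m v i)) j (slval X *m v j)))); last first.
  move=> i _; apply: eq_big => [j|j ij]; first by rewrite eq_sym.
  apply: (sml_ext span_thetaP); apply: updC; rewrite eq_sym; exact: ij.
rewrite opprD addrACA subrr addr0 span_act_theta -sumrB; apply: eq_bigr => i _ /=.
rewrite mulmxBl !mulmxA (smlD span_thetaP); congr (_ + _).
rewrite -[RHS]scaleN1r -(smlZ span_thetaP); congr (span_theta (upd _ _ _)).
by rewrite scaleN1r scaleN1r.
Qed.

Definition span_mod : lieMod gA :=
  LieMod span_act_linearl span_act_linearr span_act_lie.

End SpanModule.

Section Expansion.
Variables (K : numClosedFieldType) (A : comAlgType K) (r n : nat) (ev : A -> K).
Local Notation m := r.+1.
Local Notation V := 'cV[A]_m.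
Variables (M : lmodType K) (Xi : ('I_n -> V) -> M).
Hypothesis XiP : symmetric_multilinear ev Xi.
Variable z : int -> A.
Hypothesis span_z : forall S : A -> Prop,
  (forall a P Q, S P -> S Q -> S (a *: P + Q)) -> (forall c, S (z c)) -> forall P, S P.

Definition monomial (a : 'I_n -> int) (u : 'I_n -> 'I_m) : 'I_n -> V :=
  fun p => z (a p) *: basisv A (u p).

Lemma upd_sum_closed (S : M -> Prop) (I : finType) (v : 'I_n -> V) i (F : I -> V) :
  (forall c u w, S u -> S w -> S (c *: u + w)) -> S 0 ->
  (forall l, S (Xi (upd v i (F l)))) -> S (Xi (upd v i (\sum_l F l))).
Proof.
move=> Sl S0 SF; elim/big_ind: _ => // [|x y hx hy].
  by rewrite (sml0 XiP (upd_same v i 0)).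
by rewrite (smlD XiP) -[X in X + _]scale1r; apply: Sl.
Qed.

Lemma monomial_span (S : M -> Prop) :
  (forall c u w, S u -> S w -> S (c *: u + w)) ->
  (forall a u, S (Xi (monomial a u))) -> forall v, S (Xi v).
Proof.
move=> Sl Sm v.
have S0 : S 0.
  by have := Sl (-1) _ _ (Sm (fun=> 0) (fun=> ord0)) (Sm (fun=> 0) (fun=> ord0));
    rewrite scaleN1r addNr.
(* The slots from k on are already monomial, so k counts those still to be expanded. *)
suff H k : (k <= n)%N -> forall v,
    (forall p : 'I_n, (k <= p)%N -> exists a u, v p = z a *: basisv A u) -> S (Xi v).
  by apply: (H n) => // p; rewrite leqNgt ltn_ord.
elim: k => [|k IH] kn {}v hv.
  have /choice[f hf] p := hv p (leq0n p); have /choice[g hg] := hf.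
  by rewrite (sml_ext XiP (w := monomial f g)).
pose i := Ordinal kn.
have vi : v i = \sum_l (v i) l ord0 *: basisv A l.
  apply/colP => a; rewrite summxE (bigD1 a) //= !mxE !eqxx mulr1.
  by rewrite big1 ?addr0 // => j /negPf ja; rewrite !mxE eq_sym ja mulr0.
rewrite -(sml_ext XiP (upd_id v i)) vi; apply: upd_sum_closed => // l.
apply: (span_z (S := fun P => S (Xi (upd v i (P *: basisv A l))))) => [a P Q hP hQ|c].
  have -> : (a *: P + Q) *: basisv A l = a%:A *: (P *: basisv A l) + Q *: basisv A l.
    by rewrite scalerDl scalerA -scalerAl mul1r.
  by rewrite (smlD XiP) (smlZ XiP); apply: Sl.
apply: IH => [|p kp]; first exact: ltnW.
have [->|pi] := eqVneq p i; first by exists c, l; rewrite upd_same.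
rewrite upd_other //; apply: hv; rewrite ltn_neqAle kp andbT.
by apply: contraNneq pi => e; apply/eqP/val_inj.
Qed.

End Expansion.

(** * Modules spanned by a symmetric multilinear map satisfy the Weyl relations *)

Section WeylOfPolarized.
Variables (K : numClosedFieldType) (A : comAlgType K) (r n : nat) (ev : A -> K).
Hypotheses (evD : forall P Q, ev (P + Q) = ev P + ev Q)
  (evZ : forall a P, ev (a *: P) = a * ev P).
Local Notation m := r.+1.
Local Notation gA := (current A m).
Local Notation B := 'M[A]_m.
Local Notation V := 'cV[A]_m.
Variables (M : lieMod gA) (Xi : ('I_n -> V) -> M).
Hypotheses (XiP : symmetric_multilinear ev Xi)
  (Xi_act : forall (X : gA) v, act X (Xi v) = \sum_i Xi (upd v i (slval X *m v i)))
  (Xi_span : forall S : M -> Prop, (forall c u w, S u -> S w -> S (c *: u + w)) ->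
    (forall v, S (Xi v)) -> forall w, S w).
Variable z : int -> A.
Hypothesis span_z : forall S : A -> Prop,
  (forall a P Q, S P -> S Q -> S (a *: P + Q)) -> (forall c, S (z c)) -> forall P, S P.
Local Notation monomial := (@monomial K A r n z).
Local Notation base := (Xi (fun=> basisv A ord0)).

Lemma Xi_monomial_span (S : M -> Prop) :
  (forall c u w, S u -> S w -> S (c *: u + w)) ->
  (forall a u, S (Xi (monomial a u))) -> forall w, S w.
Proof. by move=> Sl Sm; apply: Xi_span => //; apply: (monomial_span XiP span_z). Qed.

Lemma gl_act_Xi X v : gl_act ev n X (Xi v) = \sum_i Xi (upd v i (X *m v i)).
Proof.
rewrite /gl_act Xi_act /=; set c := m%:R^-1 *: \tr X.
under eq_bigr => i _ do rewrite mulmxBl (smlD XiP) -scaleN1r.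
have eN i : -1 *: (c%:M *m v i) = (-1)%:A *: (c *: v i).
  by rewrite mul_scalar_mx !scaleN1r.
under eq_bigr => i _ do rewrite eN (smlZ XiP).
rewrite big_split -scaler_sumr /= (sml_scalar XiP) -addrA scalerA -scalerDl.
rewrite (_ : _ + _ = 0 :> K) ?scale0r ?addr0 // /c evZ.
by rewrite mulN1r; move: (ev _) (m%:R^-1) => e q; ring.
Qed.

Definition padded k (x : nat -> V) : 'I_n -> V :=
  fun p => if (p < k)%N then x p else basisv A ord0.

(** The new factor acts as a derivation. On the k filled slots it gives the corrections that [nprod]
    subtracts; on each of the other n - k slots it turns e_0 into x k, and these results agree by
    symmetry. *)
Lemma nprod_Xi k x : (k <= n)%N ->
  nprod (gl_act (M := M) ev n) k (fun i => in_col ord0 (x i)) base =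
  (n ^_ k)%:R *: Xi (padded k x).
Proof.
elim: k x => [|k IH] x kn.
  by rewrite /= ffactn0 scale1r; apply: (sml_ext XiP) => p.
have kn' := ltnW kn.
rewrite /= IH // gl_actZr gl_act_Xi (bigID (fun p : 'I_n => (p < k)%N)) /= scalerDr.
have -> : (n ^_ k)%:R *: \sum_(i < n | (i < k)%N)
    Xi (upd (padded k x) i (in_col ord0 (x k) *m padded k x i)) =
  \sum_(j < k) nprod (gl_act (M := M) ev n) k
    (upd (fun i => in_col ord0 (x i)) j (in_col ord0 (x k) * in_col ord0 (x j))) base.
  rewrite scaler_sumr.
  rewrite (big_ord_narrow kn') /=.
  apply: eq_bigr => j _; rewrite in_colM !in_colMv.
  rewrite (@nprod_ext _ _ _ k _ (fun i =>
      in_col ord0 (upd x j ((x j) ord0 ord0 *: x k) i))) => [|i _].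
    rewrite IH //; congr (_ *: _); apply: (sml_ext XiP) => p.
    rewrite /upd /padded -val_eqE /= ltn_ord.
    by case: ifP => // /eqP ->; rewrite ltn_ord.
  by rewrite /upd; case: eqP.
rewrite addrAC subrr add0r.
rewrite (eq_bigr (fun=> Xi (padded k.+1 x))) => [|i]; last first.
  rewrite -leqNgt => ki; rewrite /padded [in X in _ *m X]ltnNge ki /= in_colMv !mxE eqxx scale1r.
  rewrite -[RHS](sml_perm XiP _ (tperm (Ordinal kn) i)); apply: (sml_ext XiP) => p /=.
  rewrite /upd; case: tpermP => [->|->|/eqP p1 /eqP p2].
  - rewrite ltnn -val_eqE /= ltnS; case: eqP => [->|/eqP ne]; first by rewrite leqnn.
    by rewrite leqNgt ltn_neqAle ne ki.
  - by rewrite eqxx /= ltnS leqnn.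
  rewrite (negPf p2) ltnS [(p <= k)%N]leq_eqVlt;  have /negPf -> // : (p : nat) != k.
  by rewrite -[k]/(val (Ordinal kn)) val_eqE.
rewrite sumr_const -scaler_nat scalerA -natrM; congr (_%:R *: _).
rewrite ffactnSr; congr (_ * _)%N.
have : (\sum_(i < n) 1 = n)%N by rewrite sum_nat_const card_ord muln1.
rewrite (bigID (fun i : 'I_n => (i < k)%N)) /= (big_ord_narrow (F := fun=> 1%N) kn').
rewrite sum_nat_const card_ord muln1 sum1_card => e.
by rewrite -[n in RHS]e addKn.
Qed.

Lemma nprod_Xi_full (v : 'I_n -> V) :
  nprod (gl_act (M := M) ev n) n (fun i => in_col ord0 (extend v i)) base =
  n`!%:R *: Xi v.
Proof.
rewrite nprod_Xi // ffactnn; congr (_ *: _); apply: (sml_ext XiP) => p.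
by rewrite /padded ltn_ord extend_ord.
Qed.

Lemma base_cyclic : cyclic_vector base.
Proof.
move=> S Sl Sa Sb; apply: Xi_span => // v.
have S0 : S 0 by have := Sl (-1) _ _ Sb Sb; rewrite scaleN1r addNr.
have SD u w : S u -> S w -> S (u + w) by move=> hu hw; rewrite -[u]scale1r; apply: Sl.
have SZ c u : S u -> S (c *: u) by move=> hu; rewrite -[_ *: _]addr0; apply: Sl.
have -> : Xi v = n`!%:R^-1 *: (n`!%:R *: Xi v).
  by rewrite scalerA mulVf ?scale1r // pnatr_eq0 -lt0n fact_gt0.
apply: (SZ); rewrite -nprod_Xi_full; move: (fun i => in_col _ _).
suff H k s : S (nprod (gl_act (M := M) ev n) k s base) by exact: H.
elim: k s => //= k IH s; apply: (SD); last by rewrite -scaleN1r; apply: (SZ); elim/big_ind: _.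
by apply: (SD); [apply: (Sa)|apply: (SZ)].
Qed.

Lemma base_nplus a P : nplus a -> act (ptens a P) base = 0.
Proof.
move=> an; rewrite Xi_act big1 // => i _; apply: (sml0 XiP (i := i)).
rewrite upd_same /= -scalemxAl -colE; apply/colP => j.
by rewrite !mxE an // rmorph0 mulr0.
Qed.

Lemma base_cartan h P : cartan h ->
  act (ptens h P) base = (n%:R * omega1 h * ev P) *: base.
Proof.
move=> /is_diag_mxP hd; rewrite Xi_act.
rewrite (eq_bigr (fun i => omega1 h *: Xi (upd (fun=> basisv A ord0) i (P *: basisv A ord0)))).
  rewrite -scaler_sumr (sml_scalar XiP) scalerA; congr (_ *: _).
  by rewrite mulrCA mulrA.
move=> i _; rewrite -(smlZ XiP); congr (Xi (upd _ _ _)).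
rewrite /= -scalemxAl -colE scalerA mulrC -scalerA; congr (_ *: _).
apply/colP => j; rewrite !mxE andbT; have [->|j0] := eqVneq j ord0; first by rewrite mulr1.
by rewrite hd // rmorph0 mulr0.
Qed.

Lemma ptens1_monomial (g : sl K m) a u :
  act (ptens g 1) (Xi (monomial a u)) =
  \sum_p \sum_l slval g l (u p) *: Xi (monomial a (upd u p l)).
Proof.
rewrite Xi_act; apply: eq_bigr => p _.
have -> : slval (ptens g 1) *m monomial a u p =
    \sum_l (slval g l (u p))%:A *: (z (a p) *: basisv A l).
  rewrite /= scale1r /monomial -scalemxAr -colE; apply/colP => j.
  rewrite summxE (bigD1 j) //= !mxE !eqxx mulr1 big1 ?addr0 => [|l /negPf lj].
    by rewrite mulrC.
  by rewrite !mxE eq_sym lj !mulr0.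
have -> : Xi (upd (monomial a u) p (\sum_l (slval g l (u p))%:A *: (z (a p) *: basisv A l))) =
    \sum_l Xi (upd (monomial a u) p ((slval g l (u p))%:A *: (z (a p) *: basisv A l))).
  apply: (big_morph (fun x => Xi (upd (monomial a u) p x))) => [x y|]; first exact: (smlD XiP).
  by apply: (sml0 XiP (i := p)); rewrite upd_same.
apply: eq_bigr => l _; rewrite (smlZ XiP); congr (_ *: _); apply: (sml_ext XiP) => q.
by rewrite /upd /monomial; case: eqP => // ->.
Qed.

(** Monomials are weight vectors. A matrix unit E_ij with i != j lowers the number of letters j in
    the word, so its (n+1)-st power vanishes. *)
Lemma monomial_integrable : integrable (res_sl M).
Proof.
split=> [|x xg].
  apply: Xi_monomial_span => [c u w [k1 [f1 [w1 ->]]] [k2 [f2 [w2 ->]]]|a u].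
    exists (k1 + k2)%N, (fun i =>
      match fintype.split i with inl i => c *: f1 i | inr i => f2 i end).
    split=> [i|].
      case: (fintype.split i) => j; last exact: w2.
      have [mu hmu] := w1 j; exists mu => h hh.
      transitivity (c *: act h (f1 j)); first exact: linearZ.
      by rewrite hmu // !scalerA mulrC.
    rewrite big_split_ord /= scaler_sumr; congr (_ + _); apply: eq_bigr => i _.
      by rewrite (unsplitK (inl i)).
    by rewrite (unsplitK (inr i)).
  exists 1%N, (fun=> Xi (monomial a u)); split; last by rewrite big_ord1.
  move=> _; exists (fun h => \sum_p slval h (u p) (u p)) => h /is_diag_mxP hd.
  rewrite [LHS]ptens1_monomial scaler_suml; apply: eq_bigr => p _.
  rewrite (bigD1 (u p)) //= big1 ?addr0 => [|l lp]; last by rewrite hd // scale0r.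
  by congr (_ *: _); apply: (sml_ext XiP) => q; rewrite /monomial upd_id.
have [i [j [ij xe]]] := xg.
have nij : i != j by apply/eqP => e; rewrite e in ij; lia.
have itl N c (u w : M) : iter N (act (ptens x 1)) (c *: u + w) =
    c *: iter N (act (ptens x 1)) u + iter N (act (ptens x 1)) w.
  by elim: N => //= N ->; rewrite act_linearr.
have it0 N : iter N (act (ptens x 1)) (0 : M) = 0 by elim: N => //= N ->; rewrite linear0.
suff H (v : M) : iter n.+1 (act (ptens x 1)) v = 0 by move=> v; exists n.+1; exact: H.
move: v; apply: Xi_monomial_span => [c u w hu hw|a u].
  by rewrite itl hu hw scaler0 addr0.
suff H N (w : 'I_n -> 'I_m) : (#|[set p | w p == j]| < N)%N ->
    iter N (act (ptens x 1)) (Xi (monomial a w)) = 0.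
  by apply: H; rewrite ltnS -[X in (_ <= X)%N](card_ord n) max_card.
elim: N w => // N IH w cw; rewrite iterSr ptens1_monomial.
have itD (u1 u2 : M) : iter N (act (ptens x 1)) (u1 + u2) =
    iter N (act (ptens x 1)) u1 + iter N (act (ptens x 1)) u2.
  by have := itl N 1 u1 u2; rewrite !scale1r.
rewrite (big_morph _ itD (it0 N)) big1 // => p _.
rewrite (big_morph _ itD (it0 N)) big1 // => l _.
rewrite xe mxE; case: andP => [[/eqP -> /eqP wp]|_]; last by rewrite scale0r it0.
rewrite scale1r; apply: IH; rewrite -ltnS; apply: leq_trans cw; rewrite ltnS.
apply: proper_card; apply/properP; split.
  by apply/subsetP => q; rewrite !inE /upd; case: (q == p) => //; rewrite (negPf nij).
by exists p; rewrite !inE ?wp // upd_same.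
Qed.

Lemma base_weyl : weyl_type ev (fun h => n%:R * omega1 h) base.
Proof.
split; [exact: monomial_integrable|exact: base_cyclic| |].
  by move=> a P; apply: base_nplus.
by move=> h P; apply: base_cartan.
Qed.

End WeylOfPolarized.

(** * Linear independence *)

Lemma leq_sum_eq (I : finType) (F G : I -> nat) : (forall i, (F i <= G i)%N) ->
  (\sum_i G i <= \sum_i F i)%N -> forall i, F i = G i.
Proof.
move=> le ge i; apply/eqP; rewrite eqn_leq le /= leqNgt; apply/negP => lt.
move: ge; apply/negP; rewrite -ltnNge (bigD1 i) //= [X in (_ < X)%N](bigD1 i) //=.
by rewrite -addSn leq_add // leq_sum.
Qed.

Section Compatible.
Variable n : nat.
Implicit Types (D E : {set 'I_n.+1}) (a b : {ffun 'I_n.+1 -> int}) (c p q : 'I_n.+1).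
Implicit Types (s t : 'S_n.+1).

(** The condition for the permutation t to contribute to a determinant of monomials with exponents a
    tested against b: every slotwise product is nonzero in A and has exponent c - t p. *)
Definition compatible a b c t :=
  [forall p, (0 <= a p * b p) && (a p + b p == c%:Z - (t p)%:Z)].

Lemma compatibleP a b c t :
  reflect (forall p, 0 <= a p * b p /\ a p + b p = c%:Z - (t p)%:Z) (compatible a b c t).
Proof.
apply: (iffP forallP) => h p; have := h p; first by case/andP => -> /eqP ->.
by case=> -> ->; rewrite eqxx.
Qed.

Lemma compatible_height a b c t : compatible a b c t ->
  (height a + height b)%N = (\sum_(p < n.+1) `|c%:Z - p%:Z|)%N.
Proof.
move=> /compatibleP h; rewrite /height -big_split /=.
rewrite [RHS](reindex_inj (@perm_inj _ t)) /=; apply: eq_bigr => p _.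
by have [sg <-] := h p; nia.
Qed.

(** The triangle inequality for each pair of slots; equality in all of them means that a and b are
    ordered alike. *)
Lemma compatible_spread a b c t : compatible a b c t ->
  (\sum_(p < n.+1) \sum_(q < n.+1) `|p%:Z - q%:Z| <= spread a + spread b)%N /\
  ((spread a + spread b <= \sum_(p < n.+1) \sum_(q < n.+1) `|p%:Z - q%:Z|)%N ->
    forall p q, 0 <= (a p - a q) * (b p - b q)).
Proof.
move=> /compatibleP h.
have -> : (\sum_(p < n.+1) \sum_(q < n.+1) `|p%:Z - q%:Z|)%N =
    (\sum_(i : 'I_n.+1 * 'I_n.+1) `|(t i.1)%:Z - (t i.2)%:Z|)%N.
  rewrite -(pair_bigA _ (fun p q : 'I_n.+1 => `|(t p)%:Z - (t q)%:Z|%N)) /=.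
  rewrite (reindex_inj (@perm_inj _ t)); apply: eq_bigr => p _.
  by rewrite (reindex_inj (@perm_inj _ t)).
have -> : (spread a + spread b)%N = (\sum_(i : 'I_n.+1 * 'I_n.+1)
    (`|a i.1 - a i.2| + `|b i.1 - b i.2|))%N.
  rewrite /spread big_split /=.
  by rewrite -(pair_bigA _ (fun p q => `|a p - a q|%N)) -(pair_bigA _ (fun p q => `|b p - b q|%N)).
have le (i : 'I_n.+1 * 'I_n.+1) :
    (`|(t i.1)%:Z - (t i.2)%:Z| <= `|a i.1 - a i.2| + `|b i.1 - b i.2|)%N.
  by have [_ e1] := h i.1; have [_ e2] := h i.2; lia.
split=> [|eq p q]; first exact: leq_sum.
have := leq_sum_eq le eq (p, q) => /=; have [_ e1] := h p; have [_ e2] := h q.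
have -> : (t p)%:Z - (t q)%:Z = - ((a p - a q) + (b p - b q)) by lia.
by move: (a p - a q) (b p - b q) => x y; nia.
Qed.

Lemma stepexp_compatible D c : ord0 \notin D ->
  compatible (stepexp D c) (stepexp (codesc D) c) c 1%g.
Proof.
move=> D0; apply/compatibleP => p; rewrite !ffunE perm1.
have ec := step_codesc c D0; have ep := step_codesc p D0; split; last by lia.
have [cp|pc] := leqP c p.
  have := step_homo D cp; have := step_homo (codesc D) cp; nia.
by have := step_homo D (ltnW pc); have := step_homo (codesc D) (ltnW pc); nia.
Qed.

Lemma stepexp_similar D E c : forall p q,
  0 <= (stepexp D c p - stepexp D c q) * (stepexp E c p - stepexp E c q).
Proof.
move=> p q; rewrite !ffunE; have [pq|/ltnW pq] := leqP p q;
  by have := step_homo D pq; have := step_homo E pq; nia.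
Qed.

Lemma stepexp_inj D E c d : cut D c -> cut E d -> stepexp E d = stepexp D c ->
  E = D /\ d = c.
Proof.
move=> /andP[D0 cD] /andP[E0 dE] /ffunP eq.
have e0 : step E d = step D c.
  by have := eq ord0; rewrite !ffunE !step0 //; lia.
have es p : step E p = step D p by have := eq p; rewrite !ffunE e0; lia.
have ED : E = D.
  apply/setP => d'; have [->|d0] := eqVneq d' ord0; first by rewrite (negPf D0) (negPf E0).
  by have [p pe] := pred_ord d0; apply: negb_inj; rewrite -!(step_succ _ pe) !es.
split=> //; subst E; apply/val_inj; case: (ltngtP d c) => // lt.
  have c0 : c != ord0 by apply: contraTneq lt => ->.
  rewrite (negPf c0) /= in cD.
  suff : (step D d < step D c)%N by rewrite e0 ltnn.
  by apply/step_ltP; [exact: ltnW|exists c; rewrite // lt leqnn].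
have c0 : d != ord0 by apply: contraTneq lt => ->.
rewrite (negPf c0) /= in dE.
suff : (step D c < step D d)%N by rewrite e0 ltnn.
by apply/step_ltP; [exact: ltnW|exists d; rewrite // lt leqnn].
Qed.

(* The exponents of [E, d] are forced to have the height of those of [D, c]; if
   moreover they are not more spread, the triangle inequality for spreads is an
   equality, which makes both exponents similarly ordered. *)
Lemma compatible_stepexp D E c d s t : cut D c -> cut E d ->
  compatible (pword s (stepexp E d)) (stepexp (codesc D) c) c t ->
  height (stepexp E d) = height (stepexp D c) /\
  ((spread (stepexp E d) <= spread (stepexp D c))%N ->
   [/\ E = D, d = c, t \in stab (step (codesc D)) & (t^-1 * s)%g \in stab (step D)]).
Proof.
move=> cutD cutE; have /andP[D0 _] := cutD.
set a := stepexp D c; set a' := stepexp E d; set b := stepexp _ c => comp.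
have self := stepexp_compatible c D0; rewrite -/a -/b in self.
split.
  have := compatible_height comp; rewrite height_pword -(compatible_height self).
  by move/addIn.
move=> sp; have [_ sim] := compatible_spread comp.
have [_ /(_ _) selfle] := compatible_spread self.
have tot : (spread a + spread b = \sum_(p < n.+1) \sum_(q < n.+1) `|p%:Z - q%:Z|)%N.
  rewrite /spread -big_split; apply: eq_bigr => p _; rewrite -big_split.
  apply: eq_bigr => q _ /=; have := stepexp_similar D (codesc D) c p q.
  rewrite -/a -/b; have /compatibleP sf := self; have [_ ] := sf p; have [_] := sf q.
  rewrite !perm1 => e1 e2.
  have -> : p%:Z - q%:Z = - ((a p - a q) + (b p - b q)) by lia.
  by move: (a p - a q) (b p - b q) => x y; nia.
have {}sim p q : 0 <= (a' (s p) - a' (s q)) * (b p - b q).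
  by have := sim; rewrite spread_pword -tot leq_add2r => /(_ sp p q); rewrite !ffunE.
have /compatibleP cp := comp; have /compatibleP sf := self.
have cpE p : a' (s p) + b p = c%:Z - (t p)%:Z.
  by have [_] := cp p; rewrite [pword _ _ _]ffunE.
have bt p : b (t p) = b p.
  pose f p : int := (step (codesc D) p)%:Z.
  have fE p' : b p' = f c - f p' by rewrite ffunE.
  have mono : forall p : 'I_n.+1, f ((t^-1)%g p) = f p.
    apply: monotone_perm => p1 q1 pq1; first by rewrite lez_nat; exact: step_homo.
    rewrite leNgt; apply/negP => lt; move: pq1; apply/negP; rewrite -ltnNge.
    have := sim ((t^-1)%g p1) ((t^-1)%g q1).
    have := cpE ((t^-1)%g p1); have := cpE ((t^-1)%g q1).
    by rewrite !permKV !fE; nia.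
  by rewrite !fE -(mono (t p)) permK.
have at' p : a' (s p) = a (t p).
  have [_] := sf (t p); rewrite perm1 => e; have := cpE p; rewrite -e bt; lia.
have aE p : a' ((t^-1 * s)%g p) = a p by rewrite permM at' permKV.
have a'E p : a' ((t^-1 * s)%g p) = a' p.
  have mono : forall p : 'I_n.+1, - a' ((t^-1 * s)%g p) = - a' p.
    apply: (@monotone_perm _ (fun p => - a' p)) => p1 q1 pq1.
      by have := step_homo E pq1; rewrite !ffunE; lia.
    by rewrite !aE; have := step_homo D pq1; rewrite !ffunE; lia.
  by apply: oppr_inj; exact: mono.
have aa : a' = a by apply/ffunP => p; rewrite -a'E aE.
have [eE ed] := stepexp_inj cutD cutE aa; split=> //.
  by apply/stabP => p; have := bt p; rewrite !ffunE; lia.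
by apply/stabP => p; have := aE p; rewrite aa /a !ffunE; lia.
Qed.

Lemma compatible_self D c s t : ord0 \notin D ->
  t \in stab (step (codesc D)) -> s \in stab (step D) ->
  compatible (pword (t * s)%g (stepexp D c)) (stepexp (codesc D) c) c t.
Proof.
move=> D0 /stabP ht /stabP hs; apply/compatibleP => p.
have /compatibleP/(_ (t p)) := stepexp_compatible c D0; rewrite perm1 !ffunE permM.
by rewrite hs ht.
Qed.

End Compatible.

(** * Evaluation of alternants at complementary exponents *)

Section Injectivity.
Variables (K : numClosedFieldType) (A : comAlgType K) (m n : nat).
Variables (z : int -> A) (coef : int -> A -> K) (ev : A -> K).
Hypotheses (coef0 : forall l, coef l 0 = 0)
  (coef_zz : forall l c d, coef l (z c * z d) = ((0 <= c * d) && (c + d == l))%:R).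
Local Notation word := {ffun 'I_n.+1 -> 'I_m}.
Local Notation fn := {ffun word -> K^o}.
Local Notation Theta := (@theta K A m n.+1 coef).
Hypothesis ThetaP : symmetric_multilinear ev Theta.
Implicit Types (a b : {ffun 'I_n.+1 -> int}) (j c : 'I_n.+1) (s t : 'S_n.+1).
Implicit Types (u x : word) (F G : fn) (D E : {set 'I_n.+1}).

Lemma theta_monomial a b j u x :
  Theta (fun p => z (a p) *: delta_mx (u p) ord0) (j, (fun p => z (b p)), (fun p => x p)) =
  \sum_(s : 'S_n.+1) \sum_(t : 'S_n.+1)
    (-1) ^+ t * (compatible (pword s a) b j t)%:R * (pword s u == x)%:R.
Proof.
rewrite /theta; apply: eq_bigr => s _; rewrite /determinant; apply: eq_bigr => t _.
rewrite -mulrA; congr (_ * _); have [<-|ne] := eqVneq (pword s u) x.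
  rewrite mulr1.
  rewrite (eq_bigr (fun p => ((0 <= pword s a p * b p) &&
      (pword s a p + b p == j%:Z - (t p)%:Z))%:R)) => [|p _]; last first.
    by rewrite !mxE !ffunE /= ffunE !eqxx mulr1 coef_zz.
  case: (boolP (compatible _ _ _ _)) => [/forallP h|].
    by rewrite big1 // => p _; rewrite h.
  rewrite /compatible negb_forall => /existsP[p /negPf hp].
  by rewrite (bigD1 p) //= hp mul0r.
rewrite mulr0; have [p hp] : exists p, u (s p) != x p.
  apply/existsP; rewrite -negb_forall; apply: contraNN ne => /forallP h.
  by apply/eqP/ffunP => p; rewrite ffunE; apply/eqP.
rewrite (bigD1 p) //= !mxE [x p == _]eq_sym (negPf hp) mulr0 mul0r coef0 mul0r //.
Qed.

Lemma bracket_theta F a b j x :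
  bracket Theta z F a (j, (fun p => z (b p)), (fun p => x p)) =
  \sum_(s : 'S_n.+1) \sum_(t : 'S_n.+1)
    (-1) ^+ t * (compatible (pword s a) b j t)%:R * pfun s^-1%g F x.
Proof.
rewrite /bracket.
transitivity (\sum_u F u * Theta (fun p => z (a p) *: delta_mx (u p) ord0)
    (j, (fun p => z (b p)), (fun p => x p))).
  by elim/big_rec2: _ => // u y1 y2 _ <-.
under eq_bigr => u _.
  rewrite theta_monomial mulr_sumr.
  under eq_bigr => s _ do rewrite mulr_sumr.
  over.
rewrite exchange_big; apply: eq_bigr => s _ /=.
rewrite exchange_big; apply: eq_bigr => t _ /=.
rewrite (bigD1 (pword s^-1%g x)) //= pwordM mulgV pword1 eqxx mulr1 big1 ?addr0.
  by rewrite ffunE mulrC.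
move=> u ne; case: eqP => [e|]; last by rewrite !mulr0.
by case/eqP: ne; rewrite -e pwordM mulVg pword1.
Qed.

Lemma bracket_theta_eq0 F a b j : (forall s t, ~~ compatible (pword s a) b j t) ->
  forall x, bracket Theta z F a (j, (fun p => z (b p)), (fun p => x p)) = 0.
Proof.
move=> h x; rewrite bracket_theta big1 // => s _; rewrite big1 // => t _.
by rewrite (negPf (h s t)) mulr0 mul0r.
Qed.

(** By [compatible_stepexp] only t in the Young subgroup of [codesc D] and s in its coset under that
    of D contribute. The signed sum over t is the antisymmetrizer, and the sum over s gives the
    factor. *)
Lemma bracket_theta_diag D c F x : cut D c -> symmetric_on (step D) F ->
  bracket Theta z F (stepexp D c)
    (c, (fun p => z (stepexp (codesc D) c p)), (fun p => x p)) =
  #|stab (step D)|%:R * alt (step (codesc D)) F x.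
Proof.
move=> cutD symF; have /andP[D0 _] := cutD.
rewrite bracket_theta exchange_big /=.
rewrite (bigID (fun t => t \in stab (step (codesc D)))) /= [X in _ + X]big1 ?addr0; last first.
  move=> t tn; rewrite big1 // => s _.
  case: (boolP (compatible _ _ _ _)) => [comp|_]; last by rewrite mulr0 mul0r.
  have [_ /(_ (leqnn _))] := compatible_stepexp cutD cutD comp.
  by case=> _ _; rewrite (negPf tn).
rewrite altE mulr_sumr [RHS](reindex_inj invg_inj) /=.
apply: eq_big => [t|t ts]; first by rewrite stab_invr.
rewrite (reindex_inj (mulgI t)) (bigID (fun s => s \in stab (step D))) /=.
rewrite [X in _ + X]big1 ?addr0; last first.
  move=> s sn; case: (boolP (compatible _ _ _ _)) => [comp|_]; last by rewrite mulr0 mul0r.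
  have [_ /(_ (leqnn _))] := compatible_stepexp cutD cutD comp.
  by case=> _ _ _; rewrite mulKg (negPf sn).
rewrite (eq_bigr (fun=> (-1) ^+ t * F (pword t^-1%g x))) => [|s sD]; last first.
  rewrite compatible_self // mulr1; congr (_ * _).
  by rewrite invMg -pfunM symF ?stab_invr // ffunE.
by rewrite sumr_const odd_permV mulr_natl.
Qed.

(** Each symmetrization S D c vanishes by [descent_core]. Its antisymmetrization is read off at
    complementary exponents. Merging blocks at i gives a multiple of S (D without i) c, of smaller
    height, or 0 by admissibility when i = c. *)
Lemma theta_assemble_injective w : admissible w -> assemble Theta z w = 0 ->
  forall c, w c = 0.
Proof.
move=> adm w0.
pose S (E : {set 'I_n.+1}) d := sym (step E) (w d).
(* The exponents complementary to (D, c) detect only (D, c) itself and pairs of the same height and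
   larger spread, already known to contribute 0. *)
have vanish D c : cut D c ->
    (forall E d, cut E d -> height (stepexp E d) = height (stepexp D c) ->
      (spread (stepexp D c) < spread (stepexp E d))%N -> S E d = 0) ->
    alt (step (codesc D)) (S D c) = 0.
  move=> cutD IH; apply/ffunP => x; rewrite [RHS]ffunE.
  pose pt := (c, (fun p => z (stepexp (codesc D) c p)), (fun p => x p)) : dual_index A m n.+1.
  have term E d : cut E d -> bracket Theta z (w d) (stepexp E d) =
      #|stab (step E)|%:R^-1 *: bracket Theta z (S E d) (stepexp E d).
    move=> _; rewrite (bracket_sym z ThetaP) ?scalerA ?mulVf ?scale1r ?card_stab_neq0 //.
    by move=> p q; rewrite !ffunE => ->.
  have : assemble Theta z w pt = 0 by rewrite w0.
  rewrite /assemble.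
  have sumE (I : Type) (r : seq I) (P : pred I) (G : I -> dual_index A m n.+1 -> K^o) :
      (\sum_(i <- r | P i) G i) pt = \sum_(i <- r | P i) G i pt.
    by elim/big_rec2: _ => // i y1 y2 _ <-.
  have off E d : cut E d -> ~~ ((E == D) && (d == c)) ->
      bracket Theta z (w d) (stepexp E d) pt = 0.
    move=> cutE ne; rewrite term //.
    have [[s [t comp]]|no] := pselect (exists s t,
        compatible (pword s (stepexp E d)) (stepexp (codesc D) c) c t).
      have [hh hs] := compatible_stepexp cutD cutE comp.
      have [le|lt] := leqP (spread (stepexp E d)) (spread (stepexp D c)).
        by have [e1 e2 _ _] := hs le; rewrite e1 e2 !eqxx in ne.
      by rewrite IH // bracket0 scaler0.
    rewrite -[LHS]/(_ * _) bracket_theta_eq0 ?mulr0 // => s t; apply/negP => comp.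
    by apply: no; exists s, t.
  rewrite sumE (bigD1 D) //= sumE (bigD1 c) //=.
  rewrite [X in _ + X + _]big1 => [|d /andP[cutd dc]]; last first.
    by rewrite off // negb_and dc orbT.
  rewrite [X in _ + X]big1 => [|E ED]; last first.
    by rewrite sumE big1 // => d cutd; rewrite off // negb_and ED.
  rewrite !addr0 term //; set X := bracket _ _ _ _.
  rewrite -[(_ *: X) pt]/(_ * X pt) [X pt]bracket_theta_diag //; last exact: sym_symmetric.
  by rewrite mulKf ?card_stab_neq0.
pose top := (n.+1 * (n.+1 * n.+1))%N.
have topP D c : (spread (stepexp D c) <= top)%N.
  have -> : top = (\sum_(p < n.+1) \sum_(q < n.+1) n.+1)%N.
    by rewrite !sum_nat_const !card_ord.
  apply: leq_sum => p _; apply: leq_sum => q _.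
  by rewrite !ffunE; have := step_le D p; have := step_le D q; lia.
have main h k D c : cut D c -> (height (stepexp D c) < h)%N ->
    (top - spread (stepexp D c) < k)%N -> S D c = 0.
  elim: h k D c => // h IHh; elim=> // k IHk D c cutD hD sD.
  have /andP[D0 cD] := cutD.
  apply: (descent_core D0 (@sym_symmetric _ _ _ _ _)) => [|i iD].
    apply: vanish => // E d cutE hE sE; apply: IHk => //; first by rewrite hE.
    by have := topP E d; lia.
  rewrite sym_subset; last by move=> s; apply: stab_step_sub; exact: subD1set.
  have [ic|ic] := eqVneq i c.
    subst i; have c0 : c != ord0 by apply: contraNneq D0 => <-.
    have [p pe] := pred_ord c0.
    have /(sym_pfun (w c)) : tperm p c \in stab (step (D :\ c)).
      by apply/stab_tperm/eqP; rewrite (step_succ _ pe) !inE eqxx.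
    rewrite adm // raddfN /= => /eqP; rewrite eq_sym -addr_eq0 -mulr2n -scaler_nat.
    by rewrite scaler_eq0 pnatr_eq0 /= => /eqP ->; rewrite scaler0.
  have cutDi : cut (D :\ i) c.
    rewrite /cut !inE (negPf D0) andbF /=; case/orP: cD => ->; rewrite ?orbT //.
    by rewrite [c == i]eq_sym ic orbT.
  rewrite -/(S _ _) (IHh (top.+1)) ?scaler0 //; last by rewrite ltnS leq_subr.
  rewrite -ltnS; apply: leq_trans hD; rewrite ltnS.
  by apply: height_stepexp_lt => //; apply: properD1.
(* With every nonzero position a descent the Young subgroup is trivial, so S D c is w c itself. *)
move=> c; pose D : {set 'I_n.+1} := [set p | p != ord0].
have cutD : cut D c by rewrite /cut !inE eqxx /=; case: eqP.
have stepD p : step D p = p.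
  have D0 : ord0 \notin D by rewrite inE eqxx.
  rewrite -[RHS](step_codesc p D0) -[LHS]addn0; congr (_ + _)%N.
  apply/esym/eqP; rewrite cards_eq0 -subset0; apply/subsetP => q.
  by rewrite !inE negbK; case: (q == ord0).
have : S D c = 0 by apply: (main _ _ _ _ cutD (ltnSn _) (ltnSn _)).
rewrite /S sym_id => [/eqP|s /stabP ss].
  by rewrite scaler_eq0 (negPf (card_stab_neq0 _ _)) => /eqP.
rewrite (_ : s = 1%g) ?pfun1 //; apply/permP => p; apply/val_inj.
by have := ss p; rewrite !stepD perm1.
Qed.

End Injectivity.

(** * Coordinates of the target and the isomorphism *)

Lemma lie_isomorphic_of_bijective (K : comNzRingType) (L : lieAlgType K)
    (M N : lieMod L) (h : N -> M) :
  linear h -> (forall u, h u = 0 -> u = 0) -> (forall v, exists u, h u = v) ->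
  lie_equivariant h -> lie_isomorphic M N.
Proof.
move=> hl hi hs he.
have inj u v : h u = h v -> u = v.
  move=> e; apply/eqP; rewrite -subr_eq0; apply/eqP/hi.
  by rewrite -[u - v]addrC -scaleN1r hl e scaleN1r addNr.
have [f hf] := choice hs.
have fl : linear f by move=> c u v; apply: inj; rewrite hl !hf.
pose F : {linear M -> N} := HB.pack f (GRing.isLinear.Build K M N *:%R f fl).
exists F; split.
  by exists h => [v|u] /=; [rewrite hf|apply: inj; rewrite hf].
by move=> x v /=; apply: inj; rewrite he !hf.
Qed.

Definition scons (T : Type) (x : T) (u : nat -> T) : nat -> T :=
  fun i => if i is j.+1 then u j else x.

Section TensorEvaluation.
Variables (K : comNzRingType) (r : nat).
Local Notation m := r.+1.
Variable M : lieMod (sl K m).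
Local Notation g := (sl K m).
Implicit Types (u v : nat -> 'I_m) (a : g).

(* The coordinate of a tensor on e_(u 0) (x) ... (x) e_(u (k-1)). *)
Fixpoint tens_coord k : tens_pow k M -> (nat -> 'I_m) -> M :=
  match k return tens_pow k M -> (nat -> 'I_m) -> M with
  | 0 => fun t _ => t
  | k'.+1 => fun t u => @tens_coord k' ((t : {ffun 'I_m -> tens_pow k' M}) (u 0%N)) (u \o S)
  end.

Lemma tens_coord_linear k c (t s : tens_pow k M) u :
  tens_coord (c *: t + s) u = c *: tens_coord t u + tens_coord s u.
Proof. by elim: k t s u => //= k IH t s u; rewrite !ffunE IH. Qed.

Lemma tens_coordD k (t s : tens_pow k M) u :
  tens_coord (t + s) u = tens_coord t u + tens_coord s u.
Proof. by rewrite -[t]scale1r tens_coord_linear !scale1r. Qed.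

Lemma tens_coord0 k u : tens_coord (0 : tens_pow k M) u = 0.
Proof. by apply: (addrI (tens_coord (0 : tens_pow k M) u)); rewrite -tens_coordD !addr0. Qed.

Lemma tens_coordZ k c (t : tens_pow k M) u : tens_coord (c *: t) u = c *: tens_coord t u.
Proof. by rewrite -[c *: t]addr0 tens_coord_linear tens_coord0 addr0. Qed.

Lemma tens_coord_local k (t : tens_pow k M) u v :
  (forall i, (i < k)%N -> u i = v i) -> tens_coord t u = tens_coord t v.
Proof.
elim: k t u v => //= k IH t u v uv; rewrite uv //; apply: IH => i ik /=.
exact: uv.
Qed.

Lemma tens_coord_inj k (t : tens_pow k M) : (forall u, tens_coord t u = 0) -> t = 0.
Proof.
elim: k t => [|k IH] t h; first exact: (h (fun=> ord0)).
apply/ffunP => i; rewrite [RHS]ffunE; apply: IH => u.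
exact: (h (scons i u)).
Qed.

Lemma tens_coord_surj k (G : (nat -> 'I_m) -> M) :
  (forall u v, (forall i, (i < k)%N -> u i = v i) -> G u = G v) ->
  exists t : tens_pow k M, forall u, tens_coord t u = G u.
Proof.
elim: k G => [|k IH] G loc.
  by exists (G (fun=> ord0)) => u; apply: loc.
have step i : exists t : tens_pow k M, forall u, tens_coord t u = G (scons i u).
  by apply: IH => u v uv; apply: loc => -[|j] //= jk; apply: uv.
have [f hf] := choice step.
exists [ffun i => f i] => u /=; rewrite ffunE hf; apply: loc; by case.
Qed.

Lemma tens_coord_act k a (t : tens_pow k M) u :
  tens_coord (act a t) u = act a (tens_coord t u) +
  \sum_(p < k) \sum_l slval a (u p) l *: tens_coord t (upd u p l).
Proof.
elim: k t u => [|k IH] t u; first by rewrite big_ord0 addr0.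
rewrite /= ffunE tens_coordD IH -addrA; congr (_ + _).
rewrite [RHS]big_ord_recl addrC; congr (_ + _).
rewrite (big_morph (fun t => tens_coord t (u \o S))
  (fun t s => tens_coordD t s (u \o S)) (tens_coord0 k (u \o S))).
by apply: eq_bigr => l _; rewrite tens_coordZ.
Qed.

End TensorEvaluation.

(** * Tensors as functions on words *)

Section WordFunctions.
Variables (K : numClosedFieldType) (r n : nat).
Local Notation m := r.+1.
Local Notation word := {ffun 'I_n.+1 -> 'I_m}.
Local Notation fn := {ffun word -> K^o}.
Local Notation g := (sl K m).
Implicit Types (a : g) (x : word) (F : fn) (u v : nat -> 'I_m) (s : 'S_n.+1).

Definition word_upd x p l : word := [ffun q => if q == p then l else x q].
Definition word_seq x : nat -> 'I_m := fun i => x (inord i).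
Definition seq_word u : word := [ffun p : 'I_n.+1 => u p].

Lemma word_seqK : cancel word_seq seq_word.
Proof. by move=> x; apply/ffunP => p; rewrite ffunE /word_seq inord_val. Qed.

Lemma seq_wordK u i : (i < n.+1)%N -> word_seq (seq_word u) i = u i.
Proof. by move=> h; rewrite /word_seq ffunE inordK. Qed.

Lemma word_seq_upd x (p : 'I_n.+1) l i : (i < n.+1)%N ->
  word_seq (word_upd x p l) i = upd (word_seq x) p l i.
Proof. by move=> h; rewrite /word_seq /upd ffunE -val_eqE /= inordK. Qed.

Definition word_act a F : fn :=
  [ffun x : word => \sum_p \sum_l slval a (x p) l * F (word_upd x p l)].

Section Tensors.

Definition tens_fn (t : tens_pow n.+1 (triv_mod g)) : fn :=
  [ffun x : word => tens_coord t (word_seq x)].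

Lemma tens_fn_linear c t t' : tens_fn (c *: t + t') = c *: tens_fn t + tens_fn t'.
Proof. by apply/ffunP => x; rewrite !ffunE tens_coord_linear. Qed.

Lemma tens_fn_inj t : tens_fn t = 0 -> t = 0.
Proof.
move=> /ffunP h; apply: tens_coord_inj => u; have := h (seq_word u).
rewrite !ffunE => <-; apply: tens_coord_local => i hi; exact/esym/seq_wordK.
Qed.

Lemma tens_fn_surj F : exists t, tens_fn t = F.
Proof.
have [|t ht] := @tens_coord_surj K r (triv_mod g) n.+1 (fun u => F (seq_word u)).
  move=> u v uv; congr (F _); apply/ffunP => p; rewrite !ffunE; exact: uv.
by exists t; apply/ffunP => x; rewrite ffunE ht word_seqK.
Qed.

Lemma tens_fn_act a t : tens_fn (act a t) = word_act a (tens_fn t).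
Proof.
apply/ffunP => x; rewrite !ffunE tens_coord_act.
rewrite [act a _](_ : _ = 0) // add0r.
apply: eq_bigr => p _; apply: eq_bigr => l _.
rewrite ffunE (tens_coord_local (v := upd (word_seq x) p l) t) => [|i hi].
  by rewrite /word_seq inord_val.
exact: word_seq_upd.
Qed.

End Tensors.

Section Wedges.
Variables (k : nat) (s : 'S_n.+1).
Hypothesis nk : n = k.+1.
Local Notation T := (tens_pow k (wedge2_mod K m)).
Local Notation ik := (inord k : 'I_n.+1).
Local Notation ik1 := (inord k.+1 : 'I_n.+1).

Definition wedge_coord (t : T) u : K := w2val (tens_coord t u) (u k) (u k.+1).

(** The exterior square occupies the last two tensor factors; s carries these places to the pair
    where antisymmetry is wanted. *)
Definition wedge_fn (t : T) : fn := [ffun x : word => wedge_coord t (word_seq (pword s x))].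

Lemma wedge_coord_local t u v : (forall i, (i < n.+1)%N -> u i = v i) ->
  wedge_coord t u = wedge_coord t v.
Proof.
rewrite nk => uv; rewrite /wedge_coord !uv // (@tens_coord_local _ _ _ _ _ _ v) // => i ik.
by apply: uv; rewrite !ltnS ltnW // ltnW.
Qed.

Lemma wedge_fn_linear c t t' : wedge_fn (c *: t + t') = c *: wedge_fn t + wedge_fn t'.
Proof.
by apply/ffunP => x; rewrite !ffunE /wedge_coord tens_coord_linear /= !mxE.
Qed.

Lemma val_ik : ik = k :> nat.
Proof. by rewrite inordK // nk. Qed.

Lemma val_ik1 : ik1 = k.+1 :> nat.
Proof. by rewrite inordK // nk. Qed.

Definition last_two u (i j : 'I_m) : word :=
  seq_word (fun p => if (p < k)%N then u p else if p == k then i else j).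

Lemma wedge_coord_last_two t u i j :
  wedge_coord t (word_seq (last_two u i j)) = w2val (tens_coord t u) i j.
Proof.
have -> : w2val (tens_coord t u) i j = wedge_coord t
    (fun p => if (p < k)%N then u p else if p == k then i else j).
  rewrite /wedge_coord ltnn eqxx ltnNge leqnSn /= (gtn_eqF (ltnSn k)).
  by rewrite -(@tens_coord_local _ _ _ _ t u) // => p ->.
apply: wedge_coord_local => p hp; exact: seq_wordK.
Qed.

Lemma wedge_fn_inj t : wedge_fn t = 0 -> t = 0.
Proof.
move=> /ffunP h; apply: tens_coord_inj => u; apply/val_inj/matrixP => i j /=.
have := h (pword s^-1%g (last_two u i j)).
by rewrite !ffunE pwordM mulgV pword1 wedge_coord_last_two mxE.
Qed.

Lemma last_two_swap u i j : last_two u j i = pword (tperm ik ik1) (last_two u i j).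
Proof.
apply/ffunP => p; rewrite !ffunE.
have k1 : (k.+1 < k)%N = false by rewrite ltnNge leqnSn.
case: tpermP => [->|->|/eqP p1 /eqP p2].
- by rewrite val_ik val_ik1 ltnn eqxx k1 (gtn_eqF (ltnSn k)).
- by rewrite val_ik val_ik1 ltnn eqxx k1 (gtn_eqF (ltnSn k)).
have pk : (p < k)%N.
  have /eqP e1 : (p : nat) != k by rewrite -val_ik val_eqE.
  have /eqP e2 : (p : nat) != k.+1 by rewrite -val_ik1 val_eqE.
  by have := ltn_ord p; move: e1 e2 nk; lia.
by rewrite pk.
Qed.

Lemma wedge_fn_antisym t : pfun (tperm (s ik) (s ik1)) (wedge_fn t) = - wedge_fn t.
Proof.
apply/ffunP => x; rewrite !ffunE pwordM.
set u := word_seq (pword s x).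
have E : pword s x = last_two u (u k) (u k.+1).
  apply/ffunP => p; rewrite ffunE [RHS]ffunE /u /word_seq.
  case: ifP => pk; first by rewrite inord_val ffunE.
  case: eqP => [<-|/eqP pk']; first by rewrite inord_val ffunE.
  have -> : inord k.+1 = p; last by rewrite ffunE.
  apply/val_inj; rewrite /= val_ik1; have := ltn_ord p; by move: pk pk' nk; lia.
have -> : pword (s * tperm (s ik) (s ik1)) x = last_two u (u k.+1) (u k).
  rewrite last_two_swap -E pwordM; congr (pword _ x).
  by rewrite -tpermJ conjgE !mulgA mulgV mul1g.
rewrite wedge_coord_last_two /wedge_coord.
have /matrixP/(_ (u k) (u k.+1)) := w2valP (tens_coord t u); by rewrite !mxE.
Qed.

Lemma wedge_fn_surj F : pfun (tperm (s ik) (s ik1)) F = - F -> exists t, wedge_fn t = F.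
Proof.
move=> anti.
have sw u i j : F (pword s^-1%g (last_two u j i)) = - F (pword s^-1%g (last_two u i j)).
  have /ffunP/(_ (pword s^-1%g (last_two u i j))) := anti.
  rewrite !ffunE => <-; congr (F _); rewrite last_two_swap !pwordM; congr (pword _ _).
  by rewrite -tpermJ conjgE -!mulgA mulgV mulg1.
have mxP u : \matrix_(i, j) F (pword s^-1%g (last_two u i j)) \in @antisymmetric_mx K m.
  by apply/eqP/matrixP => i j; rewrite !mxE sw.
have [|t ht] := @tens_coord_surj K r (wedge2_mod K m) k (fun u => Wedge2 (mxP u)).
  move=> u v uv; apply/val_inj/matrixP => i j; rewrite /= !mxE.
  congr (F (pword _ _)); apply/ffunP => p; rewrite !ffunE.
  by case: ifP => // /uv.
exists t; apply/ffunP => x; rewrite ffunE /wedge_coord ht /= mxE.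
congr (F _); rewrite -[RHS]pword1 -(mulVg s) -pwordM; congr (pword _ _).
rewrite -[RHS]word_seqK; apply/ffunP => p; rewrite !ffunE.
case: ifP => pk //; case: eqP => [->//|/eqP pk'].
congr (word_seq _ _); have := ltn_ord p; by move: pk pk' nk; lia.
Qed.

Lemma wedge_coord_act a t u : wedge_coord (act a t) u =
  \sum_(p < k.+2) \sum_l slval a (u p) l * wedge_coord t (upd u p l).
Proof.
rewrite big_ord_recr [X in _ = X + _]big_ord_recr /= {1}/wedge_coord tens_coord_act.
have sumE (I : finType) (G : I -> wedge2 K m) i j :
    w2val (\sum_i G i) i j = \sum_l w2val (G l) i j.
  have -> : w2val (\sum_i G i) = \sum_i w2val (G i).
    exact: (big_morph (@w2val K m) (fun _ _ => erefl) erefl).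
  by rewrite summxE.
rewrite [w2val (_ + _)]/(w2val _ + w2val _) mxE sumE addrC -addrA; congr (_ + _).
  apply: eq_bigr => p _; rewrite sumE; apply: eq_bigr => l _; rewrite /= mxE; congr (_ * _).
  by rewrite /wedge_coord !upd_other // ?gtn_eqF // ltnS ltnW.
rewrite mxE; congr (_ + _); rewrite mxE; apply: eq_bigr => l _.
  congr (_ * _); rewrite /wedge_coord upd_same upd_other ?gtn_eqF //.
  rewrite -(@tens_coord_local _ _ _ _ t u (upd u k l)) // => i hi.
  by rewrite upd_other // ltn_eqF.
rewrite mulrC mxE; congr (_ * _); rewrite /wedge_coord upd_same upd_other ?ltn_eqF //.
rewrite -(@tens_coord_local _ _ _ _ t u (upd u k.+1 l)) // => i hi.
by rewrite upd_other // ltn_eqF // ltnW.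
Qed.

Lemma wedge_fn_act a t : wedge_fn (act a t) = word_act a (wedge_fn t).
Proof.
apply/ffunP => x; rewrite !ffunE wedge_coord_act.
rewrite [RHS](reindex_inj (@perm_inj _ s)) /=.
have -> : k.+2 = n.+1 by rewrite nk.
apply: eq_bigr => p _; apply: eq_bigr => l _.
rewrite /word_seq inord_val !ffunE; congr (_ * _).
apply: wedge_coord_local => i hi.
have -> : pword s (word_upd x (s p) l) = word_upd (pword s x) p l.
  by apply/ffunP => q; rewrite !ffunE (inj_eq perm_inj).
by rewrite [RHS](word_seq_upd _ p l hi).
Qed.

End Wedges.
End WordFunctions.

Section Equivariance.
Variables (K : numClosedFieldType) (A : comAlgType K) (r n : nat) (ev : A -> K).
Local Notation m := r.+1.
Local Notation gA := (current A m).
Local Notation V := 'cV[A]_m.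
Variables (M : lieMod gA) (Xi : ('I_n.+1 -> V) -> M) (z : int -> A).
Hypotheses (XiP : symmetric_multilinear ev Xi)
  (Xi_act : forall (X : gA) v, act X (Xi v) = \sum_i Xi (upd v i (slval X *m v i))).
Local Notation word := {ffun 'I_n.+1 -> 'I_m}.
Local Notation fn := {ffun word -> K^o}.

Lemma bracket_word_act (g : sl K m) (F : fn) a :
  bracket Xi z (word_act g F) a = act (ptens g 1) (bracket Xi z F a).
Proof.
rewrite /bracket linear_sum /=.
pose X (u : word) := Xi (monomial z a u).
transitivity (\sum_(u : word) \sum_p \sum_l (slval g (u p) l * F (word_upd u p l)) *: X u).
  apply: eq_bigr => u _; rewrite ffunE scaler_suml; apply: eq_bigr => p _.
  by rewrite scaler_suml.
transitivity (\sum_(u : word) \sum_p \sum_l (slval g l (u p) * F u) *: X (word_upd u p l)).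
  rewrite exchange_big [RHS]exchange_big /=; apply: eq_bigr => p _.
  rewrite !pair_big /=.
  (* Exchanging the old and the new letter at p turns the action on coordinates into the action on
     basis vectors. *)
  pose h (i : word * 'I_m) := (word_upd i.1 p i.2, i.1 p).
  have hK : involutive h.
    move=> [u l]; rewrite /h /=; congr (_, _); last by rewrite ffunE eqxx.
    by apply/ffunP => q; rewrite !ffunE; case: eqP => // ->.
  rewrite (reindex_inj (inv_inj hK)) /=; apply: eq_bigr => -[u l] _ /=.
  have -> : word_upd (word_upd u p l) p (u p) = u.
    by apply/ffunP => q; rewrite !ffunE; case: eqP => // ->.
  by rewrite ffunE eqxx.
apply: eq_bigr => u _; rewrite linearZ /= (ptens1_monomial XiP Xi_act) scaler_sumr.
apply: eq_bigr => p _; rewrite scaler_sumr; apply: eq_bigr => l _.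
rewrite scalerA mulrC; congr (_ *: _); apply: (sml_ext XiP) => q.
by rewrite /monomial ffunE.
Qed.

Lemma assemble_word_act (g : sl K m) w :
  assemble Xi z (fun c => word_act g (w c)) = act (ptens g 1) (assemble Xi z w).
Proof.
rewrite /assemble linear_sum; apply: eq_bigr => D _ /=.
by rewrite linear_sum; apply: eq_bigr => c _ /=; rewrite bracket_word_act.
Qed.

End Equivariance.

Section Transfer.
Variables (K : numClosedFieldType) (A : comAlgType K) (r n : nat) (ev : A -> K).
Local Notation m := r.+1.
Local Notation gA := (current A m).
Local Notation V := 'cV[A]_m.
Hypotheses (evZ : forall a P, ev (a *: P) = a * ev P).
Variables (M N : lieMod gA) (f : {linear M -> N}) (Xi : ('I_n -> V) -> N) (v0 : M).
Hypotheses (XiP : symmetric_multilinear ev Xi)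
  (Xi_act : forall (X : gA) v, act X (Xi v) = \sum_i Xi (upd v i (slval X *m v i)))
  (f_equiv : lie_equivariant f) (f_v0 : f v0 = Xi (fun=> basisv A ord0)).

(** An equivariant f commutes with [gl_act], hence with normal ordered products; the factorial is
    that of [nprod_Xi_full]. *)
Lemma equivariant_polar v : f (polar ev v0 v) = n`!%:R *: Xi v.
Proof.
rewrite -(nprod_Xi_full evZ XiP Xi_act) -f_v0 /polar.
suff H k s : f (nprod (gl_act (M := M) ev n) k s v0) =
    nprod (gl_act (M := N) ev n) k s (f v0) by exact: H.
elim: k s => //= k IH s; rewrite linearB linear_sum /= /gl_act linearD linearZ /=.
rewrite f_equiv IH; congr (_ - _); apply: eq_bigr => j _; exact: IH.
Qed.

End Transfer.

(** * Assembling the isomorphism *)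

Section Iso.
Variables (K : numClosedFieldType) (A : comAlgType K) (r n k : nat).
Variables (ev : A -> K) (z : int -> A) (coef : int -> A -> K) (x y : A).
Hypotheses (evD : forall P Q, ev (P + Q) = ev P + ev Q)
  (evZ : forall a P, ev (a *: P) = a * ev P)
  (ev_z : forall c, ev (z c) = (c == 0)%:R)
  (z0 : z 0 = 1)
  (xz : forall c, x * z c = if 0 <= c then z (c + 1) else 0)
  (yz : forall c, y * z c = if c <= 0 then z (c - 1) else 0)
  (span_z : forall S : A -> Prop,
     (forall a P Q, S P -> S Q -> S (a *: P + Q)) -> (forall c, S (z c)) -> forall P, S P)
  (coefD : forall l P Q, coef l (P + Q) = coef l P + coef l Q)
  (coefZ : forall l a P, coef l (a *: P) = a * coef l P)
  (coef_zM : forall l c P,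
     coef l (z c * P) = if 0 <= c * (l - c) then coef (l - c) P else 0)
  (coef_zz : forall l c d, coef l (z c * z d) = ((0 <= c * d) && (c + d == l))%:R).
Local Notation m := r.+1.
Local Notation gA := (current A m).
Local Notation V := 'cV[A]_m.
Hypotheses (r_gt0 : (0 < r)%N) (nk : (0 < n)%N -> n = k.+1).
Variables (W : lieMod gA) (w0 : W).
Hypothesis hW : local_weyl_module ev (fun h => n.+1%:R * omega1 h) w0.
Local Notation word := {ffun 'I_n.+1 -> 'I_m}.
Local Notation fn := {ffun word -> K^o}.

Let ev1 : ev 1 = 1.
Proof. by rewrite -z0 ev_z. Qed.

Let ev_x l : ev (x ^+ l.+1) = 0.
Proof.
have -> : x ^+ l.+1 = z l.+1; last by rewrite ev_z.
elim: l => [|l IH]; first by rewrite expr1 -[x]mulr1 -z0 xz.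
by rewrite exprS IH xz /=; congr z; lia.
Qed.

Let ev_y l : ev (y ^+ l.+1) = 0.
Proof.
have -> : y ^+ l.+1 = z (- l.+1%:Z); last by rewrite ev_z oppr_eq0.
elim: l => [|l IH]; first by rewrite expr1 -[y]mulr1 -z0 yz.
by rewrite exprS IH yz oppr_le0 /=; congr z; lia.
Qed.

Let W_weyl : weyl_type ev (fun h => n.+1%:R * omega1 h) w0.
Proof. by case: hW. Qed.

Local Notation Xi := (@polar K A r ev W n.+1 w0).

Lemma polarP : symmetric_multilinear ev Xi.
Proof.
split.
- exact: eq_polar.
- exact: polarD.
- exact: polarZ.
- exact: polar_perm.
- exact: polar_scalar.
Qed.

Lemma thetaP : symmetric_multilinear ev (@theta K A m n.+1 coef).
Proof.
split.
- exact: eq_theta.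
- exact: thetaD.
- exact: thetaZ.
- exact: theta_perm.
- exact: (theta_scalar coefD coefZ coef_zM z0 span_z evD evZ ev_z).
Qed.

(** Universality of W enters here: it provides a map to the module of alternants, under which a
    relation among assembled families persists up to a factorial. *)
Lemma polar_assemble_injective w : admissible w -> assemble Xi z w = 0 ->
  forall c, w c = 0.
Proof.
move=> adm w_eq0.
have coef0 l : coef l 0 = 0 by rewrite -(scale0r (0 : A)) coefZ mul0r.
apply: (theta_assemble_injective coef0 coef_zz thetaP adm).
pose N := span_mod thetaP (@dual_act_linear K A m n.+1) (dual_act_theta coefD coefZ).
pose gen v : N := span_theta (@theta K A m n.+1 coef) v.
have genP : symmetric_multilinear ev gen := span_thetaP thetaP.
have gen_act (X : gA) v : act X (gen v) = \sum_i gen (upd v i (slval X *m v i)).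
  exact: span_act_theta.
have gen_span (S : N -> Prop) : (forall c u w, S u -> S w -> S (c *: u + w)) ->
    (forall v, S (gen v)) -> forall w, S w by exact: span_ind.
have [_ /(_ N _ (base_weyl evZ genP gen_act gen_span span_z))] := hW.
case=> f [f_equiv _ f_w0].
have fE := equivariant_polar evZ genP gen_act f_equiv f_w0.
have f_assemble : f (assemble Xi z w) = n.+1`!%:R *: assemble gen z w.
  rewrite linear_sum scaler_sumr; apply: eq_bigr => D _ /=.
  rewrite linear_sum scaler_sumr; apply: eq_bigr => c _ /=.
  rewrite linear_sum scaler_sumr; apply: eq_bigr => u _ /=.
  by rewrite linearZ /= fE !scalerA mulrC.
have gen0 : assemble gen z w = 0.
  move: f_assemble; rewrite w_eq0 linear0 => /esym/eqP.
  by rewrite scaler_eq0 pnatr_eq0 -leqn0 leqNgt fact_gt0 => /eqP.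
have : assemble (W := span_carrier (@theta K A m n.+1 coef)) gen z w = 0 by exact: gen0.
move/(congr1 (@span_val K A r n.+1 _ (@theta K A m n.+1 coef))).
rewrite /assemble span_val_sum => e; rewrite -[RHS]e; apply: eq_bigr => D _.
rewrite span_val_sum; apply: eq_bigr => c _; rewrite /bracket span_val_sum.
exact: eq_bigr.
Qed.

Lemma polar_assemble_surjective v : exists2 w, admissible w & v = assemble Xi z w.
Proof.
have lin (c : K) (v1 v2 : W) : (exists2 w, admissible w & v1 = assemble Xi z w) ->
    (exists2 w, admissible w & v2 = assemble Xi z w) ->
    exists2 w, admissible w & c *: v1 + v2 = assemble Xi z w.
  move=> [w1 a1 ->] [w2 a2 ->]; exists (fun i => c *: w1 i + w2 i).
    by move=> p i e; rewrite linearP /= a1 // a2 // scalerN opprD.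
  by rewrite assemble_linear.
apply: (polar_span evD evZ ev1 r_gt0 W_weyl lin) => {}v.
apply: (monomial_span polarP span_z lin) => a u.
have [w adm e] := assemble_surjective polarP ev_x ev_y xz yz
  [ffun w : word => (w == finfun u)%:R : K^o] (finfun a).
exists w => //; rewrite -e /bracket (bigD1 (finfun u)) //= !ffunE eqxx scale1r.
rewrite big1 ?addr0 => [|i /negPf ne]; last by rewrite ffunE ne scale0r.
by apply: eq_polar => p; rewrite /monomial !ffunE.
Qed.

(** The places j and j+1 are those on which [admissible] imposes antisymmetry for the cut j+1. *)
Fact exists_shuffle (j : 'I_n) :
  exists s : 'S_n.+1, s (inord k) = widen_ord (leqnSn n) j /\ s (inord k.+1) = lift ord0 j.
Proof.
have nk1 : n = k.+1 by apply: nk; apply: leq_ltn_trans (ltn_ord j).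
set i := inord k; set i' := inord k.+1; set p := widen_ord _ _; set p' := lift _ _.
have ii : i != i'.
  by rewrite -val_eqE /= !inordK ?nk1 // ltn_eqF.
have pp : p != p' by rewrite -val_eqE /= /bump leq0n ltn_eqF.
exists (tperm i p * tperm (tperm i p i') p')%g; rewrite !permM.
have ne : tperm i p i' != p.
  by rewrite -[X in _ != X](tpermL i p) (inj_eq perm_inj) eq_sym.
by split; rewrite tpermL // (tpermD ne) // eq_sym.
Qed.

Definition shuffle j : 'S_n.+1 := sval (cid (exists_shuffle j)).

Lemma shuffle_antisym j :
  tperm (shuffle j (inord k)) (shuffle j (inord k.+1)) =
  tperm (widen_ord (leqnSn n) j) (lift ord0 j).
Proof. by have [-> ->] := svalP (cid (exists_shuffle j)). Qed.

Local Notation target :=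
  (dsum (tens_pow n.+1 (triv_mod (sl K m))) (copies n (tens_pow k (wedge2_mod K m)))).

(** Here n is one less than the number of tensor factors: cut 0 carries the full tensor power, and
    each of the n cuts j+1 carries one copy of the summand with the exterior square. *)
Definition family (t : target) (c : 'I_n.+1) : fn :=
  if unlift ord0 c is Some j then
    wedge_fn (shuffle j) ((t.2 : {ffun 'I_n -> tens_pow k (wedge2_mod K m)}) j)
  else tens_fn t.1.

Lemma family_linear c t t' : family (c *: t + t') = (fun i => c *: family t i + family t' i).
Proof.
apply/funext => i; rewrite /family; case: unliftP => [j|] _; last exact: tens_fn_linear.
rewrite -wedge_fn_linear; congr (wedge_fn _ _).
have e (p q : {ffun 'I_n -> tens_pow k (wedge2_mod K m)}) : (c *: p + q) j = c *: p j + q j.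
  by rewrite !ffunE.
exact: e.
Qed.

Lemma family_act g t : family (act g t) = (fun i => word_act g (family t i)).
Proof.
apply/funext => i; rewrite /family; case: unliftP => [j|] _; last exact: tens_fn_act.
rewrite -wedge_fn_act; last by apply: nk; apply: leq_ltn_trans (ltn_ord j).
by congr (wedge_fn _ _); rewrite ffunE.
Qed.

Lemma family_admissible t : admissible (family t).
Proof.
move=> p c pc; rewrite /family; case: unliftP => [j|] cE; last by rewrite cE in pc.
have <- := wedge_fn_antisym (shuffle j); last by apply: nk; apply: leq_ltn_trans (ltn_ord j).
rewrite shuffle_antisym cE; congr (pfun (tperm _ _) _); apply/val_inj.
by move: pc; rewrite cE => -[].
Qed.

Lemma family_inj t : (forall c, family t c = 0) -> t = 0.
Proof.
move=> h; suff [e1 e2] : t.1 = 0 /\ t.2 = 0 by move: e1 e2; case: (t) => a b /= -> ->.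
split; first by have := h ord0; rewrite /family unlift_none => /tens_fn_inj.
apply/ffunP => j; rewrite [RHS]ffunE; have := h (lift ord0 j); rewrite /family liftK.
by apply: wedge_fn_inj; apply: nk; apply: leq_ltn_trans (ltn_ord j).
Qed.

Lemma family_surj w : admissible w -> exists t, family t = w.
Proof.
move=> adm; have [t1 ht1] := tens_fn_surj (w ord0).
have h (j : 'I_n) : exists t : tens_pow k (wedge2_mod K m),
    wedge_fn (shuffle j) t = w (lift ord0 j) :> fn.
  apply: wedge_fn_surj; first by apply: nk; apply: leq_ltn_trans (ltn_ord j).
  by rewrite shuffle_antisym adm.
have [t2 ht2] := choice h; exists (t1, [ffun j => t2 j]).
apply/funext => i; rewrite /family; case: unliftP => [j|] ->; last exact: ht1.
by rewrite ffunE.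
Qed.

Lemma local_weyl_iso : lie_isomorphic (res_sl W) target.
Proof.
apply: (lie_isomorphic_of_bijective (h := fun t => assemble Xi z (family t) : res_sl W)).
- by move=> c t t'; rewrite family_linear; apply: assemble_linear.
- move=> t /polar_assemble_injective h; apply: family_inj; apply: h.
  exact: family_admissible.
- move=> v; have [w adm ->] := polar_assemble_surjective v.
  by have [t <-] := family_surj adm; exists t.
move=> g t; rewrite family_act.
by apply: (assemble_word_act z polarP); apply: act_polar.
Qed.

End Iso.

Theorem proposition2 (R : realType) (r n : nat) (hr : (1 <= r)%N) (hn : (1 <= n)%N)
  (W : lieMod (current (cross_ring R[i]) r.+1)) (w0 : W)
  (hW : local_weyl_module (@cross_eval0 R[i]) (fun h => n%:R * omega1 h) w0) :
  lie_isomorphic (res_sl W)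
    (dsum (tens_pow n (triv_mod (sl R[i] r.+1)))
          (copies n.-1 (tens_pow (n - 2) (wedge2_mod R[i] r.+1)))).
Proof.
case: n hn hW => // n _ hW.
apply: (local_weyl_iso (@cross_eval0D _) (@cross_eval0Z _) (@cross_eval0_zpow _)
  (zpow0 _) (@zpowX _) (@zpowY _) (@cross_ind _) (@coefD _) (@coefZ _)
  (@coef_zpowM _) (@coef_zpow_zpow _) hr _ hW).
(* With truncated subtraction the exponent n - 2 is correct from two tensor factors on; for a single
   one there are no copies. *)
by case: n {hW}=> // n _; rewrite !subSS subn0.
Qed.
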